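(* Suppose $G$ is $\mathrm{GL}_n(D)$, $\mathrm{SL}_n(D)$ or a classical group, and suppose $\mathrm{d}\phi=\{Y,H,X\}$ is a Lie triple in $\mathfrak{g}$, with corresponding homomorphism $\phi\colon \mathrm{SL}_2(k)\to G$. Let $G^\phi$ be the centralizer of $\phi(\mathrm{SL}_2(k))$ in $G$. Then $\mathcal{B}(Y,H,X)=\mathcal{B}(G)^{\phi(\mathrm{SL}_2(\mathcal{R}))}$, and there is a natural $G^\phi$-equivariant identification $$\mathcal{B}(G)^{\phi(\mathrm{SL}_2(\mathcal{R}))}=\mathcal{B}(G^\phi).$$
   Context: $k$ is a local non-archimedean field with integer ring $\mathcal{R}$ and residual characteristic $p\neq 2$; $D$ is a central division algebra over $k$ with ring of integers $\mathcal{R}_D$. Let $\mathbf{G}$ be the algebraic group with $G=\mathbf{G}(k)$, $\mathfrak{g}=\mathrm{Lie}(\mathbf{G})(k)$, and let $h$ be the maximal Coxeter number of an irreducible component of the absolute root system of $\mathbf{G}$. Assume $p>3(h-1)$ (so the characteristic of $k$ is $0$ or greater than $3(h-1)$). A classical group is a group $G=\mathrm{U}(V,F)$ of isometries of a non-degenerate sesquilinear ($\epsilon$-hermitian) form $F\colon V\times V\to D$ on a finite-rank free right $D$-module $V$. A Lie triple is a nonzero set $\{Y,H,X\}\subset\mathfrak{g}$ with $[H,X]=2X$, $[H,Y]=-2Y$, $[X,Y]=H$. Under the hypotheses it corresponds to a unique homomorphism of algebraic groups $\phi\colon\mathbf{SL}_2\to\mathbf{G}$ over $k$ with $\mathrm{d}\phi\begin{pmatrix}0&0\\1&0\end{pmatrix}=Y$,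 $\mathrm{d}\phi\begin{pmatrix}1&0\\0&-1\end{pmatrix}=H$, $\mathrm{d}\phi\begin{pmatrix}0&1\\0&0\end{pmatrix}=X$. $\mathcal{B}(\cdot)$ denotes the (enlarged) Bruhat–Tits building over $k$. For $x\in\mathcal{B}(G)$, $\mathfrak{g}_{x,0}$ is the $\mathcal{R}$-lattice in $\mathfrak g$ attached to $x$ by Bruhat–Tits theory (the Moy–Prasad lattice of depth $0$), and $$\mathcal{B}(Y,H,X)=\{x\in\mathcal{B}(G)\mid \{Y,H,X\}\subset\mathfrak{g}_{x,0}\}.$$ $\mathcal{B}(G)^{\phi(\mathrm{SL}_2(\mathcal{R}))}$ is the set of points fixed by $\phi(\mathrm{SL}_2(\mathcal{R}))$. Concretely, $\mathcal{B}(\mathrm{GL}(V,D))$ is the set of lattice functions on $V$, i.e. decreasing left-continuous maps $t\mapsto\mathcal{V}_t$ from $\mathbb{R}$ to $\mathcal{R}_D$-lattices in $V$, periodic in the sense that multiplication by a uniformizer $\varpi_D$ of $D$ shifts $t$ by the valuation of $\varpi_D$; $\mathfrak{g}_{x,0}$ is then the stabilizer in $\mathfrak{g}$ of all the lattices $\mathcal{V}_{x,t}$. For a classical group $\mathrm{U}(V,F)$ the building is the set of self-dual lattice functions with respect to $F$. For $G=\mathrm{GL}(V,D)$ (resp. $\mathrm{U}(V,F)$), $G^\phi$ is a product of groups $\mathrm{GL}(M^i,D)$ (resp. of isometry groups $\mathrm{U}(M^i,\gamma^i)$ of non-degenerate forms), where $M^i=\mathrm{Hom}_{\mathfrak{sl}_2(k)}(U_i,V)$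 and $U_i$ runs over the irreducible $\mathfrak{sl}_2(k)$-modules occurring in $V$; $\mathcal{B}(G^\phi)$ is the product of the corresponding buildings. ''Identification'' means a bijection.
   Formalization: If k has characteristic p, dφ does not determine φ (Frobenius twists have the same differential and break the claim), so the corresponding homomorphism is there required to send the elementary unipotents with parameter t to the truncated exponentials of tX and tY. *)

(* Defs.v *)
From mathcomp Require Import all_boot all_order all_algebra falgebra.
From mathcomp Require Import boolp classical_sets functions reals.
From mathcomp Require Import constructive_ereal.

Set Implicit Arguments.
Unset Strict Implicit.
Unset Printing Implicit Defensive.

Import Order.TTheory GRing.Theory Num.Theory VectorInternalTheory.

Local Open Scope classical_set_scope.
Local Open Scope ring_scope.

(** * Valued fields and division algebras *)

Definition is_valuation (RR : realType) (K : nzRingType) (v : K -> \bar RR) :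
    Prop :=
  [/\ forall x, v x != -oo%E,
      forall x, v x = +oo%E <-> x = 0,
      forall x y, v (x * y) = (v x + v y)%E
    & forall x y, (Order.min (v x) (v y) <= v (x + y)%R)%E].

Definition v_complete (RR : realType) (K : nzRingType) (v : K -> \bar RR) :
    Prop :=
  forall u : nat -> K,
    (forall e : nat, exists N, forall m n, (N <= m)%N -> (N <= n)%N ->
       ((e%:R)%:E <= v (u m - u n)%R)%E) ->
    exists l, forall e : nat, exists N, forall n, (N <= n)%N ->
       ((e%:R)%:E <= v (u n - l)%R)%E.

(* [val] is the valuation normalised by val(k^x) = Z; [p] is the residual
   characteristic. *)
Definition is_local_field (RR : realType) (k : fieldType) (val : k -> \bar RR)
    (p : nat) : Prop :=
  [/\ is_valuation val,
      forall z : \bar RR, (exists2 a, a != 0 & val a = z) <->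
                          (exists n : int, z = (n%:~R)%:E),
      v_complete val,
      exists s : seq k, forall a, (0 <= val a)%E ->
        exists2 b, b \in s & (0 < val (a - b)%R)%E
    & prime p /\ (0 < val p%:R%R)%E].

Definition integers (RR : realType) (K : nzRingType) (v : K -> \bar RR) :
  set K := [set a | (0 <= v a)%E].

Definition uniformizer (RR : realType) (K : nzRingType) (v : K -> \bar RR)
    (w : K) : Prop :=
  [/\ w != 0, (0 < v w)%E & forall a, (0 < v a)%E -> (v w <= v a)%E].

Definition is_division (D : unitRingType) : Prop :=
  forall a : D, a != 0 -> a \is a GRing.unit.

(** * Lattices *)

Definition span_over (K : nzRingType) (W : lmodType K) (S : set K)
    (s : seq W) : set W :=
  [set w | exists2 c : nat -> K, (forall i, S (c i)) &
           w = \sum_(i < size s) c i *: s`_i].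

(* [L] is a finitely generated [S]-submodule of [W] spanning the [K]-submodule
   [M]; here [S] will be the ring of integers of [K]. *)
Definition is_lattice (K : nzRingType) (W : lmodType K) (S : set K)
    (M L : set W) : Prop :=
  exists2 s : seq W, L = span_over S s & M = span_over setT s.

(** * Right D-modules *)

(* Right D-modules are left modules over the converse ring D^c. *)
Definition rscale (k : fieldType) (D : falgType k) (W : lmodType D^c)
  (w : W) (a : D) : W := (a : D^c) *: w.

Definition kscale (k : fieldType) (D : falgType k) (W : lmodType D^c)
  (a : k) (w : W) : W := rscale w (a%:A : D).

(* Points of buildings are decreasing families of lattices in a right D-module
   [M], which is given as a submodule of an ambient right D-module [W]. *)
Definition is_latfun (RR : realType) (k : fieldType) (D : falgType k)
    (nu : D -> \bar RR) (W : lmodType D^c) (M : set W) (x : RR -> set W) :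
    Prop :=
  [/\ forall t, is_lattice (integers nu : set D^c) M (x t),
      forall s t, s <= t -> x t `<=` x s,
      forall t, x t = \bigcap_(s in [set s | s < t]) x s
    & forall (w : D) (r t : RR), uniformizer nu w -> nu w = r%:E ->
        x (t + r) = [set rscale v w | v in x t]].

(** * Hermitian forms *)

(* Under [fixed_center], [k] is the field of elements of the centre of [D]
   fixed by [sigma]; both kinds of involutions are allowed. *)
Definition is_involution (k : fieldType) (D : falgType k) (sigma : D -> D) :
    Prop :=
  [/\ forall a b, sigma (a + b) = sigma a + sigma b,
      forall a b, sigma (a * b) = sigma b * sigma a
    & forall a, sigma (sigma a) = a].

Definition fixed_center (k : fieldType) (D : falgType k) (sigma : D -> D) :
    Prop :=
  forall z : D, (z \in 'Z({:D})%VS /\ sigma z = z) <-> exists a : k, z = a%:A.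

Definition is_hermitian (k : fieldType) (D : falgType k) (sigma : D -> D)
    (eps : k) (W : lmodType D^c) (M : set W) (F : W -> W -> D) : Prop :=
  [/\ forall f g1 g2, M f -> M g1 -> M g2 -> F f (g1 + g2) = F f g1 + F f g2,
      forall f g a b, M f -> M g ->
        F (rscale f a) (rscale g b) = sigma a * F f g * b,
      forall f g, M f -> M g -> F g f = eps *: sigma (F f g)
    & forall f, M f -> (forall g, M g -> F f g = 0) -> f = 0].

(* L^# = { f in M | F(f, L) is contained in the maximal ideal of R_D }. *)
Definition dual_lattice (RR : realType) (k : fieldType) (D : falgType k)
    (nu : D -> \bar RR) (W : lmodType D^c) (F : W -> W -> D)
    (M L : set W) : set W :=
  [set f | M f /\ forall g, L g -> (0 < nu (F f g))%E].

(* (x^#)_t is the dual of x_{(-t)+}, the union of the x_s for s > -t.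
   In terms of the norm alpha(v) = sup {t | v in x_t}, this is the dual norm
   v |-> inf_w (nu (F v w) - alpha w). *)
Definition dual_latfun (RR : realType) (k : fieldType) (D : falgType k)
    (nu : D -> \bar RR) (W : lmodType D^c) (F : W -> W -> D) (M : set W)
    (x : RR -> set W) : RR -> set W :=
  fun t => dual_lattice nu F M (\bigcup_(s in [set s | - t < s]) x s).

Definition is_selfdual_latfun (RR : realType) (k : fieldType) (D : falgType k)
    (nu : D -> \bar RR) (W : lmodType D^c) (F : W -> W -> D) (M : set W)
    (x : RR -> set W) : Prop :=
  is_latfun nu M x /\ x = dual_latfun nu F M x.

(** * The groups *)

(* GL(V,D), SL(V,D) and U(V,F) for an eps-hermitian form F with respect to
   the involution sigma of D. *)
Inductive group_kind (k : fieldType) (D : falgType k) (V : vectType D^c) :=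
  | GL
  | SL
  | U of (D -> D) & k & (V -> V -> D).

Arguments GL {k D V}.
Arguments SL {k D V}.

Definition admissible (k : fieldType) (D : falgType k) (V : vectType D^c)
    (G : group_kind V) : Prop :=
  match G with
  | GL | SL => 'Z({:D})%VS = 1%VS :> {vspace D}
  | U sigma eps F =>
      [/\ is_involution sigma, fixed_center sigma, eps = 1 \/ eps = -1
        & is_hermitian sigma eps setT F]
  end.

(* The matrix over D of a D-endomorphism [f] in a basis (b_j) of V
   (f b_j = sum_i b_i A_ij), with its entries replaced by their images under
   rho : D -> M_d(E). When D is central of degree d over k and rho is k-linear,
   the determinant and the trace of this matrix are the reduced norm and the
   reduced trace of [f]. *)
Definition split_mx (k : fieldType) (D : falgType k) (V : vectType D^c)
    (E : fieldType) (d : nat) (rho : D -> 'M[E]_d) (f : 'End(V)) :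
    'M[E]_(\sum_(i < dim V) d) :=
  \mxblock_(i < dim V, j < dim V)
    rho (v2r (f (r2v (delta_mx 0 j))) 0 i : D).

Definition has_splitting (k : fieldType) (D : falgType k) (d : nat)
    (P : forall E : fieldType, (D -> 'M[E]_d) -> Prop) : Prop :=
  exists (E : fieldType) (iota : {rmorphism k -> E})
         (rho : {rmorphism D -> 'M[E]_d}),
    (forall a : k, rho a%:A = (iota a)%:M) /\ P E rho.

Definition red_norm_one (k : fieldType) (D : falgType k) (d : nat)
    (V : vectType D^c) (g : 'End(V)) : Prop :=
  @has_splitting k D d (fun E rho => \det (split_mx rho g) = 1).

Definition red_trace_zero (k : fieldType) (D : falgType k) (d : nat)
    (V : vectType D^c) (A : 'End(V)) : Prop :=
  @has_splitting k D d (fun E rho => \tr (split_mx rho A) = 0).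

Definition is_invertible (K : nzRingType) (V : vectType K) (g : 'End(V)) :
    Prop :=
  exists h : 'End(V), (g \o h)%VF = \1%VF /\ (h \o g)%VF = \1%VF.

(* G as a subset of End_D(V); [d] is the degree of [D]. *)
Definition group_set (k : fieldType) (D : falgType k) (d : nat)
    (V : vectType D^c) (G : group_kind V) : set 'End(V) :=
  match G with
  | GL => [set g | is_invertible g]
  | SL => [set g | is_invertible g /\ red_norm_one d g]
  | U _ _ F => [set g | is_invertible g /\ forall v w, F (g v) (g w) = F v w]
  end.

Definition lie_set (k : fieldType) (D : falgType k) (d : nat)
    (V : vectType D^c) (G : group_kind V) : set 'End(V) :=
  match G with
  | GL => setT
  | SL => [set A | red_trace_zero d A]
  | U _ _ F => [set A | forall v w, F (A v) w + F v (A w) = 0]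
  end.

(** * Absolute root systems *)

Inductive dynkin := An of nat | Bn of nat | Cn of nat | Dn of nat.

Definition coxeter (T : dynkin) : nat :=
  match T with
  | An m => m.+1
  | Bn m | Cn m => m.*2
  | Dn m => (m.-1).*2
  end.

(* Irreducible components of the root systems of GL_N (or SL_N), Sp_N, O_N. *)
Definition linear_type (N : nat) : seq dynkin :=
  if (N <= 1)%N then [::] else [:: An N.-1].

Definition symplectic_type (N : nat) : seq dynkin :=
  if (N <= 1)%N then [::] else [:: Cn N./2].

Definition orthogonal_type (N : nat) : seq dynkin :=
  if (N <= 2)%N then [::]
  else if odd N then [:: Bn N./2]
  else if N == 4%N then [:: An 1; An 1]
  else [:: Dn N./2].

(* Over an algebraic closure, GL(V,D) and SL(V,D) become GL_N and SL_N for
   N = d * rank V. If sigma is of the second kind then so does U(V,F), up to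
   isogeny and centre; if it is of the first kind then U(V,F) becomes O_N or
   Sp_N according to whether { a in D | sigma a = eps a } has dimension
   d(d+1)/2 or d(d-1)/2 over k. *)
Definition absolute_type (k : fieldType) (D : falgType k) (d : nat)
    (V : vectType D^c) (G : group_kind V) : seq dynkin :=
  let N := (d * dim V)%N in
  match G with
  | GL | SL => linear_type N
  | U sigma eps _ =>
      if \dim 'Z({:D})%VS != 1%N then linear_type N
      else if ((\dim (lker (linfun sigma - eps *: \1%VF)%R)).*2 == d * d.+1)%N
      then orthogonal_type N else symplectic_type N
  end.

Definition max_coxeter (k : fieldType) (D : falgType k) (d : nat)
    (V : vectType D^c) (G : group_kind V) : nat :=
  \max_(T <- absolute_type d G) coxeter T.

(** * Lie triples and homomorphisms from SL_2 *)

Definition sl2_relations (K : nzRingType) (W : vectType K)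
    (y h x : 'End(W)) : Prop :=
  [/\ (h \o x)%VF - (x \o h)%VF = x *+ 2,
      (h \o y)%VF - (y \o h)%VF = - (y *+ 2)
    & (x \o y)%VF - (y \o x)%VF = h].

Definition is_lie_triple (k : fieldType) (D : falgType k) (d : nat)
    (V : vectType D^c) (G : group_kind V) (Y H X : 'End(V)) : Prop :=
  [/\ lie_set d G Y /\ lie_set d G H /\ lie_set d G X,
      ~ (Y = 0 /\ H = 0 /\ X = 0)
    & sl2_relations Y H X].

Definition sl2_monomial (A : comNzRingType) (e : 'M[nat]_2) (g : 'M[A]_2) : A :=
  \prod_(i < 2) \prod_(j < 2) g i j ^+ e i j.

(* A morphism SL_2 -> End_D(V) of k-varieties is given by a polynomial
   [P : seq ('M[nat]_2 * 'End(V))] in the matrix entries with coefficients in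
   End_D(V); each monomial is encoded by the 2x2 matrix of its exponents. *)
Definition poly_eval (k : fieldType) (D : falgType k) (V : vectType D^c)
    (P : seq ('M[nat]_2 * 'End(V))) (g : 'M[k]_2) (v : V) : V :=
  \sum_(m <- P) kscale (sl2_monomial m.1 g) (m.2 v).

(* The differential at 1 in the direction [A]: the coefficient of T in
   P (1 + T A). *)
Definition poly_diff (k : fieldType) (D : falgType k) (V : vectType D^c)
    (P : seq ('M[nat]_2 * 'End(V))) (A : 'M[k]_2) (v : V) : V :=
  \sum_(m <- P)
    kscale (sl2_monomial m.1 (1%:M + 'X *: map_mx polyC A))`_1 (m.2 v).

Definition truncated_exp (k : fieldType) (D : falgType k) (V : vectType D^c)
    (p : nat) (t : k) (A : 'End(V)) (v : V) : V :=
  \sum_(j < p) kscale (t ^+ j / j`!%:R) (iter j A v).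

(* [phi] (considered on matrices of determinant 1) is the homomorphism
   corresponding to (Y, H, X). As k is infinite, SL_2(k) is Zariski dense in
   SL_2, so a homomorphism of algebraic groups SL_2 -> G over k is the same as
   a homomorphism SL_2(k) -> G(k) given by polynomials over k, and its
   differential does not depend on the choice of the polynomials.
   If k has characteristic p, the differential does not see Frobenius twists
   and therefore does not determine phi; the last clause then singles out the
   homomorphism obtained by exponentiating X and Y. *)
Definition is_corresponding_hom (k : fieldType) (D : falgType k) (d p : nat)
    (V : vectType D^c) (G : group_kind V) (Y H X : 'End(V))
    (phi : 'M[k]_2 -> 'End(V)) : Prop :=
  [/\ forall g, \det g = 1 -> group_set d G (phi g),
      forall g1 g2, \det g1 = 1 -> \det g2 = 1 ->
        phi (g1 *m g2) = (phi g1 \o phi g2)%VF,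
      exists P : seq ('M[nat]_2 * 'End(V)),
        (forall g, \det g = 1 -> forall v, phi g v = poly_eval P g v) /\
        forall v, [/\ poly_diff P (delta_mx 1 0) v = Y v,
                      poly_diff P (delta_mx 0 0 - delta_mx 1 1) v = H v
                    & poly_diff P (delta_mx 0 1) v = X v]
    & p \in [pchar k] -> forall t v,
        phi (1%:M + t *: delta_mx 0 1) v = truncated_exp p t X v /\
        phi (1%:M + t *: delta_mx 1 0) v = truncated_exp p t Y v].

Definition centralizer_set (k : fieldType) (D : falgType k) (d : nat)
    (V : vectType D^c) (G : group_kind V) (phi : 'M[k]_2 -> 'End(V)) :
    set 'End(V) :=
  [set g | group_set d G g /\
     forall s, \det s = 1 -> (g \o phi s)%VF = (phi s \o g)%VF].

(** * The building of G *)

Definition act_latfun (T : Type) (RR : realType) (W : Type) (g : W -> T)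
  (x : RR -> set W) : RR -> set T := fun t => g @` x t.

Definition translates (RR : realType) (W : Type) (x : RR -> set W) :
    set (RR -> set W) :=
  [set (fun t => x (t + c)) | c in [set: RR]].

(* SL(V,D) has a finite centre, so its building is the quotient of that of
   GL(V,D) by translations; its points are the translation classes. *)
Definition point (RR : realType) (k : fieldType) (D : falgType k)
    (V : vectType D^c) (G : group_kind V) : Type :=
  match G with
  | SL => set (RR -> set V)
  | _ => RR -> set V
  end.

Definition building (RR : realType) (k : fieldType) (D : falgType k)
    (nu : D -> \bar RR) (V : vectType D^c) (G : group_kind V) :
    set (point RR G) :=
  match G return set (point RR G) with
  | GL => is_latfun nu setT
  | SL => [set translates x | x in is_latfun nu setT]
  | U _ _ F => is_selfdual_latfun nu F setT
  end.

Arguments building {RR k D} nu {V} G _.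

Definition act (RR : realType) (k : fieldType) (D : falgType k)
    (V : vectType D^c) (G : group_kind V) (g : 'End(V)) :
    point RR G -> point RR G :=
  match G return point RR G -> point RR G with
  | SL => fun x => [set act_latfun g l | l in x]
  | _ => fun x => act_latfun g x
  end.

Arguments act {RR k D V} G g _.

Definition stabilizes (RR : realType) (k : fieldType) (D : falgType k)
    (V : vectType D^c) (A : 'End(V)) (x : RR -> set V) : Prop :=
  forall t v, x t v -> x t (A v).

(* g_{x,0} *)
Definition lie_lattice (RR : realType) (k : fieldType) (D : falgType k)
    (d : nat) (V : vectType D^c) (G : group_kind V) :
    point RR G -> set 'End(V) :=
  match G return point RR G -> set 'End(V) with
  | SL => fun x => [set A | lie_set d SL A /\ forall l, x l -> stabilizes A l]
  | G' => fun x => [set A | lie_set d G' A /\ stabilizes A x]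
  end.

Arguments lie_lattice {RR k D} d {V} G _ _.

Definition triple_building (RR : realType) (k : fieldType) (D : falgType k)
    (nu : D -> \bar RR) (d : nat) (V : vectType D^c) (G : group_kind V)
    (Y H X : 'End(V)) : set (point RR G) :=
  [set x | building nu G x /\ [set Y; H; X] `<=` lie_lattice d G x].

Arguments triple_building {RR k D} nu d {V} G Y H X _.

Definition fixed_points (RR : realType) (k : fieldType) (val : k -> \bar RR)
    (D : falgType k) (nu : D -> \bar RR) (V : vectType D^c) (G : group_kind V)
    (phi : 'M[k]_2 -> 'End(V)) : set (point RR G) :=
  [set x | building nu G x /\
     forall s : 'M[k]_2, \det s = 1 -> (forall i j, integers val (s i j)) ->
       act G (phi s) x = x].

Arguments fixed_points {RR k} val {D} nu {V} G phi _.

(** * sl_2-modules and the building of the centralizer *)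

Definition sl2_irreducible (k : fieldType) (W : vectType k)
    (y h x : 'End(W)) : Prop :=
  [/\ sl2_relations y h x, (fullv : {vspace W}) != 0%VS
    & forall S : {vspace W},
        (y @: S <= S)%VS -> (h @: S <= S)%VS -> (x @: S <= S)%VS ->
        S = 0%VS \/ S = fullv].

Definition sl2_isomorphic (k : fieldType) (W1 W2 : vectType k)
    (y1 h1 x1 : 'End(W1)) (y2 h2 x2 : 'End(W2)) : Prop :=
  exists2 f : 'Hom(W1, W2), bijective f &
    [/\ (f \o y1 = y2 \o f)%VF, (f \o h1 = h2 \o f)%VF
      & (f \o x1 = x2 \o f)%VF].

(* Hom_{sl_2(k)}(W, V), a right D-submodule of the space of functions W -> V *)
Definition sl2_hom (k : fieldType) (D : falgType k) (V : vectType D^c)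
    (Y H X : 'End(V)) (W : vectType k) (y h x : 'End(W)) : set (W -> V) :=
  [set f | [/\ forall u1 u2, f (u1 + u2) = f u1 + f u2,
               forall (a : k) u, f (a *: u) = kscale a (f u)
             & forall u, [/\ f (y u) = Y (f u), f (h u) = H (f u)
                           & f (x u) = X (f u)]]].

(* The (Us i) represent, without repetition, the isomorphism classes of
   irreducible sl_2(k)-modules occurring in V. *)
Definition is_irr_system (k : fieldType) (D : falgType k) (V : vectType D^c)
    (Y H X : 'End(V)) (I : finType) (Us : I -> vectType k)
    (y h x : forall i, 'End(Us i)) : Prop :=
  [/\ forall i, sl2_irreducible (y i) (h i) (x i),
      forall i, exists2 f, sl2_hom Y H X (y i) (h i) (x i) f & injective f,
      forall i j, sl2_isomorphic (y i) (h i) (x i) (y j) (h j) (x j) -> i = j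
    & forall (W : vectType k) (y' h' x' : 'End(W)),
        sl2_irreducible y' h' x' ->
        (exists2 f, sl2_hom Y H X y' h' x' f & injective f) ->
        exists i, sl2_isomorphic y' h' x' (y i) (h i) (x i)].

Section CentralizerBuilding.
Context (RR : realType) (k : fieldType) (D : falgType k) (V : vectType D^c).
Context (I : finType) (Us : I -> vectType k).

Definition mult_family : Type := forall i, RR -> set (Us i -> V).

Definition mult_translates (x : mult_family) : set mult_family :=
  [set (fun i t => x i (t + c)) | c in [set: RR]].

(* For SL(V,D), the centralizer consists of the elements of reduced norm 1 in
   the product of the GL(M i), and its enlarged building is the quotient of the
   product of the buildings of the GL(M i) by simultaneous translations. *)
Definition mult_point (G : group_kind V) : Type :=
  match G with
  | SL => set mult_family
  | _ => mult_family
  end.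

Definition mult_building (nu : D -> \bar RR) (M : forall i, set (Us i -> V))
    (gamma : forall i, (Us i -> V) -> (Us i -> V) -> D) (G : group_kind V) :
    set (mult_point G) :=
  match G return set (mult_point G) with
  | GL => [set x : mult_family | forall i, is_latfun nu (M i) (x i)]
  | SL => [set mult_translates x | x in
             [set x : mult_family | forall i, is_latfun nu (M i) (x i)]]
  | U _ _ _ => [set x : mult_family |
                  forall i, is_selfdual_latfun nu (gamma i) (M i) (x i)]
  end.

(* An element of the centralizer acts on M i by composition. *)
Definition mult_act_family (g : 'End(V)) (x : mult_family) : mult_family :=
  fun i => act_latfun (fun f : Us i -> V => g \o f) (x i).

Definition mult_act (G : group_kind V) (g : 'End(V)) :
    mult_point G -> mult_point G :=
  match G return mult_point G -> mult_point G with
  | SL => fun x => [set mult_act_family g l | l in x]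
  | _ => mult_act_family g
  end.

(* x |-> (M i meet Hom(L i, x_t))_i; its inverse is
   (x_i)_i |-> sum_i (L i) (x) x_i. *)
Definition restrict_family (M : forall i, set (Us i -> V))
    (L : forall i, set (Us i)) (x : RR -> set V) : mult_family :=
  fun i t => [set f | M i f /\ forall u, L i u -> x t (f u)].

Definition restrict_point (M : forall i, set (Us i -> V))
    (L : forall i, set (Us i)) (G : group_kind V) : point RR G -> mult_point G :=
  match G return point RR G -> mult_point G with
  | SL => fun x => [set restrict_family M L l | l in x]
  | _ => restrict_family M L
  end.

(* The forms gamma i on the M i such that F is the orthogonal sum of the
   beta i (x) gamma i, for sl_2-invariant forms beta i on the Us i; they make
   the centralizer of phi in U(V,F) the product of the U(M i, gamma i). *)
Definition are_mult_forms (M : forall i, set (Us i -> V))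
    (y h x : forall i, 'End(Us i))
    (gamma : forall i, (Us i -> V) -> (Us i -> V) -> D) (G : group_kind V) :
    Prop :=
  match G with
  | GL | SL => True
  | U sigma eps F => forall i,
      (exists eps' : k, (eps' = 1 \/ eps' = -1) /\
         is_hermitian sigma eps' (M i) (gamma i)) /\
      exists beta : Us i -> Us i -> k,
        [/\ forall u, scalar (beta u),
            forall u, scalar (beta^~ u),
            forall A u w, A \in [:: y i; h i; x i] ->
              beta (A u) w + beta u (A w) = 0
          & forall f g u w, M i f -> M i g ->
              F (f u) (g w) = beta u w *: gamma i f g]
  end.

End CentralizerBuilding.

Arguments mult_building {RR k D V I Us} nu M gamma G _.
Arguments mult_act {RR k D V I Us} G g _.
Arguments restrict_point {RR k D V I Us} M L G _.

Definition is_stable_lattice (RR : realType) (k : fieldType)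
    (val : k -> \bar RR) (W : vectType k) (y h x : 'End(W)) (L : set W) :
    Prop :=
  is_lattice (integers val) setT L /\
  forall u, L u -> [/\ L (y u), L (h u) & L (x u)].

Definition equivariant_bijection (S P Q : Type) (C : set S)
    (actP : S -> P -> P) (actQ : S -> Q -> Q) (A : set P) (B : set Q)
    (f : P -> Q) : Prop :=
  set_bij A B f /\ forall g a, C g -> A a -> f (actP g a) = actQ g (f a).

(* Main.v *)
(** Put n = dim_D V; the bound on p gives n < p. The one-parameter groups
    phi(1 + tE) are polynomial in t, which makes X and Y nilpotent, hence
    X^n = Y^n = 0, and phi(1 + tE) = exp(tX). As 1/j! is integral for j < p, a
    lattice is stable under all exp(tX) with t integral if and only if it is
    stable under X. Since SL_2(R) is generated by transvections, this gives the
    first equality; for SL(V,D), where only the translation class of a lattice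
    function is fixed, one uses that transvections are commutators.

    As X^(p-1) = Y^(p-1) = 0, every subgroup of V which is stable under X, Y and
    1/j for 0 < j < p is the direct sum of the Y^l K_m for l <= m < p-1, where
    K_m is the group of its highest weight vectors of weight m (an integral form
    of a theorem of Jacobson). Applied to V and to the lattices of a fixed
    lattice function, this shows that such a lattice function is determined by
    its intersections with the highest weight spaces of V, and f |-> f(u_0), for
    a highest weight vector u_0 of U_i, identifies M_i with one of those. The
    form is F(Y^j a, Y^l b) = (-1)^j delta_(j+l,m) F(a, Y^m b) on highest weight
    vectors a, b of weight m, whence gamma(f, g) = F(f(u_0), Y^m g(u_0)). *)

From HB Require Import structures.
Require Import Defs.
From mathcomp Require Import all_boot all_order all_algebra falgebra.
From mathcomp Require Import boolp classical_sets functions reals.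
From mathcomp Require Import constructive_ereal.
From mathcomp Require Import ring zify.

Set Implicit Arguments.
Unset Strict Implicit.
Unset Printing Implicit Defensive.

Import Order.TTheory GRing.Theory Num.Theory.

Local Open Scope classical_set_scope.
Local Open Scope ring_scope.

(** * Modules over sl_2 *)

(** Only 1, ..., p-1 are available as denominators, whether k has characteristic 0 or p, because
    these are the integers known to be units of R. Hence complete reducibility over k is of little
    use: it says nothing about lattices, and in characteristic p it fails without a bound on X and
    Y. The modules of highest weights m and p-2-m have non-split extensions there, but in such an
    extension X^(p-1) or Y^(p-1) is nonzero; this is the origin of the exponent p-1. The
    decomposition is therefore proved by explicit formulas in which every division is by some j with
    0 < j < p, and it is stated for additive subgroups, so that the whole of V and a lattice are
    instances of the same statement.

    Its uniqueness does the remaining work. The components are constructed for V as a module over k,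
    and uniqueness makes them linear over D. It also shows that the components of a vector, chosen
    once and for all in V, are the ones obtained inside any stable lattice that contains the vector.
    So no compatibility between the lattices of a lattice function has to be arranged. *)

Section Iter.
Context (k : nzRingType) (W : lmodType k) (f : {linear W -> W}).

Lemma iter_lin n : linear (iter n f).
Proof. by elim: n => // n IH a u v; rewrite !iterS IH linearP. Qed.

HB.instance Definition _ n := GRing.isLinear.Build k W W _ (iter n f) (iter_lin n).

End Iter.

(** Bare maps instead of endomorphisms: the relations are also needed for [fun w => - H w] and for V
    with its scalars restricted to k. *)
Definition sl2_ops (k : fieldType) (W : lmodType k) (X Y H : W -> W) :=
  [/\ forall w, H (X w) = X (H w) + 2%:R *: X w,
      forall w, H (Y w) = Y (H w) - 2%:R *: Y w
    & forall w, X (Y w) = Y (X w) + H w].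

Definition hw (k : fieldType) (W : lmodType k) (X H : W -> W) (m : nat)
  (w : W) := X w = 0 /\ H w = m%:R *: w.

Section Sl2.
Context (k : fieldType) (p : nat) (W : lmodType k).
Implicit Types X Y H : {linear W -> W}.
Hypothesis nz : forall j, (0 < j < p)%N -> j%:R != 0 :> k.

(** The Chevalley involution; it turns formulas for highest weight vectors into formulas for lowest
    weight vectors. *)
Lemma sl2_opsC X Y H : sl2_ops X Y H -> sl2_ops Y X (fun w => - H w).
Proof.
case=> HX HY XY; split=> w; first by rewrite HY linearN opprB addrC.
  by rewrite HX linearN opprD.
by rewrite XY addrK.
Qed.

Lemma H_iterY X Y H j w : sl2_ops X Y H ->
  H (iter j Y w) = iter j Y (H w) - (2 * j)%:R *: iter j Y w.
Proof.
case=> _ HY _; elim: j => [|j IH]; first by rewrite scale0r subr0.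
rewrite !iterS HY IH linearB linearZ /= -addrA -opprD -scalerDl -natrD.
by congr (_ - _%:R *: _); lia.
Qed.

Lemma X_iterY X Y H j w : sl2_ops X Y H ->
  X (iter j.+1 Y w) =
    iter j.+1 Y (X w) + j.+1%:R *: iter j Y (H w - j%:R *: w).
Proof.
move=> s; case: (s) => _ _ XY; elim: j => [|j IH].
  by rewrite /= XY scale0r subr0 scale1r.
rewrite iterS XY IH (H_iterY _ _ s) linearD linearZ /= !linearB !linearZ /=.
rewrite -addrA -!iterS; congr (_ + _).
set A := iter j.+1 Y (H w); set B := iter j.+1 Y w.
rewrite !scalerA addrACA -{2}[A]scale1r -!scalerDl.
by congr (_ *: _ + _ *: _); ring.
Qed.

(** Only [Y (X w) = 0] is assumed, because the argument reaches the kernel of [Y X] before that of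
    X; the eigenvalue is any scalar, which covers the negative weights of the opposite triple. *)
Lemma X_iterY_eigen X Y H j z w : sl2_ops X Y H ->
  Y (X w) = 0 -> H w = z *: w ->
  X (iter j.+1 Y w) = (j.+1%:R * (z - j%:R)) *: iter j Y w.
Proof.
move=> s yx hz; rewrite (X_iterY _ _ s) iterSr yx linear0 add0r hz.
by rewrite -scalerBl linearZ scalerA.
Qed.

Lemma iterXY_eigen X Y H j z w : sl2_ops X Y H ->
  Y (X w) = 0 -> H w = z *: w ->
  iter j X (iter j Y w) = (\prod_(i < j) (i.+1%:R * (z - i%:R))) *: w.
Proof.
move=> s yx hz; elim: j => [|j IH]; first by rewrite big_ord0 scale1r.
by rewrite iterSr (X_iterY_eigen _ s yx hz) linearZ /= IH big_ord_recr scalerA mulrC.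
Qed.

(* [hprod H j] is [(H - (j-1)) ... (H - 1) H]. *)
Fixpoint hprod (H : W -> W) j w :=
  if j is j'.+1 then hprod H j' (H w - j'%:R *: w) else w.

(** The product [Y X] has weight 0, so it commutes with H. *)
Lemma kerYX_stable X Y H c w : sl2_ops X Y H ->
  Y (X w) = 0 -> Y (X (H w - c *: w)) = 0.
Proof.
move=> [HX HY _] yx; rewrite linearB linearZ /= linearB linearZ /= yx scaler0 subr0.
have -> : X (H w) = H (X w) - 2%:R *: X w by rewrite HX addrK.
have YH u : Y (H u) = H (Y u) + 2%:R *: Y u by rewrite HY subrK.
by rewrite linearB linearZ /= YH yx linear0 scaler0 addr0 subr0.
Qed.

(** For j = p-1 and Y^(p-1) = 0 this shows that H (H-1) ... (H-p+2) vanishes on the kernel of [Y X].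
    Its roots are distinct in k, so H is diagonalisable there with weights 0, ..., p-2. *)
Lemma iterXY_hprod X Y H j w : sl2_ops X Y H -> Y (X w) = 0 ->
  iter j X (iter j Y w) = j`!%:R *: hprod H j w.
Proof.
move=> s; elim: j w => [|j IH] w yx; first by rewrite scale1r.
rewrite iterSr (X_iterY _ _ s) (iterSr _ Y (X w)) yx linear0 add0r linearZ /=.
by rewrite IH ?(kerYX_stable _ s) // scalerA factS natrM.
Qed.

Definition sl2_stable X Y (L : W -> Prop) :=
  [/\ L 0, forall u v, L u -> L v -> L (u - v),
      forall j u, (0 < j < p)%N -> L u -> L (j%:R^-1 *: u),
      forall u, L u -> L (X u) & forall u, L u -> L (Y u)].

Lemma stableD X Y L u v : sl2_stable X Y L -> L u -> L v -> L (u + v).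
Proof.
by move=> [L0 LB _ _ _] Lu Lv; rewrite -[v]opprK -[- v]sub0r; apply: (LB) => //; apply: LB.
Qed.

Lemma stable_sum X Y L (I : Type) (r : seq I) (P : pred I) (F : I -> W) :
  sl2_stable X Y L -> (forall i, P i -> L (F i)) -> L (\sum_(i <- r | P i) F i).
Proof.
move=> s LF; elim/big_ind: _ => //; first by case: s.
by move=> u v; apply: stableD s.
Qed.

Lemma stableMn X Y L n u : sl2_stable X Y L -> L u -> L (n%:R *: u).
Proof.
move=> s Lu; elim: n => [|n IH]; first by rewrite scale0r; case: s.
by rewrite -natr1 scalerDl scale1r; apply: stableD s _ _.
Qed.

Lemma stableN X Y L u : sl2_stable X Y L -> L u -> L (- u).
Proof. by move=> [L0 LB _ _ _] Lu; rewrite -sub0r; apply: LB. Qed.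

Lemma stableH X Y H L u : sl2_ops X Y H -> sl2_stable X Y L -> L u -> L (H u).
Proof.
move=> [_ _ XY] [_ LB _ LX LY] Lu.
have -> : H u = X (Y u) - Y (X u) by rewrite XY addrC addKr.
by apply: LB; auto.
Qed.

(** Induction on the number of roots: the component of weight m < j of w is that of H w - j w
    divided by m - j. Only integers strictly between 0 and p are inverted, so the components stay in
    the subgroup L. *)
Lemma eigen_decomp X Y H L j w : sl2_ops X Y H -> sl2_stable X Y L ->
  (j <= p)%N -> hprod H j w = 0 -> Y (X w) = 0 -> L w ->
  exists2 b : nat -> W,
    forall m, (m < j)%N ->
      [/\ L (b m), Y (X (b m)) = 0 & H (b m) = m%:R *: b m]
    & w = \sum_(m < j) b m.
Proof.
move=> s sL; elim: j w => [|j IH] w jp /= h0 yx Lw.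
  by exists (fun=> 0) => //; rewrite h0 big_ord0.
have Lh : L (H w - j%:R *: w).
  case: (sL) => _ LB _ _ _; apply: LB; first exact: (stableH s sL).
  exact: (stableMn _ sL).
have [b bP bE] := IH _ (ltnW jp) h0 (kerYX_stable _ s yx) Lh.
pose c m := (j - m)%:R^-1 *: b m.
have cP m : (m < j)%N -> [/\ L (c m), Y (X (c m)) = 0 & H (c m) = m%:R *: c m].
  move=> mj; have [Lb yxb hb] := bP m mj; split.
  - by case: sL => _ _ LV _ _; apply: LV => //; lia.
  - by rewrite /c linearZ /= linearZ /= yxb scaler0.
  - by rewrite /c linearZ /= hb !scalerA mulrC.
exists (fun m => if m == j then w + \sum_(m < j) c m else - c m); last first.
  rewrite big_ord_recr /= eqxx.
  rewrite (eq_bigr (fun i : 'I_j => - c i)); last first.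
    by move=> i _; rewrite ltn_eqF.
  by rewrite sumrN addrCA addNr addr0.
move=> m mj; case: eqP => [->|/eqP ne].
  split.
  - by apply: (stableD sL) => //; apply: (stable_sum _ sL) => i _; have [] := cP i.
  - rewrite linearD /= linearD /= linear_sum /= linear_sum /= yx add0r big1 // => i _.
    by have [] := cP i.
  - rewrite linearD linear_sum scalerDr scaler_sumr.
    rewrite -[H w](subrK (j%:R *: w)) bE addrAC [RHS]addrC -big_split /=.
    congr (_ + _); apply: eq_bigr => i _; have [_ _ ->] := cP i (ltn_ord i).
    have nzi : (j - i)%:R != 0 :> k by apply: nz; have := ltn_ord i; lia.
    rewrite -[b i](scalerKV nzi) -/(c i) -scalerDl -natrD subnK //.
    exact: ltnW.
have mj' : (m < j)%N by lia.
have [Lc yxc hc] := cP m mj'; split.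
- exact: (stableN sL).
- by rewrite linearN /= linearN /= yxc oppr0.
- by rewrite linearN scalerN hc.
Qed.

(** Applying q - H to a relation removes the term of weight q and multiplies that of weight m by q -
    m, which is nonzero in k. *)
Lemma eigen_indep H q (b : nat -> W) : (q <= p)%N ->
  (forall m, (m < q)%N -> H (b m) = m%:R *: b m) ->
  \sum_(m < q) b m = 0 -> forall m, (m < q)%N -> b m = 0.
Proof.
elim: q b => // q IH b qp hb sb.
have bb m : (m < q)%N -> b m = 0.
  move=> mq; apply/eqP; have /negPf nzm : (q - m)%:R != 0 :> k.
    by apply: nz; lia.
  suff /(_ m mq)/eqP : forall m, (m < q)%N -> (q - m)%:R *: b m = 0.
    by rewrite scaler_eq0 nzm.
  apply: IH (fun m => (q - m)%:R *: b m) (ltnW qp) _ _.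
    by move=> i iq; rewrite linearZ /= hb 1?ltnW // !scalerA mulrC.
  transitivity (q%:R *: (\sum_(m < q.+1) b m) - H (\sum_(m < q.+1) b m)); last first.
    by rewrite sb !linear0 addr0.
  rewrite scaler_sumr linear_sum -sumrB big_ord_recr /= hb // subrr addr0.
  apply: eq_bigr => i _.
  by rewrite hb ?ltnS 1?ltnW // -scalerBl natrB // ltnW.
move=> m; rewrite ltnS leq_eqVlt => /predU1P[->|]; last exact: bb.
by move: sb; rewrite big_ord_recr big1 /= ?add0r // => i _; apply: bb.
Qed.

(** * Decomposition of modules on which X^(p-1) and Y^(p-1) vanish *)

Section Nilpotent.
Variables (X Y H : {linear W -> W}).
Hypothesis s : sl2_ops X Y H.
Hypotheses (nX : forall w, iter p.-1 X w = 0) (nY : forall w, iter p.-1 Y w = 0).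

Lemma fact_nz j : (j < p)%N -> j`!%:R != 0 :> k.
Proof.
elim: j => [|j IH] jp; first by rewrite oner_eq0.
by rewrite factS natrM mulf_neq0 ?IH ?nz // ltnW.
Qed.

Lemma prod_nz j m : (j <= m)%N -> (m < p)%N ->
  \prod_(i < j) (i.+1%:R * (m%:R - i%:R)) != 0 :> k.
Proof.
move=> jm mp; apply/prodf_neq0 => i _; have ij := ltn_ord i.
by rewrite -natrB ?mulf_neq0 ?nz //; lia.
Qed.

(* The vector X w is a lowest weight vector of weight m+2, that is -i modulo p
   for i = p-2-m; were it nonzero, then X^(i+m+1) = X^(p-1) would not kill
   Y^m w. *)
Lemma kerYX_kerX_eigen m w : (m < p.-1)%N ->
  Y (X w) = 0 -> H w = m%:R *: w -> X w = 0.
Proof.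
move=> mp yx hz; pose i := (p - 2 - m)%N.
have h1 : H (X w) = (m.+2)%:R *: X w.
  case: (s) => -> _ _; rewrite hz linearZ /= -scalerDl -natrD.
  by congr (_%:R *: _); lia.
have e1 : iter i Y (iter i X (X w)) =
    (\prod_(j < i) (j.+1%:R * (- m.+2%:R - j%:R))) *: X w.
    have sN : sl2_ops Y X (\- H) by exact: sl2_opsC.
    apply: (iterXY_eigen _ sN); first by rewrite yx linear0.
    by rewrite /= h1 scaleNr.
have nz1 : \prod_(j < i) (j.+1%:R * (- m.+2%:R - j%:R)) != 0 :> k.
  apply/prodf_neq0 => j _; have ij := ltn_ord j.
  rewrite -opprD mulrN oppr_eq0 -natrD mulf_neq0 ?nz //; move: ij; rewrite /i; lia.
have e2 := iterXY_eigen m s yx hz.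
have nz2 := @prod_nz m m (leqnn m) (leq_trans mp (leq_pred p)).
have e3 : iter i X (X w) = 0.
  apply/eqP; rewrite -(inj_eq (scalerI nz2)) scaler0 -!linearZ /= -e2.
  rewrite -iterS -iterD (_ : _ + _ = p.-1)%N ?nX //.
  by rewrite /i; lia.
by move/eqP: e1; rewrite e3 linear0 eq_sym scaler_eq0 (negPf nz1) => /eqP.
Qed.

Lemma kerYX_decomp (L : W -> Prop) w : sl2_stable X Y L ->
  L w -> Y (X w) = 0 ->
  exists2 b : nat -> W,
    forall m, (m < p.-1)%N -> L (b m) /\ hw X H m (b m)
    & w = \sum_(m < p.-1) b m.
Proof.
move=> sL Lw yx; have p1p := leq_pred p.
have h0 : hprod H p.-1 w = 0.
  have := iterXY_hprod p.-1 s yx; rewrite nY linear0 => /esym/eqP.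
  (* Positivity of p is not assumed here; for p = 0 the exponent [p.-1] is 0 and the hypothesis on Y
     says that w = 0. *)
  case: (posnP p) => [p0|p_gt0].
    by move=> _; rewrite -[LHS]/(iter 0 Y _) -[in iter 0]p0; have := nY; rewrite p0.
  by rewrite scaler_eq0 (negPf (fact_nz _)) ?prednK // => /eqP.
have [b bP ->] := eigen_decomp s sL p1p h0 yx Lw.
exists b => // m mp; have [Lb yxb hb] := bP m mp; split => //; split => //.
exact: (kerYX_kerX_eigen mp).
Qed.

(** Descent from Y^(p-1) w = 0: applying X to Y^(j+1) w = 0 gives (j+1)(m-j) Y^j w = 0, and this
    coefficient is nonzero for m < j < p-1. *)
Lemma hw_iterY m w : (m < p.-1)%N -> hw X H m w -> iter m.+1 Y w = 0.
Proof.
move=> mp [xw hz].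
have yx : Y (X w) = 0 by rewrite xw linear0.
suff: forall i, (i <= p.-1 - m.+1)%N -> iter (p.-1 - i) Y w = 0.
  by move/(_ _ (leqnn _)); rewrite subKn.
elim=> [|i IH] ip; first by rewrite subn0 nY.
have := X_iterY_eigen (p.-1 - i.+1) s yx hz.
rewrite subnSK ?IH ?linear0; try lia.
move/esym/eqP; rewrite scaler_eq0 => /orP[|/eqP//].
rewrite -opprB -natrB ?mulrN ?oppr_eq0; last lia.
by rewrite mulf_eq0 !(negPf (nz _)) //; lia.
Qed.

Definition decomposes (L : W -> Prop) w (a : nat -> nat -> W) :=
  (forall m l, (l <= m < p.-1)%N -> L (a m l) /\ hw X H m (a m l)) /\
  w = \sum_(m < p.-1) \sum_(l < m.+1) iter l Y (a m l).

Lemma X_decomp (L : W -> Prop) w a : decomposes L w a ->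
  X w = \sum_(m < p.-1) \sum_(l < m)
          (l.+1%:R * (m%:R - l%:R)) *: iter l Y (a m l.+1).
Proof.
case=> aP ->; rewrite linear_sum; apply: eq_bigr => m _.
rewrite linear_sum big_ord_recl /=.
have [_ [-> _]] := aP m 0%N (ltn_ord m); rewrite add0r.
apply: eq_bigr => l _; rewrite /bump add1n.
have [|_ [xa ha]] := aP m l.+1; first by rewrite !ltn_ord.
by rewrite -iterS (X_iterY_eigen _ s _ ha) // xa linear0.
Qed.

(** Induction on the order of nilpotency of X at w. The decomposition of X w is lifted through X
    term by term, by dividing by (l+1)(m-l). What remains of w after subtracting the lift lies in
    the kernel of [Y X], which is already decomposed. *)
Lemma decomp_exists_nil (L : W -> Prop) j w : sl2_stable X Y L -> L w ->
  iter j X w = 0 -> exists a, decomposes L w a.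
Proof.
move=> sL; elim: j w => [|j IH] w Lw /=.
  move=> ->; exists (fun _ _ => 0); split.
    move=> m l _; split; first by case: sL.
    by split; rewrite linear0 ?scaler0.
  by rewrite big1 // => m _; rewrite big1 // => l _; rewrite linear0.
rewrite -iterS iterSr => xw.
have [_ _ LV LX LY] := sL.
have [a [aP aE]] := IH _ (LX _ Lw) xw.
pose c m l := l.+1%:R^-1 *: ((m - l)%:R^-1 *: a m l).
have cP m l : (l < m < p.-1)%N -> L (c m l) /\ hw X H m (c m l).
  move=> lm; have [|La [xa ha]] := aP m l; first by lia.
  split; first by apply: (LV); [lia|apply: LV => //; lia].
  rewrite /c; split.
    by rewrite linearZ /= linearZ /= xa !scaler0.
  by rewrite linearZ /= linearZ /= ha !scalerA; congr (_ *: _); ring.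
have ca m l : (l < m < p.-1)%N -> (l.+1%:R * (m%:R - l%:R)) *: c m l = a m l.
  move=> lm; rewrite -natrB; last by lia.
  rewrite mulrC -scalerA /c scalerKV ?scalerKV //; apply: nz; lia.
pose v := w - \sum_(m < p.-1) \sum_(l < m) iter l.+1 Y (c m l).
have Lv : L v.
  case: (sL) => _ LB _ _ _; apply: LB => //.
  apply: (stable_sum _ sL) => m _; apply: (stable_sum _ sL) => l _.
  have [|Lc _] := cP m l; first by rewrite !ltn_ord.
  by elim: l.+1 => //= n; apply: LY.
(* The terms with l = m have no lift, as m - l = 0; but Y kills them, and this is all that is
   needed. *)
have Xv : X v = \sum_(m < p.-1) iter m Y (a m m).
  rewrite linearB /= aE linear_sum -sumrB; apply: eq_bigr => m _.
  rewrite linear_sum big_ord_recr /= addrAC -sumrB big1 ?add0r // => l _.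
  have lm : (l < m < p.-1)%N by rewrite !ltn_ord.
  have [_ [xc hc]] := cP m l lm.
  rewrite -iterS (X_iterY_eigen _ s _ hc) ?xc ?linear0 //.
  by rewrite -linearZ /= ca // subrr.
have YXv : Y (X v) = 0.
  rewrite Xv linear_sum big1 // => m _; rewrite /= -iterS (@hw_iterY m) //.
  by have [|//] := aP m m; rewrite leqnn /=.
have [b bP bE] := kerYX_decomp sL Lv YXv.
exists (fun m l => if l is l'.+1 then c m l' else b m); split.
  by move=> m [|l] lm; [apply: bP|apply: cP].
rewrite -[LHS](subrK (\sum_(m < p.-1) \sum_(l < m) iter l.+1 Y (c m l))).
rewrite -/v bE -big_split; apply: eq_bigr => m _ /=.
by rewrite big_ord_recl.
Qed.

Lemma decomp_exists (L : W -> Prop) w : sl2_stable X Y L -> L w ->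
  exists a, decomposes L w a.
Proof. by move=> sL Lw; apply: (decomp_exists_nil sL Lw (nX w)). Qed.

(** Applying X to the relation lowers all the exponents of Y by one, which removes the terms with l
    > 0 by induction; the terms with l = 0 are eigenvectors of H for distinct weights. *)
Lemma decomp0 (a : nat -> nat -> W) :
  (forall m l, (l <= m < p.-1)%N -> hw X H m (a m l)) ->
  \sum_(m < p.-1) \sum_(l < m.+1) iter l Y (a m l) = 0 ->
  forall m l, (l <= m < p.-1)%N -> a m l = 0.
Proof.
move=> aP a0.
(* The induction is on a bound j such that [a m l] vanishes for l >= j; as l <= m < p-1, the bound p
   always holds. *)
have [j pj] : {j | (p <= j)%N} by exists p.
have : forall m l, (j <= l <= m)%N -> (m < p.-1)%N -> a m l = 0.
  by move=> m l; lia.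
elim: j {pj} a aP a0 => [|j IH] a aP a0 az m l lm.
  by apply: az; lia.
have aS m' l' : (l' < m' < p.-1)%N -> a m' l'.+1 = 0.
  move=> lm'.
  (* The coefficients of the relation obtained by applying X. *)
  pose b m l := if (l < m)%N then (l.+1%:R * (m%:R - l%:R)) *: a m l.+1 else 0.
  suff : b m' l' = 0.
    rewrite /b; case: andP lm' => // -[lm' mp] _; rewrite lm' => /eqP.
    rewrite scaler_eq0 mulf_eq0 -natrB; last by lia.
    by rewrite !(negPf (nz _)) /=; [move/eqP|lia|lia].
  apply: IH; last by lia.
  - move=> m1 l1 lm1; rewrite /b; case: ifP => [l1m1|_]; last first.
      by split; rewrite ?linear0 ?scaler0.
    have [|xa ha] := aP m1 l1.+1; first by lia.
    by split; rewrite linearZ /= ?xa ?scaler0 // ha !scalerA mulrC.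
  - have /X_decomp : decomposes (fun=> True) 0 a.
      by split=> // m1 l1 lm1; split=> //; apply: aP.
    rewrite linear0 => e0; rewrite [RHS]e0; apply: eq_bigr => m1 _.
    rewrite big_ord_recr /= {2}/b ltnn linear0 addr0.
    by apply: eq_bigr => l1 _; rewrite /b ltn_ord linearZ.
  - move=> m1 l1 lm1 m1p; rewrite /b; case: ifP => // l1m1.
    by rewrite az ?scaler0 //; lia.
case: l lm => [|l] lm; last by apply: aS; lia.
apply: (@eigen_indep H p.-1 (a^~ 0%N) (leq_pred p)); last by lia.
  by move=> m1 m1p; have [|_ ->] := aP m1 0%N.
rewrite -[RHS]a0; apply: eq_bigr => m1 _.
rewrite big_ord_recl /= big1 ?addr0 // => l1 _.
by rewrite /bump add1n -iterS aS ?linear0 // !ltn_ord.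
Qed.

End Nilpotent.
End Sl2.

(** * The standard module with basis v, Y v, ..., Y^m v *)

Section Standard.
Context (k : fieldType) (m : nat).
Implicit Types c : 'rV[k]_m.+1.

(** The index is a natural number and the value beyond m is 0, so that the formula for X, which
    reads coordinate l+1, has no special case at l = m. *)
Definition coef l c : k := if (l <= m)%N then c 0 (inord l) else 0.

Lemma coef_ord c (l : 'I_m.+1) : coef l c = c 0 l.
Proof. by rewrite /coef -ltnS ltn_ord inord_val. Qed.

Lemma coef_out c l : (m < l)%N -> coef l c = 0.
Proof. by rewrite /coef ltnNge => /negPf ->. Qed.

Lemma coefP c c' : (forall l, (l <= m)%N -> coef l c = coef l c') -> c = c'.
Proof. by move=> E; apply/rowP => l; rewrite -!coef_ord E // -ltnS. Qed.

Lemma coef_is_linear l : scalar (coef l).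
Proof.
by move=> a c c'; rewrite /coef; case: ifP => _; rewrite ?mxE // mulr0 addr0.
Qed.
HB.instance Definition _ l :=
  GRing.isLinear.Build k 'rV[k]_m.+1 k _ (coef l) (coef_is_linear l).

Definition row_of (f : nat -> k) : 'rV[k]_m.+1 := \row_(l < m.+1) f l.

Lemma coef_row f l : (l <= m)%N -> coef l (row_of f) = f l.
Proof. by move=> lm; rewrite /coef lm mxE inordK. Qed.

(** The three operators in the coordinates of the basis Y^l v for a highest weight vector v of
    weight m; the factor in [std_x] comes from X Y^(l+1) v = (l+1)(m-l) Y^l v. *)
Definition std_y c := row_of (fun l => if l is l'.+1 then coef l' c else 0).
Definition std_h c := row_of (fun l => (m%:R - (2 * l)%:R) * coef l c).
Definition std_x c := row_of (fun l => l.+1%:R * (m%:R - l%:R) * coef l.+1 c).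

Lemma coef_y c l : (l < m)%N -> coef l.+1 (std_y c) = coef l c.
Proof. by move=> lm; rewrite coef_row. Qed.
Lemma coef_y0 c : coef 0 (std_y c) = 0.
Proof. by rewrite coef_row. Qed.
Lemma coef_h c l : coef l (std_h c) = (m%:R - (2 * l)%:R) * coef l c.
Proof.
by case: (leqP l m) => lm; [rewrite coef_row|rewrite !coef_out ?mulr0].
Qed.
Lemma coef_x c l : coef l (std_x c) = l.+1%:R * (m%:R - l%:R) * coef l.+1 c.
Proof.
case: (leqP l m) => lm; first by rewrite coef_row.
by rewrite !coef_out ?mulr0 // ltnW.
Qed.

Lemma std_y_lin : linear std_y.
Proof.
move=> a c c'; apply: coefP => -[|l] lm; rewrite linearP /=.
  by rewrite !coef_y0 mulr0 addr0.
by rewrite !coef_y // linearP.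
Qed.
Lemma std_h_lin : linear std_h.
Proof.
by move=> a c c'; apply: coefP => l lm; rewrite linearP /= !coef_h linearP /=; ring.
Qed.
Lemma std_x_lin : linear std_x.
Proof.
by move=> a c c'; apply: coefP => l lm; rewrite linearP /= !coef_x linearP /=; ring.
Qed.
HB.instance Definition _ := GRing.isLinear.Build k _ _ _ std_y std_y_lin.
HB.instance Definition _ := GRing.isLinear.Build k _ _ _ std_h std_h_lin.
HB.instance Definition _ := GRing.isLinear.Build k _ _ _ std_x std_x_lin.

Lemma std_ops : sl2_ops std_x std_y std_h.
Proof.
split=> c; apply: coefP => l lm.
- by rewrite linearD linearZ /= !(coef_x, coef_h); ring.
- rewrite linearB linearZ /= coef_h; case: l lm => [|l] lm.
    by rewrite !coef_y0 !mulr0 subrr.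
  by rewrite !coef_y // coef_h; ring.
- rewrite linearD /= coef_x coef_h; case: l lm => [|l] lm.
    rewrite coef_y0 add0r muln0 !subr0 mul1r; case: (posnP m) => [m0|m0].
      by rewrite m0 !mul0r.
    by rewrite coef_y.
  rewrite (coef_y (std_x c)) // coef_x; case: (ltngtP l.+1 m) lm => // lm _.
    by rewrite coef_y //; ring.
  by rewrite lm coef_out // -lm; ring.
Qed.

End Standard.

Section Orbit.
Context (k : fieldType) (W : lmodType k) (m : nat).

(** The map from the standard module to W that sends the basis vector number l to Y^l v. It is
    linear for every v, and a homomorphism of sl_2-modules if v is a highest weight vector of weight
    m with Y^(m+1) v = 0. *)
Definition orb (Y : W -> W) (v : W) (c : 'rV[k]_m.+1) : W :=
  \sum_(l < m.+1) coef l c *: iter l Y v.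

Lemma orb_lin Y v : linear (orb Y v).
Proof.
move=> a c c'; rewrite /orb scaler_sumr -big_split; apply: eq_bigr => l _ /=.
by rewrite linearP /= scalerDl scalerA.
Qed.
HB.instance Definition _ Y v := GRing.isLinear.Build k _ _ _ (orb Y v) (orb_lin Y v).

Context (X Y H : {linear W -> W}).
Hypothesis s : sl2_ops X Y H.

Lemma orb_y v c : iter m.+1 Y v = 0 -> orb Y v (std_y c) = Y (orb Y v c).
Proof.
move=> v0; rewrite /orb linear_sum big_ord_recl [RHS]big_ord_recr /=.
rewrite coef_y0 scale0r add0r linearZ /= -iterS v0 scaler0 addr0.
by apply: eq_bigr => l _; rewrite /bump add1n coef_y // linearZ.
Qed.

Lemma orb_h v c : hw X H m v -> orb Y v (std_h c) = H (orb Y v c).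
Proof.
move=> [xv hv]; rewrite /orb linear_sum; apply: eq_bigr => l _.
rewrite coef_h linearZ /= (H_iterY _ _ s) hv linearZ /= -scalerBl scalerA.
by rewrite mulrC.
Qed.

Lemma orb_x v c : hw X H m v -> orb Y v (std_x c) = X (orb Y v c).
Proof.
move=> [xv hv]; rewrite /orb linear_sum big_ord_recr [RHS]big_ord_recl /=.
rewrite coef_x coef_out // mulr0 scale0r addr0 linearZ /= xv scaler0 add0r.
apply: eq_bigr => l _; rewrite /bump add1n coef_x linearZ /= -iterS.
by rewrite (X_iterY_eigen _ s _ hv) ?xv ?linear0 // scalerA mulrC.
Qed.

End Orbit.

(** * Classification of the irreducible modules of highest weight below p-1 *)

Section Irreducible.
Context (k : fieldType) (p : nat).
Hypothesis nz : forall j, (0 < j < p)%N -> j%:R != 0 :> k.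

Lemma relations_ops (W : vectType k) (y h x : 'End(W)) :
  sl2_relations y h x <-> sl2_ops x y h.
Proof.
split=> [[hx hy xy]|[hx hy xy]]; split.
- move=> w; move/lfunP: hx => /(_ w).
  rewrite mulr2n !(add_lfunE, opp_lfunE, comp_lfunE) -mulr2n => /eqP.
  by rewrite subr_eq addrC scaler_nat => /eqP.
- move=> w; move/lfunP: hy => /(_ w).
  rewrite mulr2n !(add_lfunE, opp_lfunE, comp_lfunE) -mulr2n => /eqP.
  by rewrite subr_eq addrC scaler_nat => /eqP.
- move=> w; move/lfunP: xy => /(_ w).
  rewrite !(add_lfunE, opp_lfunE, comp_lfunE) => /eqP.
  by rewrite subr_eq addrC => /eqP.
- apply/lfunP => w; rewrite mulr2n !(add_lfunE, opp_lfunE, comp_lfunE) hx.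
  by rewrite addrAC subrr add0r scaler_nat mulr2n.
- apply/lfunP => w; rewrite mulr2n !(add_lfunE, opp_lfunE, comp_lfunE) hy.
  by rewrite addrAC subrr add0r scaler_nat mulr2n.
- by apply/lfunP => w; rewrite !(add_lfunE, opp_lfunE, comp_lfunE) xy addrAC subrr add0r.
Qed.

Section StandardIrreducible.
Variable m : nat.
Hypothesis mp : (m < p)%N.

Let e0 : 'rV[k]_m.+1 := row_of m (fun l => (l == 0)%:R).

Lemma coef_iter_y l i : (i <= m)%N -> (l <= m)%N ->
  coef i (iter l (@std_y k m) e0) = (i == l)%:R.
Proof.
elim: l i => [|l IH] i im lm; first by rewrite coef_row.
rewrite iterS; case: i im => [|i] im; first by rewrite coef_y0.
by rewrite coef_y // IH // ltnW.
Qed.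

Lemma orb_e0 c : orb (@std_y k m) e0 c = c.
Proof.
apply: coefP => i im; rewrite linear_sum (bigD1 (inord i)) //= big1 ?addr0.
  have ii : (inord i : 'I_m.+1) = i :> nat by rewrite inordK.
  by rewrite linearZ /= ii coef_iter_y // eqxx mulr1.
move=> l ne; rewrite linearZ /= coef_iter_y //; last by rewrite -ltnS.
by rewrite (_ : (i == l) = false) ?mulr0 //; apply: contraNF ne => /eqP ->; rewrite inord_val.
Qed.

(** For m < p the kernel of [std_x] is the line of [e0]. Applying [std_x] to a nonzero vector as
    long as the result is nonzero therefore ends at a nonzero multiple of [e0]. *)
Lemma std_mem_e0 (S : {vspace 'rV[k]_m.+1}) :
  (forall c, c \in S -> std_x c \in S) -> S != 0%VS -> e0 \in S.
Proof.
move=> Sx S0.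
have : vpick S \in S := memv_pick S; have : vpick S != 0 by rewrite vpick0.
move: (vpick S) => c c0 cS.
have [n mn] : {n | (m <= n)%N} by exists m.
have : forall l, (n < l)%N -> coef l c = 0.
  by move=> l nl; apply: coef_out; apply: leq_ltn_trans nl.
elim: n {mn} c c0 cS => [|n IH] c c0 cS cn.
  have cE : c = coef 0 c *: e0.
    apply: coefP => -[|l] lm; rewrite linearZ /= coef_row //= ?mulr1 //.
    by rewrite mulr0 cn.
  have c00 : coef 0 c != 0.
    by apply: contra c0 => /eqP z; rewrite cE z scale0r.
  by rewrite -(scalerK c00 e0) -cE rpredZ.
have [xc0|xc0] := eqVneq (std_x c) 0.
  apply: IH cS _ => // -[|l] nl //; case: (leqP l.+1 m) => lm; last exact: coef_out.
  have /eqP := coef_x c l; rewrite xc0 linear0 eq_sym !mulf_eq0.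
  rewrite -natrB ?(ltnW lm) // (negPf (nz (j := l.+1) _)); last by lia.
  by rewrite (negPf (nz (j := m - l) _)) => [/eqP//|]; lia.
apply: IH xc0 (Sx _ cS) _ => l nl.
by rewrite coef_x cn ?mulr0.
Qed.

Lemma std_irreducible :
  @sl2_irreducible k 'rV[k]_m.+1 (linfun (@std_y k m)) (linfun (@std_h k m))
    (linfun (@std_x k m)).
Proof.
split.
- apply/relations_ops; have [hx hy xy] := @std_ops k m.
  by split=> c; rewrite !lfunE /= ?hx ?hy ?xy.
- apply/eqP => /(congr1 (fun S : {vspace _} => \dim S)).
  by rewrite dimvf dimv0.
- move=> S /subvP Sy _ /subvP Sx.
  have [->|S0] := eqVneq S 0%VS; [by left|right].
  have {}Sx c : c \in S -> std_x c \in S.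
    by move=> cS; rewrite -(lfunE (@std_x k m)) /= Sx // memv_img.
  have {}Sy c : c \in S -> std_y c \in S.
    by move=> cS; rewrite -(lfunE (@std_y k m)) /= Sy // memv_img.
  apply/eqP; rewrite eqEsubv subvf /=; apply/subvP => c _.
  rewrite -(orb_e0 c); apply: rpred_sum => l _; apply: rpredZ.
  elim: (l : nat) => [|n IH] /=; first exact: std_mem_e0.
  exact: Sy.
Qed.

End StandardIrreducible.

(** Uniqueness of the decomposition, for a family concentrated in the single weight m. *)
Lemma orb_inj0 (W : lmodType k) (X Y H : {linear W -> W}) m u (c : 'rV[k]_m.+1) :
  sl2_ops X Y H -> (forall w, iter p.-1 Y w = 0) -> (m < p.-1)%N ->
  hw X H m u -> u != 0 -> orb Y u c = 0 -> c = 0.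
Proof.
move=> s nY mp hwu u0 o0; apply: coefP => l lm; rewrite linear0.
pose a m' l := if m' == m then coef l c *: u else 0.
have : a m l = 0.
  apply: (decomp0 nz s (a := a)) => [m' l' _||]; last by rewrite lm.
    rewrite /a; case: eqP => [->|_]; last by split; rewrite !linear0 ?scaler0.
    by case: hwu => xu hu; split; rewrite linearZ /= ?xu ?scaler0 // hu !scalerA mulrC.
  rewrite (bigD1 (Ordinal mp)) //= [X in _ + X]big1 ?addr0; last first.
    move=> i ne; rewrite big1 // => l' _; rewrite /a ifF ?linear0 //.
    by apply: contraNF ne => /eqP im; apply/eqP/val_inj.
  by rewrite -[RHS]o0; apply: eq_bigr => l' _; rewrite /a eqxx linearZ.
by rewrite /a eqxx => /eqP; rewrite scaler_eq0 (negPf u0) orbF => /eqP.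
Qed.

Section IrreducibleOrbit.
Context (U : vectType k) (y h x : 'End(U)) (m : nat) (u : U).
Hypotheses (irr : sl2_irreducible y h x).
Hypotheses (nX : forall w, iter p.-1 x w = 0) (nY : forall w, iter p.-1 y w = 0).

(** The decomposition of a nonzero vector has a nonzero term. *)
Lemma irr_hw_exists : exists m u, [/\ (m < p.-1)%N, hw x h m u & u != 0].
Proof.
have [/relations_ops s U0 _] := irr.
have [|a [aP aE]] := decomp_exists nz s nX nY (L := fun=> True) (w := vpick fullv) _ I.
  by split.
apply: contrapT => no; move: U0; rewrite -vpick0 aE big1 ?eqxx // => i _.
rewrite big1 // => l _; have [|_ ha] := aP i l.
  by have := ltn_ord l; have := ltn_ord i; lia.
have [->|a0] := eqVneq (a i l) 0; first by rewrite linear0.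
by case: no; exists i, (a i l).
Qed.

Hypotheses (mp : (m < p.-1)%N) (hwu : hw x h m u) (u0 : u != 0).

Let orbf : 'Hom('rV[k]_m.+1, U) := linfun (@orb k U m y u).

Lemma irr_orb_ker : lker orbf = 0%VS.
Proof.
have [/relations_ops s _ _] := irr.
apply/eqP/lker0P => c c' /eqP; rewrite -subr_eq0 -linearB /= lfunE /= => /eqP o0.
by apply/eqP; rewrite -subr_eq0; apply/eqP/(orb_inj0 s nY mp hwu u0).
Qed.

Lemma irr_orb_img : limg orbf = fullv.
Proof.
have [/relations_ops s U0 irrS] := irr.
have yu : iter m.+1 y u = 0 by apply: (hw_iterY nz s nY mp hwu).
have stab (f : 'End(U)) (g : 'rV[k]_m.+1 -> 'rV[k]_m.+1) :
    (forall c, orb y u (g c) = f (orb y u c)) -> (f @: limg orbf <= limg orbf)%VS.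
  move=> fg; apply/subvP => _ /memv_imgP[_ /memv_imgP[c _ ->] ->].
  by rewrite /orbf lfunE /= -fg -(lfunE (@orb k U m y u)) memv_img ?memvf.
case: (irrS (limg orbf)) => //.
- by apply: (stab _ (@std_y k m)) => c; apply: orb_y.
- by apply: (stab _ (@std_h k m)) => c; apply: (orb_h s).
- by apply: (stab _ (@std_x k m)) => c; apply: (orb_x s).
move=> img0; have := limg_dim_eq (f := orbf) (U := fullv).
rewrite irr_orb_ker capv0 img0 dimv0 dimvf => /(_ (erefl _)) /esym/eqP.
by rewrite -[dim _]/(1 * m.+1)%N mul1n.
Qed.

Lemma irr_dim : dim U = m.+1.
Proof.
rewrite -dimvf -irr_orb_img limg_dim_eq ?irr_orb_ker ?capv0 // dimvf.
by rewrite -[LHS]/(1 * m.+1)%N mul1n.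
Qed.

Definition orb_inv : U -> 'rV[k]_m.+1 := (orbf^-1)%VF.

Lemma orbK c : orb_inv (orb y u c) = c.
Proof.
have -> : orb y u c = orbf c by rewrite lfunE.
by rewrite /orb_inv lker0_lfunK //; apply/eqP/irr_orb_ker.
Qed.

Lemma orb_invK w : orb y u (orb_inv w) = w.
Proof.
have -> : orb y u (orb_inv w) = orbf (orb_inv w) by rewrite lfunE.
by rewrite /orb_inv limg_lfunVK // irr_orb_img memvf.
Qed.

Lemma orb_inv_lin : linear orb_inv. Proof. exact: linearP. Qed.

Lemma orb_inv_y w : orb_inv (y w) = std_y (orb_inv w).
Proof.
have [/relations_ops s _ _] := irr.
by rewrite -{1}(orb_invK w) -orb_y ?orbK //; apply: (hw_iterY nz s nY mp hwu).
Qed.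

Lemma orb_inv_h w : orb_inv (h w) = std_h (orb_inv w).
Proof.
have [/relations_ops s _ _] := irr.
by rewrite -{1}(orb_invK w) -(orb_h s) ?orbK.
Qed.

Lemma orb_inv_x w : orb_inv (x w) = std_x (orb_inv w).
Proof.
have [/relations_ops s _ _] := irr.
by rewrite -{1}(orb_invK w) -(orb_x s) ?orbK.
Qed.

Lemma irr_std : sl2_isomorphic (linfun (@std_y k m)) (linfun (@std_h k m))
    (linfun (@std_x k m)) y h x.
Proof.
have [/relations_ops s _ _] := irr.
exists orbf.
  by exists orb_inv => c; rewrite /orbf lfunE /= ?orbK ?orb_invK.
split; apply/lfunP => c; rewrite !comp_lfunE !lfunE /=.
- by apply: orb_y; apply: (hw_iterY nz s nY mp hwu).
- exact: (orb_h s).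
- exact: (orb_x s).
Qed.

End IrreducibleOrbit.

Lemma sl2_isomorphic_dim (U1 U2 : vectType k) (y1 h1 x1 : 'End(U1))
    (y2 h2 x2 : 'End(U2)) :
  sl2_isomorphic y1 h1 x1 y2 h2 x2 -> dim U1 = dim U2.
Proof.
case=> f [g fK gK] _; rewrite -!dimvf -(limg_dim_eq (f := f)); last first.
  have /eqP -> : lker f == 0%VS by apply/lker0P/(can_inj fK).
  by rewrite capv0.
congr (\dim _); apply/eqP; rewrite eqEsubv subvf /=; apply/subvP => w _.
by rewrite -(gK w) memv_img ?memvf.
Qed.

Lemma sl2_isomorphic_sym (U1 U2 : vectType k) (y1 h1 x1 : 'End(U1))
    (y2 h2 x2 : 'End(U2)) :
  sl2_isomorphic y1 h1 x1 y2 h2 x2 -> sl2_isomorphic y2 h2 x2 y1 h1 x1.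
Proof.
case=> f [g fK gK] [fy fh fx].
have inj : injective f := can_inj fK.
have glin : linear g by move=> a u v; apply: inj; rewrite gK linearP /= !gK.
pose gl := GRing.isLinear.Build k U2 U1 _ g glin.
pose G : {linear U2 -> U1} := HB.pack g gl.
have com (a1 : 'End(U1)) (a2 : 'End(U2)) :
    (f \o a1 = a2 \o f)%VF -> (linfun G \o a2 = a1 \o linfun G)%VF.
  move=> e; apply/lfunP => w; rewrite !comp_lfunE !lfunE /=; apply: inj.
  by rewrite gK -[RHS](comp_lfunE f a1) e comp_lfunE gK.
by exists (linfun G); [exists f => w; rewrite lfunE /= ?fK ?gK|split; apply: com].
Qed.

Lemma sl2_isomorphic_trans (U1 U2 U3 : vectType k) (y1 h1 x1 : 'End(U1))
    (y2 h2 x2 : 'End(U2)) (y3 h3 x3 : 'End(U3)) :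
  sl2_isomorphic y1 h1 x1 y2 h2 x2 -> sl2_isomorphic y2 h2 x2 y3 h3 x3 ->
  sl2_isomorphic y1 h1 x1 y3 h3 x3.
Proof.
move=> [f bf [fy fh fx]] [g bg [gy gh gx]]; exists (g \o f)%VF.
  by apply: (eq_bij (bij_comp bg bf)) => w; rewrite comp_lfunE.
by split; rewrite -comp_lfunA ?fy ?fh ?fx !comp_lfunA ?gy ?gh ?gx.
Qed.

End Irreducible.

(** * Restriction of scalars to k *)

Section ScalarRestriction.
Context (k : fieldType) (D : falgType k).

Section Kscale.
Context (W : lmodType D^c).
Implicit Types (a b : k) (v w : W).

Lemma kscaleA a b v : kscale a (kscale b v) = kscale (a * b) v.
Proof.
rewrite /kscale /rscale scalerA; congr (_ *: v).
by rewrite -[_ * _ in LHS]/((b%:A : D) * a%:A) -scalerAl mul1r scalerA mulrC.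
Qed.

Lemma kscale1 : left_id 1 (@kscale k D W).
Proof. by move=> v; rewrite /kscale /rscale !scale1r. Qed.

Lemma kscaleDr : right_distributive (@kscale k D W) +%R.
Proof. by move=> a v w; rewrite /kscale /rscale scalerDr. Qed.

Lemma kscaleDl v : {morph (@kscale k D W)^~ v : a b / a + b}.
Proof. by move=> a b; rewrite /kscale /rscale !scalerDl. Qed.

Lemma kscale_rscale a (d : D) v :
  kscale a (rscale v d) = rscale (kscale a v) d.
Proof.
rewrite /kscale /rscale !scalerA; congr (_ *: v).
rewrite -[LHS]/(d * a%:A) -[RHS]/(a%:A * d).
by rewrite -scalerAr -scalerAl mulr1 mul1r.
Qed.

End Kscale.

(** A synonym of V that carries the structure of a k-module, beside the structure over D^c that V
    itself carries. *)
Definition kmod (V : vectType D^c) : Type := V.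

Context (V : vectType D^c).

HB.instance Definition _ := GRing.Zmodule.copy (kmod V) V.
HB.instance Definition _ := GRing.Zmodule_isLmodule.Build k (kmod V)
  (@kscaleA V) (@kscale1 V) (@kscaleDr V) (@kscaleDl V).

Definition kfun (f : 'End(V)) : kmod V -> kmod V := f.

Lemma kfun_lin (f : 'End(V)) : linear (kfun f).
Proof. by move=> a u v; rewrite /kfun linearP. Qed.
HB.instance Definition _ f :=
  GRing.isLinear.Build k (kmod V) (kmod V) _ (kfun f) (kfun_lin f).

Lemma kscale_nat n (v : V) : kscale n%:R v = v *+ n.
Proof. exact: (@scaler_nat k (kmod V)). Qed.

Lemma kfun_ops (Y H X : 'End(V)) :
  sl2_relations Y H X -> sl2_ops (kfun X) (kfun Y) (kfun H).
Proof.
move=> [hx hy xy]; split=> w.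
- move/lfunP: hx => /(_ w).
  rewrite mulr2n !(add_lfunE, opp_lfunE, comp_lfunE) -mulr2n => /eqP.
  by rewrite subr_eq addrC scaler_nat => /eqP.
- move/lfunP: hy => /(_ w).
  rewrite mulr2n !(add_lfunE, opp_lfunE, comp_lfunE) -mulr2n => /eqP.
  by rewrite subr_eq addrC scaler_nat => /eqP.
- move/lfunP: xy => /(_ w).
  rewrite !(add_lfunE, opp_lfunE, comp_lfunE) => /eqP.
  by rewrite subr_eq addrC => /eqP.
Qed.

End ScalarRestriction.

(** * Highest weight components of the vectors of V *)

Section Components.
Context (k : fieldType) (p : nat) (D : falgType k) (V : vectType D^c).
Context (Y H X : 'End(V)).
Hypothesis nz : forall j, (0 < j < p)%N -> j%:R != 0 :> k.
Hypothesis s : sl2_relations Y H X.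
Hypotheses (nX : forall w, iter p.-1 X w = 0) (nY : forall w, iter p.-1 Y w = 0).

(** Natural multiples replace scalars of k here, so that the condition is visibly D-linear. *)
Definition vhw m (v : V) : Prop := X v = 0 /\ H v = v *+ m.

Lemma vhwE m v : vhw m v <-> hw (kfun X) (kfun H) m v.
Proof. by rewrite /vhw /hw scaler_nat. Qed.

Lemma vhw0 m : vhw m 0.
Proof. by split; rewrite linear0 ?mul0rn. Qed.

Lemma vhw_lin m (a : D^c) u v : vhw m u -> vhw m v -> vhw m (a *: u + v).
Proof.
move=> [xu hu] [xv hv]; split; rewrite linearP /= ?xu ?xv ?scaler0 ?addr0 //.
by rewrite hu hv mulrnDl scalerMnr.
Qed.

(** The components are chosen for the trivial subgroup condition, that is in V. If v lies in a
    stable subgroup L, it also has a decomposition inside L, and by uniqueness this is the chosen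
    one. *)
Lemma comps_exist : exists c : nat -> nat -> V -> V,
  [/\ forall m l v, vhw m (c m l v),
      forall v, v = \sum_(m < p.-1) \sum_(l < m.+1) iter l Y (c m l v),
      forall L : V -> Prop, sl2_stable p (kfun X) (kfun Y) L ->
        forall m l v, L v -> L (c m l v)
    & forall a : nat -> nat -> V, (forall m l, vhw m (a m l)) ->
        forall m l, (l <= m < p.-1)%N ->
        c m l (\sum_(m < p.-1) \sum_(l < m.+1) iter l Y (a m l)) = a m l].
Proof.
have sk := kfun_ops s.
have trivial_stable : sl2_stable p (kfun X) (kfun Y) (fun=> True) by split.
have ex v := @decomp_exists k p (kmod V) nz (kfun X) (kfun Y) (kfun H) sk nX nY
  (fun=> True) v trivial_stable I.
pose d (v : V) := sval (cid (ex v)).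
have dP v := svalP (cid (ex v)).
(* The value 0 outside the range makes [c m l v] a highest weight vector for all m and l. *)
pose c m l v : V := if (l <= m < p.-1)%N then d v m l else 0.
have chw m l v : vhw m (c m l v).
  rewrite /c; case: ifP => lm; last exact: vhw0.
  by have [/(_ _ _ lm)[_ ?] _] := dP v; apply/vhwE.
have cE v : v = \sum_(m < p.-1) \sum_(l < m.+1) iter l Y (c m l v).
  have [_ {1}->] := dP v; apply: eq_bigr => m _; apply: eq_bigr => l _.
  by rewrite /c ltn_ord -ltnS ltn_ord.
have uniq (a b : nat -> nat -> V) : (forall m l, (l <= m < p.-1)%N -> vhw m (a m l)) ->
    (forall m l, (l <= m < p.-1)%N -> vhw m (b m l)) ->
    \sum_(m < p.-1) \sum_(l < m.+1) iter l Y (a m l) =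
    \sum_(m < p.-1) \sum_(l < m.+1) iter l Y (b m l) ->
    forall m l, (l <= m < p.-1)%N -> a m l = b m l.
  move=> ah bh ab m l lm; apply/eqP; rewrite -subr_eq0; apply/eqP.
  apply: (@decomp0 k p (kmod V) nz (kfun X) (kfun Y) (kfun H) sk
    (fun m l => a m l - b m l)) lm => [m1 l1 lm1|].
    apply/vhwE; rewrite addrC -scaleN1r; apply: vhw_lin; [exact: bh|exact: ah].
  rewrite -[RHS](subrr (\sum_(m < p.-1) \sum_(l < m.+1) iter l Y (a m l))).
  rewrite {2}ab -sumrB; apply: eq_bigr => m1 _; rewrite -sumrB.
  by apply: eq_bigr => l1 _; rewrite linearB.
exists c; split=> // [L sL m l v Lv|a ah m l lm].
  have [a [aP aE]] := decomp_exists nz sk nX nY sL Lv.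
  rewrite /c; case: ifP => lm; last by case: sL.
  have [dh dE] := dP v.
  rewrite (uniq (d v) a) //; first by have [] := aP m l lm.
  - by move=> m1 l1 lm1; apply/vhwE; have [] := dh m1 l1 lm1.
  - by move=> m1 l1 lm1; apply/vhwE; have [] := aP m1 l1 lm1.
  - by rewrite -[LHS]dE.
by apply: (uniq (fun m l => c m l _) a) lm => //; rewrite -cE.
Qed.

End Components.

(** * Decomposition indexed by the irreducible modules occurring in V *)

Section IrreducibleSystem.
Context (k : fieldType) (p : nat) (D : falgType k) (V : vectType D^c).
Context (Y H X : 'End(V)).
Hypothesis nz : forall j, (0 < j < p)%N -> j%:R != 0 :> k.
Hypothesis s : sl2_relations Y H X.
Hypotheses (nX : forall w, iter p.-1 X w = 0) (nY : forall w, iter p.-1 Y w = 0).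

Lemma sl2_hom_iter (W : vectType k) (y h x : 'End(W)) f n u :
  sl2_hom Y H X y h x f ->
  f (iter n x u) = iter n X (f u) /\ f (iter n y u) = iter n Y (f u).
Proof.
move=> [_ _ fP]; elim: n => //= n [IHx IHy].
by have [_ _ ->] := fP (iter n x u); have [-> _ _] := fP (iter n y u); rewrite IHx IHy.
Qed.

Lemma sl2_hom0 (W : vectType k) (y h x : 'End(W)) f :
  sl2_hom Y H X y h x f -> f 0 = 0.
Proof. by move=> [fD _ _]; apply: (addrI (f 0)); rewrite -fD !addr0. Qed.

Lemma orb_hom m v : (m < p.-1)%N -> vhw H X m v ->
  sl2_hom Y H X (linfun (@std_y k m)) (linfun (@std_h k m)) (linfun (@std_x k m))
    (@orb k (kmod V) m (kfun Y) v).
Proof.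
move=> mp /vhwE vh; have sk := kfun_ops s; split.
- by move=> c c'; rewrite linearD.
- by move=> a c; rewrite linearZ.
move=> c; rewrite !lfunE /=; split.
- apply: (@orb_y k (kmod V) m (kfun Y) v c).
  exact: (hw_iterY nz sk nY mp vh).
- exact: (@orb_h k (kmod V) m (kfun X) (kfun Y) (kfun H) sk v c vh).
- exact: (@orb_x k (kmod V) m (kfun X) (kfun Y) (kfun H) sk v c vh).
Qed.

Context (I : finType) (Us : I -> vectType k) (y h x : forall i, 'End(Us i)).
Hypothesis irrs : is_irr_system Y H X y h x.

Lemma irr_system_nil i u : iter p.-1 (x i) u = 0 /\ iter p.-1 (y i) u = 0.
Proof.
have [_ /(_ i)[f fh fi] _ _] := irrs.
have [fx fy] := sl2_hom_iter p.-1 u fh.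
by split; apply: fi; rewrite ?fx ?fy ?nX ?nY (sl2_hom0 fh).
Qed.

(** The highest weight of U_i, read off its dimension so that no vector has to be chosen. *)
Definition hwt i := (dim (Us i)).-1.

Lemma irr_system_hw i : exists u,
  [/\ (hwt i < p.-1)%N, hw (x i) (h i) (hwt i) u & u != 0].
Proof.
have [irr _ _ _] := irrs.
have ni u := @irr_system_nil i u.
have [m [u [mp uh u0]]] := irr_hw_exists nz (irr i) (fun u => (ni u).1) (fun u => (ni u).2).
exists u; rewrite /hwt (irr_dim nz (irr i) _ mp uh u0) // => w.
by case: (ni w).
Qed.

Lemma irr_system_std i : sl2_isomorphic (linfun (@std_y k (hwt i)))
  (linfun (@std_h k (hwt i))) (linfun (@std_x k (hwt i))) (y i) (h i) (x i).
Proof.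
have [irr _ _ _] := irrs; have [u [mp uh u0]] := irr_system_hw i.
by apply: (irr_std nz (irr i) _ mp uh u0) => w; case: (@irr_system_nil i w).
Qed.

Lemma hwt_inj : injective hwt.
Proof.
have [_ _ inj _] := irrs; move=> i j ij; apply: inj.
apply: sl2_isomorphic_trans (irr_system_std j).
by rewrite -ij; apply/sl2_isomorphic_sym/irr_system_std.
Qed.

(** A nonzero highest weight vector of weight m < p-1 generates a copy of the standard module, which
    is irreducible and hence isomorphic to some U_i. *)
Lemma hwt_cover m v : (m < p.-1)%N -> vhw H X m v -> v != 0 -> exists i, hwt i = m.
Proof.
move=> mp vh v0; have [_ _ _ cov] := irrs; have sk := kfun_ops s.
have [||i iso] := cov _ (linfun (@std_y k m)) (linfun (@std_h k m)) (linfun (@std_x k m)).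
- by apply: (std_irreducible nz); apply: leq_trans mp (leq_pred p).
- exists (@orb k (kmod V) m (kfun Y) v); first exact: orb_hom.
  move=> c c' cc'.
  have o0 : @orb k (kmod V) m (kfun Y) v (c - c') = 0 by rewrite linearB /= cc' subrr.
  apply/eqP; rewrite -subr_eq0; apply/eqP.
  apply: (orb_inj0 nz sk nY mp _ v0 o0); exact/vhwE.
exists i; rewrite /hwt -(sl2_isomorphic_dim iso).
by rewrite -[dim _]/(1 * m.+1)%N mul1n.
Qed.

Lemma sum_hwt (G : nat -> V) :
  (forall m, (m < p.-1)%N -> (forall i, hwt i <> m) -> G m = 0) ->
  \sum_(m < p.-1) G m = \sum_i G (hwt i).
Proof.
move=> G0.
have lt i : (hwt i < p.-1)%N by have [u []] := irr_system_hw i.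
pose f i := Ordinal (lt i).
have -> : \sum_i G (hwt i) = \sum_(m in [set f i | i in setT]%SET) G m.
  rewrite big_imset /=; last by move=> i j _ _ /(congr1 val)/hwt_inj.
  by apply: eq_big => // i; rewrite in_setT.
rewrite [RHS]big_mkcond; apply: eq_bigr => m _; case: ifP => // /imsetP nm.
by apply: G0 => // i im; apply: nm; exists i; [rewrite in_setT|apply: val_inj].
Qed.

(** The decomposition by weights, reindexed by I. This is legitimate since distinct indices have
    distinct weights, and a weight that is missing from I has no nonzero highest weight vector in
    V. *)
Lemma frame_exists : exists c : I -> nat -> V -> V,
  [/\ forall i l v, vhw H X (hwt i) (c i l v),
      forall v, v = \sum_i \sum_(l < (hwt i).+1) iter l Y (c i l v),
      forall L : V -> Prop, sl2_stable p (kfun X) (kfun Y) L ->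
        forall i l v, L v -> L (c i l v)
    & forall a : I -> nat -> V, (forall i l, vhw H X (hwt i) (a i l)) ->
        forall i l, (l <= hwt i)%N ->
        c i l (\sum_i \sum_(l < (hwt i).+1) iter l Y (a i l)) = a i l].
Proof.
have [c [ch cE cL cU]] := comps_exist nz s nX nY.
have lt i : (hwt i < p.-1)%N by have [u []] := irr_system_hw i.
exists (fun i => c (hwt i)); split=> // [v|L sL i l v Lv|a ah i l li].
- rewrite {1}[v]cE.
  apply: (@sum_hwt (fun m => \sum_(l < m.+1) iter l Y (c m l v))) => m mp nm; rewrite big1 // => l _.
  suff -> : c m l v = 0 by elim: (l : nat) => //= n ->; rewrite linear0.
  apply/eqP; apply: contrapT => /negP nc.
  by have [i im] := hwt_cover mp (ch m l v) nc; apply: (nm i).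
- exact: cL.
(* The family is extended by 0 to the weights that do not occur. *)
pose b m l := if [pick i | hwt i == m] is Some i then a i l else 0.
have bE j l1 : b (hwt j) l1 = a j l1.
  by rewrite /b; case: pickP => [i1 /eqP/hwt_inj -> //|/(_ j)]; rewrite eqxx.
rewrite -(bE i l) -[RHS](cU b) ?li ?lt //; last first.
  move=> m l1; rewrite /b; case: pickP => [j /eqP <- //|_]; exact: vhw0.
congr (c _ _ _).
rewrite [RHS](@sum_hwt (fun m => \sum_(l < m.+1) iter l Y (b m l))).
  by apply: eq_bigr => j _; apply: eq_bigr => l1 _; rewrite bE.
move=> m mp nm; rewrite big1 // => l1 _; rewrite /b; case: pickP => [j /eqP/nm //|_].
by elim: (l1 : nat) => //= n ->; rewrite linear0.
Qed.

End IrreducibleSystem.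

(** * Valuations and lattices *)

Section Valuation.
Context (RR : realType) (K : nzRingType) (v : K -> \bar RR).
Hypothesis vP : is_valuation v.

Lemma val0 : v 0 = +oo%E.
Proof. by have [_ /(_ 0)[_ ->]] := vP. Qed.

Lemma valM x y : v (x * y) = (v x + v y)%E.
Proof. by have [_ _ ->] := vP. Qed.

Lemma val_double0 x : x != 0 -> (v x + v x = v x)%E -> v x = 0.
Proof.
have [vn vo _ _] := vP => x0 /eqP.
case: (v x) (vn x) (vo x) => [r| |] // _ [H _]; last first.
  by move=> _; move/eqP: x0 => /(_ (H erefl)).
by rewrite -EFinD eqe -subr_eq0 addrK => /eqP ->.
Qed.

Lemma val1 : v 1 = 0.
Proof. by apply: val_double0; rewrite ?oner_neq0 // -valM mulr1. Qed.

Lemma valN1 : v (-1) = 0.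
Proof.
have := valM (-1) (-1); rewrite mulrNN mulr1 val1.
case: (v (-1)) => [r| |] // /esym/eqP; rewrite -EFinD eqe -mulr2n mulrn_eq0 /=.
by move/eqP => ->.
Qed.

Lemma valN x : v (- x) = v x.
Proof. by rewrite -mulN1r valM valN1 add0e. Qed.

Lemma val_unit x y : x * y = 1 -> v x = 0 -> v y = 0.
Proof. by move=> xy x0; have := valM x y; rewrite xy val1 x0 add0e. Qed.

Lemma int0 : integers v 0.
Proof. by rewrite /integers /= val0 leey. Qed.

Lemma int1 : integers v 1.
Proof. by rewrite /integers /= val1. Qed.

Lemma intM x y : integers v x -> integers v y -> integers v (x * y).
Proof. by rewrite /integers /= valM => x0 y0; apply: adde_ge0. Qed.

Lemma intD x y : integers v x -> integers v y -> integers v (x + y).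
Proof.
have [_ _ _ vD] := vP; rewrite /integers /= => x0 y0.
by apply: le_trans (vD x y); rewrite le_min x0 y0.
Qed.

Lemma intN x : integers v x -> integers v (- x).
Proof. by rewrite /integers /= valN. Qed.

Lemma int_nat n : integers v n%:R.
Proof.
elim: n => [|n IH]; first exact: int0.
by rewrite -natr1; apply: intD int1.
Qed.

Lemma posD x y : (0 < v x -> 0 < v y -> 0 < v (x + y)%R)%E.
Proof.
have [_ _ _ vD] := vP => x0 y0.
by apply: lt_le_trans (vD x y); rewrite lt_min x0 y0.
Qed.

End Valuation.

(** * Integers prime to p are units *)

Section ResidualCharacteristic.
Context (RR : realType) (k : fieldType) (val : k -> \bar RR) (p : nat).
Hypotheses (vP : is_valuation val) (p_prime : prime p) (vp : (0 < val p%:R%R)%E).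

Lemma pos_natM n x : (0 < val x -> 0 < val (n%:R * x)%R)%E.
Proof.
move=> x0; elim: n => [|n IH]; first by rewrite mul0r (val0 vP) ltry.
by rewrite -natr1 mulrDl mul1r posD.
Qed.

(** By Bezout, 1 is an integral combination of n and p; if both had positive valuation, so would
    1. *)
Lemma val_coprime n : coprime n p -> val n%:R = 0.
Proof.
move=> cop; have n_ge0 := int_nat vP n.
have n_gt0 : (0 < n)%N.
  case: n cop {n_ge0} => //; rewrite /coprime gcd0n => /eqP p1.
  by move: (prime_gt1 p_prime); rewrite p1.
apply/eqP; rewrite eq_le n_ge0 andbT leNgt; apply/negP => n0.
have [a b ab _] := egcdnP p n_gt0.
have h1 : (0 < val (a%:R * n%:R)%R)%E by apply: pos_natM.
have h2 : (0 < val (- (b%:R * p%:R))%R)%E by rewrite valN //; apply: pos_natM.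
have := posD vP h1 h2.
by rewrite -!natrM ab natrD addrAC subrr add0r (eqP cop) (val1 vP) ltxx.
Qed.

Lemma nat_nz n : coprime n p -> n%:R != 0 :> k.
Proof.
move=> /val_coprime vn; apply/eqP => n0; move: vn; rewrite n0.
by have [_ /(_ 0)[_ ->]] := vP.
Qed.

Lemma coprime_lt n : (0 < n < p)%N -> coprime n p.
Proof. by move=> np; rewrite coprime_sym prime_coprime // gtnNdvd //; case/andP: np. Qed.

Lemma int_inv n : (0 < n < p)%N -> integers val n%:R^-1.
Proof.
move=> np; have nz := nat_nz (coprime_lt np).
rewrite /integers /= (val_unit vP (divff nz)) // val_coprime //.
exact: coprime_lt.
Qed.

End ResidualCharacteristic.

(** * Images and finite sums of lattices *)

Section Lattice.
Context (K : nzRingType) (S : set K).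
Implicit Types W : lmodType K.

Lemma lattice_image W W' (T : W -> W') M L : linear T ->
  is_lattice S M L -> is_lattice S (T @` M) (T @` L).
Proof.
move=> Tlin [s -> ->].
pose T' : {linear W -> W'} := HB.pack T (GRing.isLinear.Build K W W' _ T Tlin).
have TE (S' : set K) : T @` span_over S' s = span_over S' (map T s).
  rewrite /span_over size_map; apply/seteqP; split => w /=.
    move=> [_ [c cS ->] <-]; exists c => //.
    rewrite -[T]/(T' : W -> W') linear_sum; apply: eq_bigr => i _.
    by rewrite linearZ (nth_map 0) ?linear0.
  move=> [c cS ->]; exists (\sum_(i < size s) c i *: s`_i); first by exists c.
  rewrite -[T]/(T' : W -> W') linear_sum; apply: eq_bigr => i _.
  by rewrite linearZ (nth_map 0) ?linear0.
by exists (map T s); rewrite TE.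
Qed.

Definition set_sum W (A B : set W) : set W :=
  [set w | exists2 a, A a & exists2 b, B b & w = a + b].

Lemma span_cat W (S' : set K) (s1 s2 : seq W) :
  span_over S' (s1 ++ s2) = set_sum (span_over S' s1) (span_over S' s2).
Proof.
have sumE (c : nat -> K) : \sum_(i < size (s1 ++ s2)) c i *: (s1 ++ s2)`_i =
    \sum_(i < size s1) c i *: s1`_i +
    \sum_(i < size s2) c (size s1 + i)%N *: s2`_i.
  rewrite size_cat big_split_ord; congr (_ + _); apply: eq_bigr => i _ /=.
    by rewrite nth_cat ltn_ord.
  by rewrite nth_cat ltnNge leq_addr addKn.
apply/seteqP; split => w /=.
  move=> [c cS ->]; rewrite sumE.
  exists (\sum_(i < size s1) c i *: s1`_i); first by exists c.
  by exists (\sum_(i < size s2) c (size s1 + i)%N *: s2`_i) => //; exists (fun i => c (size s1 + i)%N).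
move=> [_ [c1 c1S ->] [_ [c2 c2S ->] ->]].
pose c i := if (i < size s1)%N then c1 i else c2 (i - size s1)%N.
exists c; first by rewrite /c => i; case: ifP.
rewrite sumE /c; congr (_ + _); apply: eq_bigr => i _.
  by rewrite ltn_ord.
by rewrite ltnNge leq_addr addKn.
Qed.

Lemma lattice_sum W M1 L1 M2 L2 : is_lattice S M1 L1 -> is_lattice S M2 L2 ->
  is_lattice S (set_sum M1 M2 : set W) (set_sum L1 L2).
Proof. by move=> [s1 -> ->] [s2 -> ->]; exists (s1 ++ s2); rewrite span_cat. Qed.

Definition set_bigsum W (J : Type) (r : seq J) (A : J -> set W) : set W :=
  [set w | exists2 a, forall j, A j (a j) & w = \sum_(j <- r) a j].

(** In [set_bigsum] the summand is a function of the index, so a repeated index would have to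
    contribute the same vector twice; this is why [r] is duplicate-free. *)
Lemma lattice_bigsum W (J : eqType) (r : seq J) (M L : J -> set W) :
  S 0 -> uniq r ->
  (forall j, M j 0) -> (forall j, L j 0) ->
  (forall j, is_lattice S (M j) (L j)) ->
  is_lattice S (set_bigsum r M) (set_bigsum r L).
Proof.
move=> S0 ur M0 L0 ML.
have E (A : J -> set W) j r' : j \notin r' -> (forall j, A j 0) ->
    set_bigsum (j :: r') A = set_sum (A j) (set_bigsum r' A).
  move=> jr A0; apply/seteqP; split => w /=.
    move=> [a aA ->]; rewrite big_cons; exists (a j) => //.
    by exists (\sum_(i <- r') a i) => //; exists a.
  move=> [b bA [_ [a aA ->] ->]].
  exists (fun i => if i == j then b else a i).
    by move=> i; case: eqP => [->|].
  rewrite big_cons eqxx; congr (_ + _); rewrite !big_seq; apply: eq_bigr => i ir.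
  by case: eqP ir jr => // -> ->.
elim: r ur => [_|j r IH /= /andP[jr ur]].
  have E0 (A : J -> set W) (S' : set K) : S' 0 -> (forall j, A j 0) ->
      set_bigsum [::] A = span_over S' [::].
    move=> S'0 A0; apply/seteqP; split => w /= [a _ ->]; rewrite ?big_nil ?big_ord0.
      by exists (fun=> 0); rewrite ?big_ord0.
    by exists (fun=> 0); rewrite ?big_nil.
  by exists [::]; apply: E0.
by rewrite !E //; apply: lattice_sum (IH ur).
Qed.

End Lattice.

(** * The invariant form on the standard module *)

Section StandardForm.
Context (k : fieldType) (m : nat).
Implicit Types c : 'rV[k]_m.+1.

(** It pairs opposite weights, Y^j v with Y^(m-j) v; the sign (-1)^j is forced by invariance, as
    each Y moved to the other side changes the sign. *)
Definition std_form c c' : k :=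
  \sum_(j < m.+1) (-1) ^+ j * coef j c * coef (m - j) c'.

Lemma std_form_linl c : scalar (std_form^~ c).
Proof.
move=> a u v; rewrite /std_form mulr_sumr -big_split; apply: eq_bigr => j _ /=.
by rewrite linearP /=; ring.
Qed.

Lemma std_form_linr c : scalar (std_form c).
Proof.
move=> a u v; rewrite /std_form mulr_sumr -big_split; apply: eq_bigr => j _ /=.
by rewrite linearP /=; ring.
Qed.

Lemma std_form_y c c' : std_form (std_y c) c' + std_form c (std_y c') = 0.
Proof.
rewrite /std_form big_ord_recl [X in _ + X]big_ord_recr /=.
rewrite coef_y0 mulr0 mul0r add0r subnn coef_y0 mulr0 addr0 -big_split big1 //.
move=> j _ /=; have jm := ltn_ord j.
rewrite /bump add1n coef_y // -(subnSK jm) coef_y; last by lia.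
by rewrite exprS; ring.
Qed.

Lemma std_form_h c c' : std_form (std_h c) c' + std_form c (std_h c') = 0.
Proof.
rewrite /std_form -big_split big1 // => j _ /=; have jm := ltn_ord j.
have jm' : (j <= m)%N by rewrite -ltnS.
by rewrite !coef_h !natrM natrB //; ring.
Qed.

Lemma std_form_x c c' : std_form (std_x c) c' + std_form c (std_x c') = 0.
Proof.
rewrite /std_form big_ord_recr [X in _ + X]big_ord_recl /=.
rewrite coef_x (coef_out c (ltnSn m)) !mulr0 mul0r addr0 subn0.
rewrite [X in _ + (X + _)](_ : _ = 0) ?add0r; last first.
  by rewrite coef_x subrr mulr0 mul0r mulr0.
rewrite -big_split big1 // => j _ /=; have jm := ltn_ord j.
have jm' : (j <= m)%N := ltnW jm.
rewrite /bump add1n !coef_x subnSK // !natrB // exprS; ring.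
Qed.

End StandardForm.

(** * The correspondence between lattice functions *)

Section Frame.
Context (RR : realType) (k : fieldType) (val : k -> \bar RR) (p : nat).
Context (D : falgType k) (nu : D -> \bar RR) (V : vectType D^c).
Context (Y H X : 'End(V)).
Hypothesis nz : forall j, (0 < j < p)%N -> j%:R != 0 :> k.
Hypothesis s : sl2_relations Y H X.
Hypotheses (nX : forall w, iter p.-1 X w = 0) (nY : forall w, iter p.-1 Y w = 0).
Hypothesis (vP : is_valuation val) (nuP : is_valuation nu).
Hypothesis (nu_val : forall a : k, nu a%:A = val a).
Hypothesis (invP : forall n, (0 < n < p)%N -> integers val n%:R^-1).
Hypothesis (D_division : is_division D).
Context (I : finType) (Us : I -> vectType k) (y h x : forall i, 'End(Us i)).
Hypothesis irrs : is_irr_system Y H X y h x.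
Context (u0 : forall i, Us i).
Hypothesis u0P : forall i,
  [/\ (hwt Us i < p.-1)%N, hw (x i) (h i) (hwt Us i) (u0 i) & u0 i != 0].

Local Notation mu := (hwt Us).
Local Notation M := (fun i => sl2_hom Y H X (y i) (h i) (x i)).
Local Notation RD := (integers nu : set D^c).

Definition coords i : Us i -> 'rV[k]_(mu i).+1 := @orb_inv k (Us i) (y i) (mu i) (u0 i).

Lemma coords_lin i : linear (@coords i). Proof. exact: orb_inv_lin. Qed.
HB.instance Definition _ i := GRing.isLinear.Build k _ _ _ (@coords i) (@coords_lin i).

Lemma coords_facts i :
  [/\ cancel (orb (y i) (u0 i)) (@coords i), cancel (@coords i) (orb (y i) (u0 i)),
      forall w, coords (y i w) = std_y (coords w), forall w, coords (h i w) = std_h (coords w)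
    & forall w, coords (x i w) = std_x (coords w)].
Proof.
have [irr _ _ _] := irrs; have [mp uh u0i] := u0P i.
have ny w : iter p.-1 (y i) w = 0 by case: (irr_system_nil nX nY irrs w).
split=> w; rewrite /coords.
- exact: (orbK nz (irr i) ny mp uh u0i).
- exact: (orb_invK nz (irr i) ny mp uh u0i).
- exact: (orb_inv_y nz (irr i) ny mp uh u0i).
- exact: (orb_inv_h nz (irr i) ny mp uh u0i).
- exact: (orb_inv_x nz (irr i) ny mp uh u0i).
Qed.

Definition std_lattice i : set (Us i) := [set w | forall l, integers val (coef l (coords w))].

Lemma row_coef m (c : 'rV[k]_m.+1) : row_of m (fun l => coef l c) = c.
Proof. by apply: coefP => l lm; rewrite coef_row. Qed.

(** In the basis of the Y^l u_0, of which [std_lattice] is the R-span, the matrices of the three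
    operators have integer entries. *)
Lemma std_lattice_stable i : is_stable_lattice val (y i) (h i) (x i) (@std_lattice i).
Proof.
have [oK cK cy ch cx] := coords_facts i; split.
  pose t := mkseq (fun l => iter l (y i) (u0 i)) (mu i).+1.
  have spanE S : span_over S t =
      [set w | exists2 c, (forall l, S (c l)) & w = orb (y i) (u0 i) (row_of (mu i) c)].
    have sumE (c : nat -> k) : \sum_(j < size t) c j *: t`_j = orb (y i) (u0 i) (row_of (mu i) c).
      rewrite /orb size_mkseq; apply: eq_bigr => l _.
      by rewrite nth_mkseq ?ltn_ord // coef_row // -ltnS ltn_ord.
    by apply/seteqP; split=> w [c cS ->]; exists c; rewrite ?sumE.
  exists t; rewrite spanE; apply/seteqP; split=> w //=.
  - move=> wL; exists (fun l => coef l (coords w)) => //.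
    by rewrite row_coef cK.
  - move=> [c cS ->] l; rewrite oK; case: (leqP l (mu i)) => lm.
      by rewrite coef_row.
    by rewrite coef_out //; apply: int0.
  - by move=> _; exists (fun l => coef l (coords w)) => //; rewrite row_coef cK.
have natB (m n : nat) : integers val (m%:R - n%:R).
  by apply: (intD vP); [|apply: (intN vP)]; apply: int_nat.
move=> w wL; split=> l.
- rewrite cy; case: l => [|l]; first by rewrite coef_y0; apply: int0.
  case: (leqP l.+1 (mu i)) => lm; first by rewrite coef_y.
  by rewrite coef_out //; apply: int0.
- by rewrite ch coef_h; apply: intM.
- rewrite cx coef_x; apply: (intM vP) => //; apply: (intM vP) => //.
  exact: int_nat.
Qed.

(** The candidate for the homomorphism that takes the value v at u_0. It is defined for every v,
    which makes it a D-linear map on all of V; it takes values in M_i on the highest weight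
    vectors. *)
Definition hom_of i (v : V) : Us i -> V :=
  fun w => @orb k (kmod V) (mu i) (kfun Y) v (coords w).

Lemma hom_of_lin i : linear (@hom_of i).
Proof.
move=> a u v; apply/funext => w; rewrite /hom_of /orb.
rewrite -[RHS]/(a *: (\sum_(l < (mu i).+1) (kscale (coef l (coords w)) (iter l Y u))) +
  \sum_(l < (mu i).+1) kscale (coef l (coords w)) (iter l Y v)).
rewrite scaler_sumr -big_split; apply: eq_bigr => l _ /=.
rewrite -[LHS]/(kscale (coef l (coords w)) (iter l Y (a *: u + v))) linearP /=.
rewrite kscaleDr; congr (_ + _).
exact: (kscale_rscale (coef l (coords w)) (a : D) (iter l Y u)).
Qed.
HB.instance Definition _ i := GRing.isLinear.Build D^c V (Us i -> V) _ (@hom_of i) (@hom_of_lin i).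

Lemma hom_of_u0 i v : @hom_of i v (u0 i) = v.
Proof.
have [oK cK _ _ _] := coords_facts i.
have orb1 (W : lmodType k) (f : W -> W) u :
    orb f u (row_of (mu i) (fun l => (l == 0)%:R)) = u.
  rewrite /orb big_ord_recl coef_row // scale1r big1 ?addr0 // => l _.
  by rewrite lift0 coef_row ?scale0r ?ltn_ord.
by rewrite /hom_of -(orb1 _ (y i) (u0 i)) oK orb1.
Qed.

Lemma hom_of_inj i : injective (@hom_of i).
Proof. by move=> u v /(congr1 (fun f => f (u0 i))); rewrite !hom_of_u0. Qed.

Lemma hom_of_hom i v : vhw H X (mu i) v -> M i (hom_of v : Us i -> V).
Proof.
move=> vh; have [oK cK cy ch cx] := coords_facts i; have [mp _ _] := u0P i.
have [oD oZ oP] := orb_hom nz s nY mp vh; split=> [w w'|a w|w].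
- by rewrite /hom_of linearD oD.
- by rewrite /hom_of linearZ oZ.
- by have := oP (coords w); rewrite /hom_of cy ch cx !lfunE.
Qed.

Lemma hom_vhw i f : M i f -> vhw H X (mu i) (f (u0 i)).
Proof.
move=> fM; have [fD fZ fP] := fM; have [_ [xu hu] _] := u0P i.
have [_ fh fx] := fP (u0 i); split.
  by rewrite -fx xu (sl2_hom0 fM).
by rewrite -fh hu fZ kscale_nat.
Qed.

Lemma hom_ofE i f : M i f -> f = hom_of (f (u0 i)).
Proof.
move=> fM; have [fD fZ fP] := fM; have [oK cK _ _ _] := coords_facts i.
apply/funext => w; rewrite -{1}(cK w) /hom_of /orb.
have -> : forall (F : 'I_(mu i).+1 -> Us i), f (\sum_l F l) = \sum_l f (F l).
  by move=> F; apply: (big_morph f fD (sl2_hom0 fM)).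
by apply: eq_bigr => l _; rewrite fZ; have [_ ->] := sl2_hom_iter l (u0 i) fM.
Qed.

(** Stability under H follows, since H = XY - YX and the terms of a lattice function are additive
    groups. *)
Definition stab (z : RR -> set V) := forall t v, z t v -> z t (X v) /\ z t (Y v).

Definition sl2_latfun (z : RR -> set V) := is_latfun nu setT z /\ stab z.

Section Submodule.
Variables (W : lmodType D^c) (N L : set W).
Hypothesis latL : is_lattice RD N L.

Lemma lat_sub w : L w -> N w.
Proof. by case: latL => t -> -> [c _ ->]; exists c. Qed.

Lemma lat0 : L 0.
Proof.
case: latL => t -> _; exists (fun=> 0) => [_|]; first exact: int0.
by rewrite big1 // => i _; rewrite scale0r.
Qed.

Lemma latD u v : L u -> L v -> L (u + v).
Proof.
case: latL => t -> _ [c cS ->] [d dS ->]; exists (fun i => c i + d i) => [i|].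
  exact: intD.
by rewrite -big_split; apply: eq_bigr => i _; rewrite scalerDl.
Qed.

Lemma latZ (a : D) u : integers nu a -> L u -> L (rscale u a).
Proof.
move=> aS; case: latL => t -> _ [c cS ->].
exists (fun i => (a : D^c) * c i) => [i|].
  by rewrite -[_ * _]/((c i : D) * a); apply: intM.
by rewrite /rscale scaler_sumr; apply: eq_bigr => i _; rewrite scalerA.
Qed.

Lemma lat_kZ (a : k) u : integers val a -> L u -> L (kscale a u).
Proof. by move=> aS; apply: latZ; rewrite /integers /= nu_val. Qed.

Lemma lat_sum (J : Type) (r : seq J) (f : J -> W) :
  (forall j, L (f j)) -> L (\sum_(j <- r) f j).
Proof. by move=> fL; elim/big_ind: _ => //; [exact: lat0|exact: latD]. Qed.

End Submodule.

Lemma sl2_latfun_stable z t : sl2_latfun z -> sl2_stable p (kfun X) (kfun Y) (z t).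
Proof.
move=> [[zl _ _ _] zs]; have lt := zl t; split.
- exact: lat0 lt.
- move=> u v zu zv; apply: (latD lt) => //.
  rewrite -scaleN1r; apply: (lat_kZ lt _ zv); apply: (intN vP); exact: int1.
- by move=> j u jp zu; apply: (lat_kZ lt _ zu); apply: invP.
- by move=> u /zs[].
- by move=> u /zs[].
Qed.

Local Notation res z i := (@restrict_family RR k D V I Us M (@std_lattice) z i).

(** As L_i is the R-span of the Y^l u_0 and [z t] is stable under Y, a homomorphism f maps L_i into
    [z t] as soon as f(u_0) lies in [z t]. *)
Lemma restrictE z (i : I) t : sl2_latfun z ->
  res z i t = [set @hom_of i v | v in [set v | vhw H X (mu i) v /\ z t v]].
Proof.
move=> gz; have [oK cK _ _ _] := coords_facts i; have [[zl _ _ _] zs] := gz.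
apply/seteqP; split=> f /=.
  move=> [fM fL]; exists (f (u0 i)); last by rewrite -hom_ofE.
  split; first exact: hom_vhw; apply: fL => l.
  have -> : coords (u0 i) = row_of (mu i) (fun l => (l == 0)%:R).
    rewrite -[RHS]oK; congr coords; rewrite /orb big_ord_recl coef_row // scale1r.
    by rewrite big1 ?addr0 // => j _; rewrite lift0 coef_row ?scale0r ?ltn_ord.
  case: (leqP l (mu i)) => lm; last by rewrite coef_out //; apply: int0.
  by rewrite coef_row //; apply: int_nat.
move=> [v [vh zv] <-]; split; first exact: hom_of_hom.
move=> w wL; apply: (lat_sum (zl t)) => l; apply: (lat_kZ (zl t)) => //.
by elim: (l : nat) => //= n IH; have [] := zs _ _ IH.
Qed.

Context (c : I -> nat -> V -> V).
Hypotheses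
  (ch : forall i l v, vhw H X (mu i) (c i l v))
  (cE : forall v, v = \sum_i \sum_(l < (mu i).+1) iter l Y (c i l v))
  (cL : forall L : V -> Prop, sl2_stable p (kfun X) (kfun Y) L ->
        forall i l v, L v -> L (c i l v))
  (cU : forall a : I -> nat -> V, (forall i l, vhw H X (mu i) (a i l)) ->
        forall i l, (l <= mu i)%N ->
        c i l (\sum_i \sum_(l < (mu i).+1) iter l Y (a i l)) = a i l).

(** The maps [c i l] arise from a choice; uniqueness of the decomposition makes them linear over
    D. *)
Lemma c_lin i l : (l <= mu i)%N -> linear (c i l).
Proof.
move=> li a u v.
have aP j l1 : vhw H X (mu j) (a *: c j l1 u + c j l1 v) by apply: vhw_lin.
rewrite -(cU aP li); congr (c _ _ _).
rewrite {1}[u]cE {1}[v]cE scaler_sumr -big_split; apply: eq_bigr => j _ /=.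
rewrite scaler_sumr -big_split; apply: eq_bigr => l1 _ /=.
by rewrite linearP.
Qed.

Lemma c_one i j l v : vhw H X (mu i) v -> (l <= mu j)%N ->
  c j l v = if (j == i) && (l == 0)%N then v else 0.
Proof.
move=> vh lj; pose a j l := if (j == i) && (l == 0)%N then v else 0.
have aP j1 l1 : vhw H X (mu j1) (a j1 l1).
  by rewrite /a; case: eqP => [->|_] /=; [case: eqP => _ //|]; apply: vhw0.
rewrite -[RHS]/(a j l) -(cU aP lj); congr (c _ _ _).
rewrite (bigD1 i) //= [X in _ + X]big1 ?addr0; last first.
  by move=> j1 /negPf ne; rewrite big1 // => l1 _; rewrite /a ne; rewrite linear0.
rewrite big_ord_recl big1 ?addr0 => [|l1 _]; first by rewrite /a !eqxx.
by rewrite lift0 /a andbF linear0.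
Qed.

Lemma c_hw i v : vhw H X (mu i) v -> c i 0 v = v.
Proof. by move=> vh; rewrite (c_one vh) // !eqxx. Qed.

(** The map [c i 0] restricts to the identity on highest weight vectors of weight [mu i]. Thus M_i
    and the restricted lattices are images of V and of [z t] under one D-linear map, which makes
    them lattices. *)
Lemma hom_of_image i (N : set V) :
  (forall v, N v -> N (c i 0 v)) ->
  [set @hom_of i (c i 0 v) | v in N] = [set @hom_of i v | v in [set v | vhw H X (mu i) v /\ N v]].
Proof.
move=> Nc; apply/seteqP; split=> _ [v vN <-].
  by exists (c i 0 v) => //; split; [exact: ch|exact: Nc].
by case: vN => vh vN; exists v => //; rewrite c_hw.
Qed.

Lemma hom_image i : M i = [set @hom_of i (c i 0 v) | v in setT].
Proof.
rewrite hom_of_image //; apply/seteqP; split=> f.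
  by move=> fM; exists (f (u0 i)); [split=> //; exact: hom_vhw|rewrite -hom_ofE].
by move=> [v [vh _] <-]; apply: hom_of_hom.
Qed.

Lemma c_in z t i l v : sl2_latfun z -> z t v -> z t (c i l v).
Proof. by move=> gz; apply: cL; apply: sl2_latfun_stable. Qed.

Lemma rscale_inv (W : lmodType D^c) (w : D) (v : W) : w != 0 ->
  rscale (rscale v w) w^-1 = v /\ rscale (rscale v w^-1) w = v.
Proof.
move=> /D_division wU; rewrite /rscale !scalerA.
split; rewrite -[X in X *: _]/((_ : D) * (_ : D)).
  by rewrite [_ * _](divrr wU) scale1r.
by rewrite [_ * _](mulVr wU) scale1r.
Qed.

Lemma vhw_rscale m v (a : D) : vhw H X m v -> vhw H X m (rscale v a).
Proof.
move=> vh; have := vhw_lin (a : D^c) vh (vhw0 H X m).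
by rewrite addr0.
Qed.

Lemma hom_of_rscale i v (a : D) : @hom_of i (rscale v a) = rscale (hom_of v : Us i -> V) a.
Proof. by rewrite /rscale linearZ. Qed.

Lemma restrict_latfun z i : sl2_latfun z -> is_latfun nu (M i) (res z i).
Proof.
move=> gz; have [[zl zd zc zp] zs] := gz; split.
- move=> t; rewrite restrictE // hom_image -hom_of_image; last first.
    by move=> v; apply: c_in.
  apply: lattice_image (zl t).
  by move=> a u v; rewrite (c_lin (leq0n _)) linearP.
- move=> t t' tt'; rewrite !restrictE // => _ [v [vh zv] <-].
  by exists v => //; split=> //; apply: zd zv.
- move=> t; apply/seteqP; split=> f.
    rewrite restrictE // => -[v [vh zv] <-] t' /= tt'.
    rewrite restrictE //; exists v => //; split=> //.
    by apply: (zd t') zv; apply: ltW.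
  (* Any index below t serves to see that f lies in M_i; t - 1 is one. *)
  move=> fz; have fM : M i f by have [|] := fz (t - 1) _; rewrite //= ltrBlDr ltrDl.
  rewrite restrictE //; exists (f (u0 i)); last by rewrite -hom_ofE.
  split; first exact: hom_vhw.
  rewrite zc => t' /= tt'; have := fz _ tt'; rewrite restrictE // => -[v [_ zv] <-].
  by rewrite hom_of_u0.
- move=> w r t wu wr; have [w0 _ _] := wu.
  have wt := zp w r t wu wr.
  apply/seteqP; split=> f; rewrite !restrictE //.
    move=> [v [vh zv] <-]; move: zv; rewrite wt => -[v' zv' vE].
    exists (hom_of v'); last by rewrite -hom_of_rscale vE.
    exists v' => //; split=> //; have [<- _] := rscale_inv v' w0.
    by apply: vhw_rscale; rewrite vE.
  move=> [_ [v [vh zv] <-] <-]; exists (rscale v w); last exact: hom_of_rscale.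
  by split; [exact: vhw_rscale|rewrite wt; exists v].
Qed.

(* Inverse to the restriction of lattice functions to the M i. *)
Definition glue (z : mult_family RR V Us) : RR -> set V :=
  fun t => [set v | forall i l, (l <= mu i)%N -> z i t (hom_of (c i l v))].

Section Glue.
Variable z : mult_family RR V Us.
Arguments z : clear implicits.
Hypothesis zP : forall i, is_latfun nu (M i) (z i).

Lemma mult0 i t : z i t 0.
Proof. by have [zl _ _ _] := zP i; apply: lat0 (zl t). Qed.

Lemma glue_one i t v l : vhw H X (mu i) v -> (l <= mu i)%N ->
  z i t (hom_of v) -> glue z t (iter l Y v).
Proof.
move=> vh li zv j l1 l1j.
pose a j l' := if (j == i) && (l' == l) then v else 0.
have aP j1 l' : vhw H X (mu j1) (a j1 l').
  by rewrite /a; case: eqP => [->|_] /=; [case: eqP => _ //|]; apply: vhw0.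
have -> : iter l Y v = \sum_j \sum_(l' < (mu j).+1) iter l' Y (a j l').
  rewrite (bigD1 i) //= [X in _ + X]big1 ?addr0; last first.
    by move=> j1 /negPf ne; rewrite big1 // => l' _; rewrite /a ne linear0.
  rewrite (bigD1 (Ordinal (li : (l < (mu i).+1)%N))) //= [X in _ + X]big1 ?addr0.
    by rewrite /a !eqxx.
  move=> l' /negPf ne; rewrite /a [_ == l](_ : _ = false) ?andbF ?linear0 //.
rewrite cU // /a; case: eqP => [jE|_] /=; last by rewrite linear0; apply: mult0.
case: eqP => [_|_]; last by rewrite linear0; apply: mult0.
by rewrite jE.
Qed.

Lemma glueD t u v : glue z t u -> glue z t v -> glue z t (u + v).
Proof.
move=> zu zv i l li; have [zl _ _ _] := zP i.
have cD : c i l (u + v) = c i l u + c i l v.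
  by have := c_lin li 1 u v; rewrite !scale1r.
by rewrite cD linearD /=; apply: (latD (zl t)); [apply: zu|apply: zv].
Qed.

Lemma glue0 t : glue z t 0.
Proof.
move=> i l li; have -> : c i l 0 = 0.
  by have := c_lin li (-1) 0 0; rewrite scaler0 addr0 scaleN1r addNr.
by rewrite linear0; apply: mult0.
Qed.

Lemma glue_sumE t v : glue z t v <->
  exists2 a : I -> nat -> V,
    forall i l, vhw H X (mu i) (a i l) /\ z i t (hom_of (a i l))
    & v = \sum_i \sum_(l < (mu i).+1) iter l Y (a i l).
Proof.
split=> [vz|[a aP ->] i l li].
  exists (fun i l => if (l <= mu i)%N then c i l v else 0).
    move=> i l; case: ifP => li; first by split; [apply: ch|apply: vz].
    by split; [exact: vhw0|rewrite linear0; exact: mult0].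
  rewrite {1}[v]cE; apply: eq_bigr => i _; apply: eq_bigr => l _.
  by rewrite -ltnS ltn_ord.
by rewrite cU //; [case: (aP i l)|move=> j l1; case: (aP j l1)].
Qed.

(** The glued set is the finite sum, over i and l <= [mu i], of the images of [z i t] under the
    linear maps f |-> Y^l f(u_0). *)
Lemma glue_lattice t : is_lattice RD setT (glue z t).
Proof.
pose A (B : forall i, set (Us i -> V)) i (l : 'I_(mu i).+1) : set V :=
  [set iter l Y (f (u0 i)) | f in B i].
have evl i l : linear (fun f : Us i -> V => iter l Y (f (u0 i))).
  by move=> a f g; rewrite -[(a *: f + g) (u0 i)]/(a *: f (u0 i) + g (u0 i)) linearP.
have Alat i l : is_lattice RD (A M i l) (A (fun i => z i t) i l).
  by have [zl _ _ _] := zP i; apply: lattice_image (evl i l) (zl t).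
have M0 i : M i (0 : Us i -> V).
  by rewrite -(linear0 (@hom_of i)); apply: hom_of_hom; apply: vhw0.
have A0 B i l : B i 0 -> A B i l 0.
  by move=> B0; exists 0 => //; rewrite -[0 (u0 i)]/(0 : V) linear0.
have Blat i : is_lattice RD (set_bigsum (index_enum _) (A M i))
    (set_bigsum (index_enum _) (A (fun i => z i t) i)).
  apply: lattice_bigsum => //; [exact: int0|exact: index_enum_uniq| |].
    by move=> l; apply/A0/M0.
  by move=> l; apply/A0/mult0.
have B0 i (B : forall l, set V) : (forall l, B l 0) ->
    set_bigsum (index_enum 'I_(mu i).+1) B 0.
  by move=> ?; exists (fun=> 0) => //; rewrite big1.
have := @lattice_bigsum D^c RD V I (index_enum I)
  (fun i => set_bigsum (index_enum _) (A M i))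
  (fun i => set_bigsum (index_enum _) (A (fun i => z i t) i))
  (int0 nuP) (index_enum_uniq I)
  (fun i => B0 i _ (fun l => A0 M i l (M0 i)))
  (fun i => B0 i _ (fun l => A0 (fun i => z i t) i l (mult0 i t))) Blat.
congr is_lattice; apply/seteqP; split=> v //.
- move=> _; exists (fun i => \sum_(l < (mu i).+1) iter l Y (c i l v)); last exact: cE.
  move=> i; exists (fun l : 'I_(mu i).+1 => iter l Y (c i l v)) => // l.
  by exists (hom_of (c i l v)); [apply/hom_of_hom/ch|rewrite hom_of_u0].
- move=> [b bP ->]; elim/big_ind: _ => //; [exact: glue0|exact: glueD|].
  move=> i _; have [a aP ->] := bP i.
  elim/big_ind: _ => //; [exact: glue0|exact: glueD|].
  move=> l _; have [f zf <-] := aP l; have [zl _ _ _] := zP i.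
  have fM := lat_sub (zl t) zf.
  by apply: glue_one; [exact: hom_vhw|rewrite -ltnS|rewrite -hom_ofE].
- move=> vz; exists (fun i => \sum_(l < (mu i).+1) iter l Y (c i l v)); last exact: cE.
  move=> i; exists (fun l : 'I_(mu i).+1 => iter l Y (c i l v)) => // l.
  by exists (hom_of (c i l v)); [apply: vz; rewrite -ltnS|rewrite hom_of_u0].
Qed.

(** On Y^l a, for a of weight m, the operator X acts through an integral multiple of Y^(l-1) a, and
    Y leads out of the range l <= m only to Y^(m+1) a = 0. *)
Lemma glue_stab : stab (glue z).
Proof.
have sk := kfun_ops s.
have sum_in t (F : forall i, 'I_(mu i).+1 -> V) : (forall i l, glue z t (F i l)) ->
    glue z t (\sum_i \sum_l F i l).
  move=> FP; refine (lat_sum (glue_lattice t) _ _) => i.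
  by refine (lat_sum (glue_lattice t) _ _) => l.
move=> t v /glue_sumE[a aP ->]; split; rewrite linear_sum.
  under eq_bigr do rewrite linear_sum.
  apply: sum_in => i [[|l] li] /=.
    by have [[-> _] _] := aP i 0%N; apply: glue0.
  have [vh' az'] := aP i l.+1; have /vhwE[xa ha] := vh'.
  have yx : kfun Y (kfun X (a i l.+1)) = 0 by rewrite xa linear0.
  have -> : X (Y (iter l Y (a i l.+1))) =
      kscale (l.+1%:R * ((mu i)%:R - l%:R)) (iter l Y (a i l.+1)).
    exact: (@X_iterY_eigen k (kmod V) (kfun X) (kfun Y) (kfun H) l _ (a i l.+1) sk yx ha).
  refine (lat_kZ (glue_lattice t) _ _).
    apply: (intM vP); first exact: int_nat.
    by apply: (intD vP); [|apply: (intN vP)]; apply: int_nat.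
  by apply: (glue_one vh' _ az'); apply: ltnW.
under eq_bigr do rewrite linear_sum.
apply: sum_in => i [l li] /=; have [vh az] := aP i l; rewrite -iterS.
move: li; rewrite ltnS leq_eqVlt => /predU1P[lE|li]; last exact: (glue_one vh li az).
have [mp _ _] := u0P i; move/vhwE: vh; rewrite lE => vh.
have -> : iter (mu i).+1 Y (a i (mu i)) = 0 := hw_iterY nz sk nY mp vh.
exact: glue0.
Qed.

Lemma c_rscale i l v (a : D) : (l <= mu i)%N ->
  c i l (rscale v a) = rscale (c i l v) a.
Proof.
move=> li; have := c_lin li (a : D^c) v 0; rewrite addr0.
suff -> : c i l 0 = 0 by rewrite addr0.
by have := c_lin li (-1) 0 0; rewrite scaler0 addr0 scaleN1r addNr.
Qed.

Lemma glue_latfun : sl2_latfun (glue z).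
Proof.
split; last exact: glue_stab.
split.
- exact: glue_lattice.
- move=> t t' tt' v zv i l li; have [_ zd _ _] := zP i.
  by apply: zd tt' _ (zv i l li).
- move=> t; apply/seteqP; split=> v zv.
    move=> t' /= tt' i l li; have [_ zd _ _] := zP i.
    by apply: zd (ltW tt') _ (zv i l li).
  move=> i l li; have [_ _ zc _] := zP i; rewrite zc => t' /= tt'.
  exact: zv.
- move=> w r t wu wr; have [w0 _ _] := wu.
  apply/seteqP; split=> v.
    move=> zv; exists (rscale v w^-1); last by have [] := rscale_inv v w0.
    move=> i l li; have [_ _ _ zp] := zP i.
    have := zv i l li; rewrite (zp w r t wu wr) => -[f zf fE].
    rewrite c_rscale // hom_of_rscale -fE.
    by have [-> _] := rscale_inv f w0.
  move=> [v' zv <-] i l li; have [_ _ _ zp] := zP i.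
  by rewrite (zp w r t wu wr) c_rscale // hom_of_rscale; exists (hom_of (c i l v')) => //; apply: zv.
Qed.

Lemma restrict_glue : (fun i => res (glue z) i) = z.
Proof.
apply: functional_extensionality_dep => i; apply/funext => t.
rewrite restrictE; last exact: glue_latfun.
apply/funext => f; apply/propext; split.
  move=> [v [vh zv] <-]; have := zv i 0%N (leq0n _); by rewrite c_hw.
have [zl _ _ _] := zP i => zf; have fM := lat_sub (zl t) zf.
exists (f (u0 i)); last by rewrite -hom_ofE.
split; first exact: hom_vhw.
apply: (glue_one (l := 0)) => //; [exact: hom_vhw|by rewrite -hom_ofE].
Qed.

End Glue.

(** Rests on the integral form of the decomposition: the components of a vector of [z t] lie in
    [z t] again. *)
Lemma glue_restrict z : sl2_latfun z -> glue (fun i => res z i) = z.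
Proof.
move=> gz; apply/funext => t; apply/seteqP; split=> v zv.
  rewrite [v]cE; have [[zl _ _ _] zs] := gz.
  apply: (lat_sum (zl t)) => i; apply: (lat_sum (zl t)) => l.
  have := zv i l; rewrite -ltnS ltn_ord => /(_ erefl).
  rewrite restrictE // => -[v' [_ zv'] /hom_of_inj <-].
  by elim: (l : nat) => //= n IH; have [] := zs _ _ IH.
move=> i l li; rewrite restrictE //; exists (c i l v) => //.
by split; [exact: ch|exact: c_in].
Qed.

(** * Invariant hermitian forms and duality *)

Section Hermitian.
Context (sigma : D -> D) (eps : k) (F : V -> V -> D).
Hypotheses (sigP : is_involution sigma) (fixP : fixed_center sigma).
Hypothesis epsP : eps = 1 \/ eps = -1.
Hypothesis FP : is_hermitian sigma eps setT F.
Hypothesis skew : forall A, A \in [:: X; Y; H] -> forall v w, F (A v) w + F v (A w) = 0.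

Lemma sigma_k a : sigma a%:A = a%:A.
Proof. by have /(_ (ex_intro _ a erefl))[] := (fixP a%:A).2. Qed.

Lemma sigmaZ a d : sigma (a *: d) = a *: sigma d.
Proof.
have [_ sM _] := sigP.
by rewrite -[a *: d]mulr_algl sM sigma_k -scalerAr mulr1.
Qed.

Lemma sigma0 : sigma 0 = 0.
Proof. by rewrite -(scale0r (0 : D)) sigmaZ !scale0r. Qed.

Lemma FDr f g1 g2 : F f (g1 + g2) = F f g1 + F f g2.
Proof. by have [-> //] := FP. Qed.

Lemma FC f g : F g f = eps *: sigma (F f g).
Proof. by have [_ _ -> //] := FP. Qed.

Lemma FDl f1 f2 g : F (f1 + f2) g = F f1 g + F f2 g.
Proof. by have [sD _ _] := sigP; rewrite !(FC g) FDr sD scalerDr. Qed.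

Lemma FZ a b f g : F (rscale f a) (rscale g b) = sigma a * F f g * b.
Proof. by have [_ -> //] := FP. Qed.

Lemma rscale1 (W : lmodType D^c) (v : W) : rscale v (1 : D) = v.
Proof. exact: scale1r. Qed.

Lemma FZr b f g : F f (kscale b g) = b *: F f g.
Proof.
have -> : F f (kscale b g) = F (rscale f 1) (kscale b g) by rewrite rscale1.
have [_ sM _] := sigP.
by rewrite FZ -[1 : D]scale1r sigma_k scale1r mul1r -scalerAr mulr1.
Qed.

Lemma FZl a f g : F (kscale a f) g = a *: F f g.
Proof. by rewrite !(FC g) FZr sigmaZ !scalerA mulrC. Qed.

Lemma F0r f : F f 0 = 0.
Proof. by apply: (addrI (F f 0)); rewrite -FDr !addr0. Qed.

Lemma F0l g : F 0 g = 0.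
Proof. by rewrite FC F0r sigma0 scaler0. Qed.

Lemma F_sumr f (J : Type) (r : seq J) (g : J -> V) :
  F f (\sum_(j <- r) g j) = \sum_(j <- r) F f (g j).
Proof. exact: (big_morph (F f) (FDr f) (F0r f)). Qed.

Lemma F_suml g (J : Type) (r : seq J) (f : J -> V) :
  F (\sum_(j <- r) f j) g = \sum_(j <- r) F (f j) g.
Proof. exact: (big_morph (F^~ g) (fun f1 f2 => FDl f1 f2 g) (F0l g)). Qed.

Lemma FX f g : F f (X g) = - F (X f) g.
Proof.
by apply/eqP; rewrite eq_sym -subr_eq0 -opprD oppr_eq0 skew // !inE eqxx.
Qed.

Lemma FY f g : F (Y f) g = - F f (Y g).
Proof. by apply/eqP; rewrite -subr_eq0 opprK skew // !inE eqxx orbT. Qed.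

Lemma FH f g : F (H f) g = - F f (H g).
Proof. by apply/eqP; rewrite -subr_eq0 opprK skew // !inE eqxx !orbT. Qed.

Lemma F_iterY l f g : F (iter l Y f) g = (-1) ^+ l *: F f (iter l Y g).
Proof.
elim: l f g => [|l IH] f g; first by rewrite scale1r.
by rewrite iterS FY IH iterSr exprS mulN1r scaleNr.
Qed.

(** Three cases. If l < [mu j] then Y^l b is a multiple of X Y^(l+1) b, and X moved to the other
    side kills a. If l > [mu j] then Y^l b = 0. If l = [mu j] then a and Y^l b have weights [mu i]
    and -[mu j], and their sum is nonzero in k for i <> j. *)
Lemma F_hw_orth i j l a b : vhw H X (mu i) a -> vhw H X (mu j) b ->
  ~~ ((i == j) && (l == mu i)) -> F a (iter l Y b) = 0.
Proof.
move=> [xa ha] hb; have [xb hbE] := hb; have sk := kfun_ops s.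
have [mi _ _] := u0P i; have [mj _ _] := u0P j.
have [lj|] := ltnP l (mu j).
  move=> _; have hz := (vhwE H X (mu j) b).1 hb.
  have yx : kfun Y (kfun X b) = 0 by rewrite /kfun xb linear0.
  have := @X_iterY_eigen k (kmod V) (kfun X) (kfun Y) (kfun H) l _ b sk yx hz.2.
  move/(congr1 (F a)); rewrite -[X in F a X = _]/(X (iter l.+1 Y b)) FX xa F0l oppr0.
  rewrite -[X in F a X]/(kscale (l.+1%:R * ((mu j)%:R - l%:R)) (iter l Y b)) FZr.
  move=> /esym/eqP; rewrite scaler_eq0 mulf_eq0 -natrB ?(ltnW lj) //.
  rewrite (negPf (nz (j := l.+1) _)) ?(negPf (nz (j := mu j - l) _)) //.
  - by move/eqP.
  - by lia.
  - by lia.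
rewrite leq_eqVlt => /predU1P[lE|lj]; last first.
  move=> _; have -> : iter l Y b = 0; last exact: F0r.
  rewrite -(subnK lj) iterD.
  have -> : iter (mu j).+1 Y b = 0.
    by apply: (hw_iterY nz sk nY mj (w := b : kmod V)); apply/vhwE.
  by elim: (l - _)%N => //= n ->; rewrite linear0.
have [ij|ij] := eqVneq i j; first by rewrite -lE ij eqxx.
move=> _.
have hY : H (iter l Y b) = kscale (- (mu j)%:R) (iter l Y b).
  have e : kfun H (iter l (kfun Y) b) =
      - (mu j)%:R *: (iter l (kfun Y) b : kmod V).
    rewrite (H_iterY l (b : kmod V) sk) /= ((vhwE H X (mu j) b).1 hb).2 linearZ /= -scalerBl -lE.
    by congr (_ *: _); rewrite natrM; ring.
  exact: e.
have := FH a (iter l Y b); rewrite ha hY FZr scaleNr opprK -kscale_nat FZl.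
move/eqP; rewrite -subr_eq0 -scalerBl scaler_eq0 => /orP[|/eqP //].
have /eqP : mu i <> mu j.
  by move=> /(hwt_inj nz nX nY irrs) ij'; rewrite ij' eqxx in ij.
rewrite neq_ltn => /orP[lt|lt]; [rewrite -oppr_eq0 opprB|]; rewrite -natrB ?(ltnW lt) //.
  by rewrite (negPf (nz _)) //; lia.
by rewrite (negPf (nz _)) //; lia.
Qed.

Definition gamma i (f g : Us i -> V) : D := F (f (u0 i)) (iter (mu i) Y (g (u0 i))).

Definition beta i (u w : Us i) : k := std_form (coords u) (coords w).

(** The sign of the form changes with the parity of [mu i], as Y^(mu i) is moved across F. It is
    non-degenerate because f(u_0) is orthogonal to every Y^l b, with b a highest weight vector,
    except those that enter [gamma]. *)
Lemma gamma_hermitian i :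
  is_hermitian sigma ((-1) ^+ mu i * eps) (M i) (@gamma i).
Proof.
have [sD sM sK] := sigP; split.
- move=> f g1 g2 _ _ _; rewrite /gamma -FDr.
  by rewrite -[(g1 + g2) (u0 i)]/(g1 (u0 i) + g2 (u0 i)) linearD.
- move=> f g a b _ _; rewrite /gamma -FZ.
  rewrite -[rscale f a (u0 i)]/(rscale (f (u0 i)) a).
  by rewrite -[rscale g b (u0 i)]/(rscale (g (u0 i)) b) /rscale linearZ.
- move=> f g _ _; rewrite /gamma -scalerA -FC F_iterY scalerA -expr2 sqrr_sign.
  by rewrite scale1r.
- move=> f fM f0; rewrite (hom_ofE fM).
  suff -> : f (u0 i) = 0 by rewrite linear0.
  have [_ _ _ nd] := FP; apply: nd => // g _.
  rewrite [g]cE F_sumr big1 // => j _; rewrite F_sumr big1 // => l _.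
  have fh := hom_vhw fM; have gh := ch j l g.
  case: (boolP ((i == j) && (l == mu i :> nat))) => [/andP[/eqP ij /eqP lE]|]; last first.
    exact: (F_hw_orth fh gh).
  rewrite lE; have := f0 (hom_of (c i (mu i) g)) (hom_of_hom (ch _ _ _)).
  by rewrite /gamma hom_of_u0 -ij.
Qed.

Lemma gamma_mult i : exists beta : Us i -> Us i -> k,
  [/\ forall u, scalar (beta u), forall u, scalar (beta^~ u),
      forall A u w, A \in [:: y i; h i; x i] -> beta (A u) w + beta u (A w) = 0
    & forall f g u w, M i f -> M i g -> F (f u) (g w) = beta u w *: gamma f g].
Proof.
have [oK cK cy ch' cx] := coords_facts i.
exists (@beta i); split.
- by move=> u a w w'; rewrite /beta linearP std_form_linr.
- by move=> u a w w'; rewrite /beta linearP std_form_linl.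
- move=> A u w; rewrite !inE => /or3P[] /eqP->; rewrite /beta.
  + by rewrite !cy std_form_y.
  + by rewrite !ch' std_form_h.
  + by rewrite !cx std_form_x.
move=> f g u w fM gM; have fh := hom_vhw fM; have gh := hom_vhw gM.
rewrite (hom_ofE fM) (hom_ofE gM) /gamma !hom_of_u0.
set a := f (u0 i); set b := g (u0 i).
have EE v (w' : Us i) : hom_of v w' =
  \sum_(l < (mu i).+1) kscale (coef l (coords w')) (iter l Y v) by [].
rewrite !EE F_suml /beta /std_form scaler_suml; apply: eq_bigr => j _.
have jm : (j <= mu i)%N by rewrite -ltnS.
rewrite F_sumr (bigD1 (inord (mu i - j))) //= big1 ?addr0.
  rewrite inordK ?ltnS ?leq_subr // FZl FZr F_iterY -iterD subnKC // !scalerA.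
  by congr (_ *: _); ring.
move=> l ne; rewrite FZl FZr F_iterY -iterD (F_hw_orth fh gh) ?scaler0 //.
rewrite eqxx /=; apply: contra ne => /eqP lE; apply/eqP/val_inj.
by rewrite /= inordK ?ltnS ?leq_subr //; move: lE; lia.
Qed.

Lemma gamma_eps i : (-1) ^+ mu i * eps = 1 \/ (-1) ^+ mu i * eps = -1.
Proof.
rewrite -signr_odd; case: epsP => ->; case: odd; rewrite /= ?expr0 ?expr1; 
  by [left; ring|right; ring].
Qed.

Section Dual.
Variable z : mult_family RR V Us.
Arguments z : clear implicits.
Hypothesis zP : forall i, is_latfun nu (M i) (z i).

Let zd : mult_family RR V Us := fun i => dual_latfun nu (@gamma i) (M i) (z i).
Arguments zd : clear implicits.

Lemma pos_sum (J : Type) (r : seq J) (f : J -> D) :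
  (forall j, (0 < nu (f j))%E) -> (0 < nu (\sum_(j <- r) f j)%R)%E.
Proof.
by move=> fp; elim/big_ind: _ => //; [rewrite (val0 nuP) ltry|exact: posD].
Qed.

Lemma nu_sign n d : nu ((-1) ^+ n *: d) = nu d.
Proof.
by rewrite -signr_odd; case: odd; rewrite ?expr1 ?scaleN1r ?(valN nuP) ?expr0 ?scale1r.
Qed.

(** F pairs the component (i, l) with (i, mu i - l), up to sign through [gamma], and is zero on all
    other pairs; duals can therefore be computed component by component. *)
Lemma dual_glue : dual_latfun nu F setT (glue z) = glue zd.
Proof.
apply/funext => t; apply/seteqP; split=> v.
  move=> [_ vz] i l li; split; first exact/hom_of_hom/ch.
  move=> g [s' /= ts zg]; have [zl _ _ _] := zP i.
  have gM := lat_sub (zl s') zg; have gh := hom_vhw gM.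
  (* This test vector isolates the component (i, l) of v. *)
  have wz : glue z s' (iter (mu i - l) Y (g (u0 i))).
    by apply: (glue_one zP gh (leq_subr _ _)); rewrite -hom_ofE.
  have := vz _ (ex_intro2 _ _ s' ts wz).
  suff -> : F v (iter (mu i - l) Y (g (u0 i))) = (-1) ^+ l *: gamma (hom_of (c i l v)) g.
    by rewrite nu_sign.
  rewrite {1}[v]cE F_suml (bigD1 i) //= [X in _ + X]big1 ?addr0; last first.
    move=> j ji; rewrite F_suml big1 // => l' _.
    rewrite F_iterY -iterD (F_hw_orth (ch j l' v) gh) ?scaler0 //.
    by rewrite (negPf ji).
  rewrite F_suml (bigD1 (Ordinal (li : (l < (mu i).+1)%N))) //= [X in _ + X]big1 ?addr0.
    by rewrite F_iterY -iterD subnKC // /gamma hom_of_u0.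
  move=> l' ne; rewrite F_iterY -iterD (F_hw_orth (ch i l' v) gh) ?scaler0 //.
  rewrite eqxx /=; apply: contra ne => /eqP e; apply/eqP/val_inj => /=.
  by move: e; have := ltn_ord l'; lia.
move=> vz; split=> // w [s' /= ts /(glue_sumE zP)[a aP ->]].
rewrite F_sumr; apply: pos_sum => j; rewrite F_sumr; apply: pos_sum => l.
rewrite [v]cE F_suml; apply: pos_sum => i; rewrite F_suml; apply: pos_sum => l'.
rewrite F_iterY nu_sign -iterD; have [ah az] := aP j l.
case: (boolP ((i == j) && (l' + l == mu i)%N)) => [/andP[/eqP ij /eqP e]|ne]; last first.
  by rewrite (F_hw_orth (ch i l' v) ah ne) (val0 nuP) ltry.
subst j; have l'm : (l' <= mu i)%N by rewrite -ltnS.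
have [_ /(_ (hom_of (a i l)))] := vz i l' l'm.
by rewrite /gamma !hom_of_u0 e; apply; exists s'.
Qed.

(** Of N only [N j t 0] is asked, so that the lemma applies to the dual family before anything else
    is known about it. *)
Lemma glue_hw N i t v : (forall j, N j t 0) -> vhw H X (mu i) v ->
  glue N t v <-> N i t (hom_of v).
Proof.
move=> N0 vh; split=> [/(_ i 0%N (leq0n _))|Nv j l lj]; first by rewrite c_hw.
rewrite (c_one vh lj); case: ifP => [/andP[/eqP -> _] //|_].
rewrite linear0; exact: N0.
Qed.

Lemma selfdual_glue :
  glue z = dual_latfun nu F setT (glue z) <-> forall i, z i = zd i.
Proof.
rewrite dual_glue; split=> [zz i|zz]; last first.
  by congr glue; apply: functional_extensionality_dep.
have zd0 j t : zd j t 0.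
  split; first by rewrite -(linear0 (@hom_of j)); apply: hom_of_hom; apply: vhw0.
  by move=> g _; rewrite /gamma F0l (val0 nuP) ltry.
apply/funext => t; apply/funext => f; apply/propext.
(* Both families consist of subsets of M_i, and an element of M_i is tested through the highest
   weight vector f(u_0). *)
have key : M i f -> z i t f <-> zd i t f.
  move=> fM; rewrite (hom_ofE fM); have fh := hom_vhw fM.
  rewrite -(glue_hw (fun j => mult0 zP j t) fh) -(glue_hw (fun j => zd0 j t) fh).
  by rewrite zz.
split=> zf.
  by have [zl _ _ _] := zP i; apply/(key _).1 => //; apply: lat_sub (zl t) _ zf.
by have [fM _] := zf; apply/(key fM).
Qed.

End Dual.
End Hermitian.
End Frame.

(** * From phi to the triple *)

Section Interpolation.
Context (k : fieldType) (W : lmodType k) (L : W -> Prop).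
Hypothesis LB : forall u v, L u -> L v -> L (u - v).

(* Synthetic division: G(t) - G(a_0) = (t - a_0) S(t), where S has degree one
   less than G and takes its values in L at the remaining points. *)
Lemma interpolation (d : nat) (a : nat -> k) (f : nat -> W) :
  (forall i u, (i <= d)%N -> L u -> L (a i *: u)) ->
  (forall i j u, (i < j <= d)%N -> L u -> L ((a j - a i)^-1 *: u)) ->
  (forall i j, (i < j <= d)%N -> a i != a j) ->
  (forall i, (i <= d)%N -> L (\sum_(j < d.+1) a i ^+ j *: f j)) ->
  forall j, (j <= d)%N -> L (f j).
Proof.
elim: d a f => [|d IH] a f La Linv an Lf j jd.
  have := Lf 0%N (leqnn _); rewrite big_ord1 scale1r.
  by move: jd; rewrite leqn0 => /eqP ->.
(* The coefficients of S, by Horner's scheme. *)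
pose h j := \sum_(l < d.+1 - j) a 0%N ^+ l *: f (j + l).+1.
have hd : h d.+1 = 0 by rewrite /h subnn big_ord0.
have fS i : (i <= d)%N -> f i.+1 = h i - a 0%N *: h i.+1.
  move=> id; rewrite /h subSn // big_ord_recl scale1r addn0 subSS.
  rewrite scaler_sumr -addrA -sumrB big1 ?addr0 // => l _.
  by rewrite lift0 scalerA -exprS addnS addSn subrr.
have G t : \sum_(i < d.+2) t ^+ i *: f i =
    f 0%N + a 0%N *: h 0%N + (t - a 0%N) *: \sum_(i < d.+1) t ^+ i *: h i.
  have e : \sum_(i < d.+1) t ^+ i.+1 *: h i.+1 + h 0%N = \sum_(i < d.+1) t ^+ i *: h i.
    rewrite big_ord_recr /= hd scaler0 addr0 [RHS]big_ord_recl scale1r addrC.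
    by congr (_ + _); apply: eq_bigr => i _; rewrite lift0.
  rewrite big_ord_recl scale1r -addrA; congr (_ + _).
  rewrite scalerBl -{2}e scalerDr opprD addrCA [X in _ + X]addrCA subrr addr0.
  rewrite !scaler_sumr -sumrB; apply: eq_bigr => i _.
  rewrite lift0 fS; last by rewrite -ltnS.
  rewrite scalerBr !scalerA -exprS.
  by rewrite mulrC.
have Lh i : (i <= d)%N -> L (h i).
  apply: (IH (fun i => a i.+1)) => [i1 u id|i1 j1 u ij|i1 j1 ij|i1 id].
  - exact: La.
  - by apply: Linv; lia.
  - by apply: an; lia.
  have nz : a i1.+1 - a 0%N != 0 by rewrite subr_eq0 eq_sym an.
  rewrite -(scalerK nz (\sum_(j < d.+1) _)).
  apply: Linv; first by lia.
  have -> : (a i1.+1 - a 0%N) *: (\sum_(j0 < d.+1) a i1.+1 ^+ j0 *: h j0) =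
     \sum_(j < d.+2) a i1.+1 ^+ j *: f j - \sum_(j < d.+2) a 0%N ^+ j *: f j.
    by rewrite !G subrr scale0r addr0 addrAC subrr add0r.
  by apply: LB; apply: Lf.
have L0 : L 0 by rewrite -(subrr (h 0%N)); apply: LB; apply: Lh.
have Lh' i : L (h i.+1) \/ (d < i)%N.
  by case: (ltngtP i d) => id; [left; apply: Lh|right|left; rewrite id hd].
case: j jd => [|j] jd.
  have -> : f 0%N = \sum_(j < d.+2) a 0%N ^+ j *: f j - a 0%N *: h 0%N.
    by rewrite G subrr scale0r addr0 addrK.
  by apply: LB; [apply: Lf|apply: La => //; apply: Lh].
rewrite fS //; apply: LB; first exact: Lh.
apply: La => //; case: (Lh' j) => // dj; move: jd; lia.
Qed.

End Interpolation.

(** Interpolation for the zero subgroup: the points of an infinite sequence determine a polynomial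
    with coefficients in W. *)
Lemma poly_vanish (k : fieldType) (W : lmodType k) (a : nat -> k) (d : nat) (f : nat -> W) :
  injective a -> (forall t, \sum_(j < d) t ^+ j *: f j = 0) ->
  forall j, (j < d)%N -> f j = 0.
Proof.
case: d => // d ai f0 j jd.
apply: (@interpolation k W (fun u => u = 0) _ d a f) => //.
- by move=> u v -> ->; rewrite subrr.
- by move=> i u _ ->; rewrite scaler0.
- by move=> i l u _ ->; rewrite scaler0.
- by move=> i l il; apply/eqP => /ai; lia.
Qed.

Section Nilpotency.
Import VectorInternalTheory.
Context (k : fieldType) (D : falgType k) (V : vectType D^c) (X : 'End(V)).
Hypothesis D_division : is_division D.

(* If X^n v <> 0 for n = dim V then v, X v, ..., X^n v are independent over D,
   which is impossible already by counting dimensions over k. *)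
Lemma nilpotent_dim B : (forall v, iter B X v = 0) ->
  forall v, iter (dim V) X v = 0.
Proof.
move=> nB v; set n := dim V; apply: contrapT => /eqP nv.
(* N is the last exponent for which X^N v is nonzero. *)
have [N [nN XN XN1]] : exists N, [/\ (n <= N)%N, iter N X v != 0 & iter N.+1 X v = 0].
  have ex : exists m, iter (n + m) X v == 0.
    by exists B; rewrite addnC iterD nB.
  case: (ex_minnP ex) => -[|m] /eqP vm mmin; first by rewrite addn0 in vm; rewrite vm eqxx in nv.
  exists (n + m)%N; split; [exact: leq_addr| |by rewrite -addnS].
  by apply/negP => /mmin; rewrite ltnn.
have X0 l : iter l X (0 : V) = 0 by elim: l => //= l ->; rewrite linear0.
(* Once the coefficients before a_j are known to vanish, X^(N-j) reduces the relation to X^N v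
   multiplied by a_j. *)
have ind (a : nat -> D) : \sum_(j < n.+1) rscale (iter j X v) (a j) = 0 ->
    forall j, (j <= n)%N -> a j = 0.
  move=> sa j; elim/ltn_ind: j => j IH jn.
  have := congr1 (iter (N - j) X) sa; rewrite X0 linear_sum.
  rewrite (bigD1 (inord j)) //= inordK // big1 ?addr0; last first.
    move=> i ij; have {}ij : i != j :> nat.
      by apply: contra ij => /eqP <-; rewrite inord_val.
    rewrite linearZ /= -iterD; have [lt|ge] := ltnP i j.
      by rewrite IH ?(leq_trans (ltnW lt)) // [_ *: _]scale0r.
    rewrite (_ : N - j + i = (N - j + i - N.+1) + N.+1)%N; last by lia.
    by rewrite iterD XN1 X0 scaler0.
  rewrite linearZ /= -iterD subnK ?(leq_trans jn) // => aX.
  apply/eqP; apply: contraTT XN => /D_division aU; apply/negPn/eqP.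
  rewrite -[LHS](scale1r (_ : V)) -[1](mulVr (aU : (a j : D^c) \is a GRing.unit)).
  by rewrite -scalerA aX scaler0.
(* The combination with coefficients a, in coordinates: a k-linear map from D^(n+1) to D^n,
   injective by independence. *)
pose T (a : {ffun 'I_n.+1 -> D}) := [ffun i : 'I_n =>
    (v2r (\sum_(j < n.+1) rscale (iter j X v) (a j)) 0 i : D)].
have Tlin : linear T.
  move=> c a b; apply/ffunP => i; rewrite !ffunE.
  have -> : \sum_(j < n.+1) rscale (iter j X v) ((c *: a + b) j) =
      (c%:A : D^c) *: (\sum_(j < n.+1) rscale (iter j X v) (a j)) +
      \sum_(j < n.+1) rscale (iter j X v) (b j).
    rewrite scaler_sumr -big_split; apply: eq_bigr => j _ /=.
    rewrite /rscale !ffunE [LHS]scalerDl scalerA; congr (_ *: _ + _).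
    by rewrite -[RHS]/(a j * c%:A : D) -scalerAr mulr1.
  rewrite linearP !mxE; congr (_ + _).
  set d := v2r _ _ _; rewrite -[LHS]/(@GRing.mul D (d : D) c%:A).
  by rewrite -scalerAr mulr1.
pose T' : {linear _ -> _} := HB.pack T (GRing.isLinear.Build k _ _ _ T Tlin).
have kerT : lker (linfun T') = 0%VS.
  apply/eqP/lker0P => a b; rewrite !lfunE /= => ab.
  apply/ffunP => j; apply/eqP; rewrite -subr_eq0; apply/eqP.
  have T0 : T (a - b) = 0.
    have := Tlin (-1) b a; rewrite !scaleN1r ab addNr => <-.
    by rewrite addrC.
  have := ind (fun l => (a - b) (inord l)) _ j; rewrite inord_val !ffunE; apply.
    apply: v2r_inj; rewrite linear0; apply/rowP => i; rewrite !mxE.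
    have := congr1 (fun f : {ffun _ -> _} => f i) T0; rewrite !ffunE => <-.
    by congr (v2r _ 0 i); apply: eq_bigr => l _; rewrite inord_val.
  by rewrite -ltnS.
have := dimvS (subvf (limg (linfun T'))).
rewrite limg_dim_eq ?kerT ?capv0 // !dimvf.
rewrite -[dim {ffun 'I_n.+1 -> D}]/(#|'I_n.+1| * dim D)%N.
rewrite -[dim {ffun 'I_n -> D}]/(#|'I_n| * dim D)%N !card_ord leq_pmul2r ?ltnn //.
rewrite lt0n; apply/eqP => d0; have := oner_neq0 D.
have : (1 : D) \in {:D}%VS by rewrite memvf.
have /eqP : \dim {:D} = 0%N by rewrite dimvf.
by rewrite dimv_eq0 => /eqP ->; rewrite memv0 => ->.
Qed.
End Nilpotency.

(** * Polynomial one-parameter groups *)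

Section OneParameter.
Context (k : fieldType) (D : falgType k) (V : vectType D^c).
Context (phi : 'M[k]_2 -> 'End(V)) (P : seq ('M[nat]_2 * 'End(V))).
Context (A : 'M[k]_2) (X : 'End(V)) (a : nat -> k).
Hypothesis a_inj : injective a.
Hypothesis detA : forall t, \det (1%:M + t *: A) = 1.
Hypothesis mulA : forall s t,
  (1%:M + s *: A) *m (1%:M + t *: A) = 1%:M + (s + t) *: A.
Hypothesis phiM : forall g1 g2, \det g1 = 1 -> \det g2 = 1 ->
  phi (g1 *m g2) = (phi g1 \o phi g2)%VF.
Hypothesis phi1 : phi 1%:M = \1%VF.
Hypothesis phiP : forall g, \det g = 1 -> forall v, phi g v = poly_eval P g v.
Hypothesis dX : forall v, poly_diff P A v = X v.

Definition mono (e : 'M[nat]_2) : {poly k} :=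
  sl2_monomial e (1%:M + 'X *: map_mx polyC A).

Lemma horner_mono e t : (mono e).[t] = sl2_monomial e (1%:M + t *: A).
Proof.
rewrite /mono /sl2_monomial horner_prod; apply: eq_bigr => i _.
rewrite horner_prod; apply: eq_bigr => j _; rewrite horner_exp; congr (_ ^+ _).
by rewrite !mxE hornerD hornerM hornerX hornerC hornerMn hornerC.
Qed.

(** The coefficient of T^j in P (1 + T A) v. *)
Definition coef_at j (v : V) : kmod V :=
  \sum_(m <- P) (mono m.1)`_j *: (m.2 v : kmod V).

(** The offset 2 keeps degree 1 within range even if all monomials are constant or P is empty. *)
Definition deg_bound := (\max_(m <- P) size (mono m.1)).+2.

Lemma coef_at_big j v : (deg_bound <= j)%N -> coef_at j v = 0.
Proof.
move=> bj; rewrite /coef_at big_seq big1 // => m mP.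
rewrite nth_default ?scale0r //; apply: leq_trans bj.
rewrite /deg_bound; apply: leqW; apply: leqW.
by apply: (leq_bigmax_seq (F := fun m => size (mono m.1))).
Qed.

Lemma phi_coef t v :
  phi (1%:M + t *: A) v = \sum_(j < deg_bound) t ^+ j *: coef_at j v :> kmod V.
Proof.
rewrite phiP // /coef_at.
under [RHS]eq_bigr do rewrite scaler_sumr.
rewrite exchange_big /= /poly_eval big_seq [RHS]big_seq; apply: eq_bigr => m mP.
rewrite -horner_mono (@horner_coef_wide _ deg_bound); last first.
  rewrite /deg_bound; apply: leqW; apply: leqW.
  by apply: (leq_bigmax_seq (F := fun m => size (mono m.1))).
rewrite -[LHS]/(_ *: (m.2 v : kmod V)) scaler_suml.
by apply: eq_bigr => j _; rewrite scalerA mulrC.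
Qed.

Lemma coef_at1 v : coef_at 1 v = X v.
Proof. exact: dX. Qed.

Lemma coef_at0 v : coef_at 0 v = v.
Proof.
have sum0 n (f : nat -> kmod V) : \sum_(j < n.+1) 0 ^+ j *: f j = f 0%N.
  rewrite big_ord_recl scale1r big1 ?addr0 // => j _.
  by rewrite lift0 expr0n scale0r.
have := phi_coef 0 v; rewrite scale0r addr0 phi1 id_lfunE => e.
by rewrite [RHS]e; symmetry; exact: (sum0 _ (fun j => coef_at j v)).
Qed.

(** The coefficient of t in phi(s + t) v = phi(s) phi(t) v says that phi(s) X v is the derivative of
    phi(s) v with respect to s; comparing the coefficients in s gives the recursion. *)
Lemma coef_at_X j v : coef_at j (X v) = j.+1%:R *: coef_at j.+1 v.
Proof.
pose B := deg_bound.
have step s : \sum_(j < B) s ^+ j *: coef_at j (X v) =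
    \sum_(j < B) ('C(j, 1)%:R * s ^+ (j - 1)) *: coef_at j v.
  pose u := kfun (phi (1%:M + s *: A)).
  pose f i : kmod V := \sum_(j < B) ('C(j, i)%:R * s ^+ (j - i)) *: coef_at j v -
    u (coef_at i v).
  have f0 t : \sum_(i < B) t ^+ i *: f i = 0.
    have e1 : u (\sum_(j < B) t ^+ j *: coef_at j v) =
        \sum_(j < B) (s + t) ^+ j *: coef_at j v.
      rewrite -(phi_coef t v) -(phi_coef (s + t) v) -mulA phiM //.
      by rewrite comp_lfunE.
    rewrite /f; under eq_bigr do rewrite scalerBr.
    rewrite sumrB; apply/eqP; rewrite subr_eq0; apply/eqP.
    transitivity (u (\sum_(j < B) t ^+ j *: coef_at j v)); last first.
      by rewrite /u linear_sum; apply: eq_bigr => i _; rewrite linearZ.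
    rewrite e1; under eq_bigr do rewrite scaler_sumr.
    rewrite exchange_big /=; apply: eq_bigr => l _.
    under eq_bigr do rewrite scalerA.
    rewrite -scaler_suml; congr (_ *: _); rewrite exprDn.
    rewrite (big_ord_widen B (fun i => s ^+ (l - i) * t ^+ i *+ 'C(l, i))) //.
    rewrite [RHS]big_mkcond; apply: eq_bigr => i _; case: ifP => ij.
      by rewrite -mulr_natl; ring.
    by rewrite bin_small ?mul0r ?mulr0 // ltnNge -ltnS ij.
  have := poly_vanish a_inj f0 (j := 1) isT.
  move/eqP; rewrite subr_eq0 coef_at1 => /eqP ->.
  by rewrite -(phi_coef s (X v)).
pose g j := coef_at j (X v) - j.+1%:R *: coef_at j.+1 v.
have g0 t : \sum_(j < B) t ^+ j *: g j = 0.
  rewrite /g; under eq_bigr do rewrite scalerBr.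
  rewrite sumrB; apply/eqP; rewrite subr_eq0; apply/eqP; rewrite step.
  rewrite /B /deg_bound; set m := (\max_(_ <- _) _).+1.
  rewrite big_ord_recl [RHS]big_ord_recr /= mul0r scale0r add0r.
  rewrite (@coef_at_big m.+1 v (leqnn _)) !scaler0 addr0.
  apply: eq_bigr => i _.
  by rewrite /bump add1n bin1 subn1 scalerA mulrC.
have [jB|Bj] := ltnP j B.
  by apply/eqP; rewrite -subr_eq0; apply/eqP; exact: (poly_vanish a_inj g0).
by rewrite !coef_at_big ?scaler0 // ltnW.
Qed.

Lemma coef_at_fact j v : iter j X v = j`!%:R *: coef_at j v :> kmod V.
Proof.
elim: j v => [|j IH] v; first by rewrite scale1r coef_at0.
by rewrite iterSr IH coef_at_X scalerA factS natrM mulrC.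
Qed.

Lemma dphi_nilpotent v : iter deg_bound X v = 0.
Proof. by rewrite coef_at_fact coef_at_big // scaler0. Qed.

(** Nonvanishing of all factorials means characteristic 0. Otherwise j! [coef_at j v] = X^j v does
    not determine the coefficients of degree p and above. *)
Lemma phi_exp p t v : (forall j, j`!%:R != 0 :> k) -> (forall w, iter p.-1 X w = 0) ->
  phi (1%:M + t *: A) v = truncated_exp p t X v.
Proof.
move=> fz nX; pose g j : kmod V := (t ^+ j / j`!%:R) *: (iter j X v : kmod V).
have g0 j : (p <= j)%N -> g j = 0.
  move=> pj; rewrite /g (_ : iter j X v = 0) ?scaler0 //.
  rewrite -(subnK (leq_trans (leq_pred p) pj)) iterD nX.
  by elim: (j - _)%N => //= n ->; rewrite linear0.
have gB j : (deg_bound <= j)%N -> g j = 0.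
  by move=> bj; rewrite /g coef_at_fact coef_at_big // !scaler0.
have sumE B B' : (B <= B')%N -> (forall j, (B <= j)%N -> g j = 0) ->
    \sum_(j < B) g j = \sum_(j < B') g j.
  move=> BB gz; rewrite (big_ord_widen B' g BB) big_mkcond /=.
  by apply: eq_bigr => j _; case: ltnP => // /gz ->.
rewrite phi_coef -[RHS]/(\sum_(j < p) g j).
transitivity (\sum_(j < deg_bound) g j).
  by apply: eq_bigr => j _; rewrite /g coef_at_fact scalerA divfK.
by rewrite (sumE _ (maxn p deg_bound)) ?leq_maxr // (sumE p (maxn p deg_bound)) ?leq_maxl.
Qed.

End OneParameter.

Section Matrix2.
Context (k : comUnitRingType).

Definition mx2 (a b c d : k) : 'M[k]_2 :=
  \matrix_(i, j) if i == 0 then if j == 0 then a else b else if j == 0 then c else d.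

Lemma mx2_eta (g : 'M[k]_2) : g = mx2 (g 0 0) (g 0 1) (g 1 0) (g 1 1).
Proof.
apply/matrixP => i j; rewrite mxE.
by case: i => -[|[|//]] ?; case: j => -[|[|//]] ? /=; congr (g _ _); apply/val_inj.
Qed.

Lemma mx2M a b c d a' b' c' d' :
  mx2 a b c d *m mx2 a' b' c' d' =
  mx2 (a * a' + b * c') (a * b' + b * d') (c * a' + d * c') (c * b' + d * d').
Proof.
apply/matrixP => i j; rewrite !mxE !big_ord_recl big_ord0 !mxE /= addr0.
by case: i => -[|[|//]] ?; case: j => -[|[|//]] ? /=.
Qed.

Lemma det_mx2 a b c d : \det (mx2 a b c d) = a * d - b * c.
Proof.
rewrite (expand_det_row _ 0) !big_ord_recl big_ord0 /cofactor !det_mx11 !mxE /=.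
by rewrite /bump /= addr0 expr0 mul1r expr1 mulN1r mulrN.
Qed.

Lemma upperE t : 1%:M + t *: delta_mx 0 1 = mx2 1 t 0 1.
Proof.
apply/matrixP => i j; rewrite !mxE.
by case: i => -[|[|//]] ?; case: j => -[|[|//]] ? /=; rewrite ?mulr0 ?mulr1 ?add0r ?addr0.
Qed.

Lemma lowerE t : 1%:M + t *: delta_mx 1 0 = mx2 1 0 t 1.
Proof.
apply/matrixP => i j; rewrite !mxE.
by case: i => -[|[|//]] ?; case: j => -[|[|//]] ? /=; rewrite ?mulr0 ?mulr1 ?add0r ?addr0.
Qed.

Lemma mx2_1 : 1%:M = mx2 1 0 0 1.
Proof. by rewrite -(upperE 0) scale0r addr0. Qed.

End Matrix2.

(** * Generation of SL_2(R) by transvections *)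

Section IntegralSL2.
Context (RR : realType) (k : fieldType) (val : k -> \bar RR).
Hypothesis vP : is_valuation val.

Lemma val0_inv a : val a = 0 -> integers val a^-1.
Proof.
move=> va; have a0 : a != 0.
  by apply/eqP => a0; move: va; rewrite a0 (val0 vP).
by rewrite /integers /= (val_unit vP (divff a0) va).
Qed.

(** If the lower left entry c is a unit, the matrix is a product of an upper, a lower and an upper
    transvection. If not, ad - bc = 1 makes a a unit, and adding the first row to the second
    replaces c by the unit a + c. *)
Lemma sl2_generated (Q : 'M[k]_2 -> Prop) :
  (forall t, integers val t -> Q (mx2 1 t 0 1)) ->
  (forall t, integers val t -> Q (mx2 1 0 t 1)) ->
  (forall g1 g2, Q g1 -> Q g2 -> Q (g1 *m g2)) ->
  forall g, \det g = 1 -> (forall i j, integers val (g i j)) -> Q g.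
Proof.
move=> Qu Ql QM.
have unitc a b c d : a * d - b * c = 1 -> integers val a -> integers val d ->
    val c = 0 -> Q (mx2 a b c d).
  move=> det1 ia id vc; have ic := val0_inv vc.
  have c0 : c != 0 by apply/eqP => c0; move: vc; rewrite c0 (val0 vP).
  have -> : mx2 a b c d = mx2 1 ((a - 1) / c) 0 1 *m (mx2 1 0 c 1 *m mx2 1 ((d - 1) / c) 0 1).
    have -> : b = (a * d - 1) / c by rewrite -det1 opprB addrC subrK mulfK.
    by rewrite !mx2M; congr mx2; field.
  have iB e : integers val e -> integers val (e - 1).
    by move=> ie; apply: (intD vP) => //; apply: (intN vP); apply: int1.
  have iq e : integers val e -> integers val ((e - 1) / c).
    by move=> ie; apply: (intM vP) => //; apply: iB.
  apply: (QM); first exact/Qu/iq.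
  apply: QM; last exact/Qu/iq.
  by apply: Ql; rewrite /integers /= vc.
move=> g; rewrite (mx2_eta g) det_mx2 => det1 ig.
have {ig} [ia ib ic id] : [/\ integers val (g 0 0), integers val (g 0 1),
    integers val (g 1 0) & integers val (g 1 1)].
  by have := ig; split; [have := ig 0 0|have := ig 0 1|have := ig 1 0|have := ig 1 1]; rewrite mxE.
move: (g 0 0) (g 0 1) (g 1 0) (g 1 1) det1 ia ib ic id => a b c d det1 ia ib ic id.
have [vc|vc] := eqVneq (val c) 0; first exact: unitc.
have pc : (0 < val c)%E by rewrite lt_def vc.
have va : val a = 0.
  apply/eqP; rewrite eq_le [X in _ && X]ia andbT leNgt; apply/negP => pa.
  have posM x y : (0 < val x)%E -> integers val y -> (0 < val (x * y)%R)%E.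
    by move=> px iy; rewrite (valM vP); apply: (lt_le_trans px); apply: leeDl.
  have := posD vP (posM _ _ pa id) (x := a * d) (y := - (c * b)).
  rewrite (valN vP) [c * b]mulrC det1 (val1 vP) ltxx => H; suff: false by [].
  by apply: H; rewrite mulrC; apply: posM.
have -> : mx2 a b c d = mx2 1 0 (-1) 1 *m mx2 a b (a + c) (b + d).
  by rewrite mx2M; congr mx2; ring.
apply: QM; first by apply: Ql; apply: (intN vP); apply: int1.
apply: unitc => //; first by rewrite -det1; ring.
  exact: (intD vP).
apply/eqP; rewrite eq_le [X in _ && X](intD vP ia ic) andbT leNgt; apply/negP => pac.
have := posD vP pac (y := - c); rewrite (valN vP) addrK va ltxx.
by move=> /(_ pc).
Qed.

End IntegralSL2.

(** * Lattices stable under exponentials *)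

Section ExponentialStability.
Context (RR : realType) (k : fieldType) (val : k -> \bar RR) (p : nat).
Hypotheses (vP : is_valuation val) (p_prime : prime p) (vp : (0 < val p%:R%R)%E).
Context (D : falgType k) (V : vectType D^c) (X : 'End(V)) (L : set V).
Hypothesis LB : forall u v, L u -> L v -> L (u - v).
Hypothesis LZ : forall a v, integers val a -> L v -> L (kscale a v).

Lemma int_exp a j : integers val a -> integers val (a ^+ j).
Proof.
by move=> ia; elim: j => [|j IH]; [exact: int1|rewrite exprS; apply: intM].
Qed.

Lemma int_fact_inv j : (j < p)%N -> integers val (j`!%:R^-1).
Proof.
elim: j => [|j IH] jp; first by rewrite invr1; apply: int1.
rewrite factS natrM invfM; apply: (intM vP); last by apply: IH; apply: ltnW.
exact: (int_inv vP p_prime vp).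
Qed.

Lemma stable_exp t v : (forall u, L u -> L (X u)) -> integers val t ->
  L v -> L (truncated_exp p t X v).
Proof.
move=> LX it Lv; have L0 : L 0 by rewrite -(subrr v); apply: LB.
rewrite /truncated_exp; elim/big_ind: _ => // [u w Lu Lw|j _].
  by rewrite -[w]opprK -[- w]sub0r; apply: (LB) => //; apply: LB.
apply: LZ; last by elim: (j : nat) => //= n; apply: LX.
by apply: (intM vP); [apply: int_exp|apply: int_fact_inv].
Qed.

(** The truncated exponential has degree at most p-1 in t, and the p points 0, ..., p-1 have
    differences invertible in R; interpolation in L then yields the coefficient of t. *)
Lemma exp_stable v : (forall t u, integers val t -> L u -> L (truncated_exp p t X u)) ->
  L v -> L (X v).
Proof.
move=> Le Lv; have p1 := prime_gt1 p_prime.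
pose f j : kmod V := j`!%:R^-1 *: (iter j X v : kmod V).
have p0 : (p.-1.+1 = p)%N by rewrite prednK // ltnW.
suff : L (f 1%N) by rewrite /f invr1 scale1r.
apply: (@interpolation k (kmod V) L LB p.-1 (fun i => i%:R)); last by lia.
- by move=> i u _; apply: LZ; apply: int_nat.
- move=> i j u ij; apply: LZ; rewrite -natrB; last by lia.
  by apply: (int_inv vP p_prime vp); lia.
- move=> i j ij; rewrite eq_sym -subr_eq0 -natrB; last by lia.
  by apply: (nat_nz vP p_prime vp); apply: (coprime_lt p_prime); lia.
- move=> i ip; rewrite p0; have := Le _ v (int_nat vP i) Lv.
  congr L; apply: eq_bigr => j _.
  by rewrite /f scalerA.
Qed.

End ExponentialStability.

(** * Fixed points of phi(SL_2(R)) and stability under the triple *)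

Section Triple.
Context (RR : realType) (k : fieldType) (val : k -> \bar RR) (p : nat).
Hypotheses (k_local : is_local_field val p) (p_odd : p != 2%N).
Context (D : falgType k) (nu : D -> \bar RR).
Hypotheses (D_division : is_division D) (nuP : is_valuation nu).
Hypothesis nu_val : forall a : k, nu a%:A = val a.
Context (V : vectType D^c) (Y H X : 'End(V)) (phi : 'M[k]_2 -> 'End(V)).
Hypothesis s : sl2_relations Y H X.
Hypothesis dimV : (dim V < p)%N.
Hypothesis phi_inv : forall g, \det g = 1 -> is_invertible (phi g).
Hypothesis phiM : forall g1 g2, \det g1 = 1 -> \det g2 = 1 ->
  phi (g1 *m g2) = (phi g1 \o phi g2)%VF.
Hypothesis phi_poly : exists P : seq ('M[nat]_2 * 'End(V)),
  (forall g, \det g = 1 -> forall v, phi g v = poly_eval P g v) /\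
  forall v, [/\ poly_diff P (delta_mx 1 0) v = Y v,
                poly_diff P (delta_mx 0 0 - delta_mx 1 1) v = H v
              & poly_diff P (delta_mx 0 1) v = X v].
Hypothesis phi_char : p \in [pchar k] -> forall t v,
  phi (1%:M + t *: delta_mx 0 1) v = truncated_exp p t X v /\
  phi (1%:M + t *: delta_mx 1 0) v = truncated_exp p t Y v.

Local Notation RD := (integers nu : set D^c).

Let vP : is_valuation val. Proof. by case: k_local. Qed.
Let p_prime : prime p. Proof. by case: k_local => _ _ _ _ []. Qed.
Let vp : (0 < val p%:R%R)%E. Proof. by case: k_local => _ _ _ _ []. Qed.

Lemma small_nat_nz j : (0 < j < p)%N -> j%:R != 0 :> k.
Proof. by move=> jp; apply: (nat_nz vP p_prime vp); apply: (coprime_lt p_prime). Qed.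

Lemma fact_nz_pchar j : p \notin [pchar k] -> j`!%:R != 0 :> k.
Proof.
rewrite inE p_prime /= => p0; suff nz n : (0 < n)%N -> n%:R != 0 :> k.
  by apply: nz; apply: fact_gt0.
move=> n0; rewrite -(partnC p n0) natrM mulf_neq0 //.
  by rewrite p_part natrX expf_neq0.
by apply: (nat_nz vP p_prime vp); rewrite coprime_sym prime_coprime // -p'natE ?part_pnat.
Qed.

(** The powers of an element of valuation 1. *)
Lemma infinite_sequence : exists a : nat -> k, injective a.
Proof.
have [_ /(_ 1%:E)[_ ex] _ _ _] := k_local.
have [|a a0 va] := ex; first by exists 1.
exists (fun n => a ^+ n).
have vX n : val (a ^+ n) = (n%:R)%:E.
  elim: n => [|n IH]; first by rewrite (val1 vP).
  by rewrite exprS (valM vP) IH va -EFinD -natr1 addrC.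
by move=> i j /(congr1 val); rewrite !vX => -[] /eqP; rewrite eqr_nat => /eqP.
Qed.

Lemma phi_one : phi 1%:M = \1%VF.
Proof.
have d1 : \det (1%:M : 'M[k]_2) = 1 by exact: det1.
have [g [gl gr]] := phi_inv d1.
have := phiM d1 d1; rewrite mulmx1 => /(congr1 (fun f => (g \o f)%VF)).
by rewrite comp_lfunA gr comp_lfun1l.
Qed.

Lemma upper_nilpotent_exp : (forall v, iter p.-1 X v = 0) /\
  forall t v, phi (mx2 1 t 0 1) v = truncated_exp p t X v.
Proof.
have [a a_inj] := infinite_sequence; have [P [phiP dP]] := phi_poly.
have detA t : \det (1%:M + t *: delta_mx 0 1 : 'M[k]_2) = 1.
  by rewrite upperE det_mx2; ring.
have mulA (t u : k) : (1%:M + t *: delta_mx 0 1) *m (1%:M + u *: delta_mx 0 1) =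
    1%:M + (t + u) *: delta_mx 0 1 :> 'M[k]_2.
  by rewrite !upperE mx2M; congr mx2; ring.
have dX v : poly_diff P (delta_mx 0 1) v = X v by case: (dP v).
have nX := dphi_nilpotent a_inj detA mulA phiM phi_one phiP dX.
have nXp v : iter p.-1 X v = 0.
  have nXd := nilpotent_dim D_division nX v.
  rewrite -(subnK (_ : dim V <= p.-1)%N); last by move: dimV; case: p.
  by rewrite iterD nXd; elim: (_ - _)%N => //= n ->; rewrite linear0.
(* In characteristic p the exponential formula is part of the hypothesis on phi; otherwise k has
   characteristic 0 and the formula is derived. *)
split=> // t v; rewrite -upperE; case: (boolP (p \in [pchar k])) => pk.
  by have [] := phi_char pk t v.
apply: (phi_exp a_inj detA mulA phiM phi_one phiP dX t v _ nXp) => j.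
exact: fact_nz_pchar.
Qed.

Lemma lower_nilpotent_exp : (forall v, iter p.-1 Y v = 0) /\
  forall t v, phi (mx2 1 0 t 1) v = truncated_exp p t Y v.
Proof.
have [a a_inj] := infinite_sequence; have [P [phiP dP]] := phi_poly.
have detA t : \det (1%:M + t *: delta_mx 1 0 : 'M[k]_2) = 1.
  by rewrite lowerE det_mx2; ring.
have mulA (t u : k) : (1%:M + t *: delta_mx 1 0) *m (1%:M + u *: delta_mx 1 0) =
    1%:M + (t + u) *: delta_mx 1 0 :> 'M[k]_2.
  by rewrite !lowerE mx2M; congr mx2; ring.
have dY v : poly_diff P (delta_mx 1 0) v = Y v by case: (dP v).
have nY := dphi_nilpotent a_inj detA mulA phiM phi_one phiP dY.
have nYp v : iter p.-1 Y v = 0.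
  have nYd := nilpotent_dim D_division nY v.
  rewrite -(subnK (_ : dim V <= p.-1)%N); last by move: dimV; case: p.
  by rewrite iterD nYd; elim: (_ - _)%N => //= n ->; rewrite linear0.
split=> // t v; rewrite -lowerE; case: (boolP (p \in [pchar k])) => pk.
  by have [] := phi_char pk t v.
apply: (phi_exp a_inj detA mulA phiM phi_one phiP dY t v _ nYp) => j.
exact: fact_nz_pchar.
Qed.

Lemma det_upper (t : k) : \det (mx2 1 t 0 1) = 1.
Proof. by rewrite det_mx2; ring. Qed.

Lemma det_lower (t : k) : \det (mx2 1 0 t 1) = 1.
Proof. by rewrite det_mx2; ring. Qed.

Section Fixed.
Variable z : RR -> set V.
Hypothesis zl : forall t, is_lattice RD setT (z t).

Let zB t u v : z t u -> z t v -> z t (u - v).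
Proof.
move=> zu zv; apply: (latD nuP (zl t)) => //.
have -> : - v = kscale (-1) v by exact: (esym (scaleN1r (v : kmod V))).
by apply: (lat_kZ nuP nu_val (zl t) _ zv); apply: (intN vP); apply: int1.
Qed.

Let zZ t a v : integers val a -> z t v -> z t (kscale a v).
Proof. exact: (lat_kZ nuP nu_val (zl t)). Qed.

Definition fixed_latfun :=
  forall g : 'M[k]_2, \det g = 1 -> (forall i j, integers val (g i j)) ->
    act_latfun (phi g) z = z.

Lemma act_phiM g1 g2 (z' : RR -> set V) : \det g1 = 1 -> \det g2 = 1 ->
  act_latfun (phi (g1 *m g2)) z' = act_latfun (phi g1) (act_latfun (phi g2) z').
Proof.
move=> d1 d2; apply/funext => t; rewrite /act_latfun phiM // image_comp.
by apply: eq_imagel => v _; rewrite comp_lfunE.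
Qed.

Lemma act_sub_eq g g' : \det g = 1 -> \det g' = 1 -> g *m g' = 1%:M ->
  (forall t v, z t v -> z t (phi g v) /\ z t (phi g' v)) ->
  act_latfun (phi g) z = z.
Proof.
move=> d1 d2 gg' sub; apply/funext => t; apply/seteqP; split=> v.
  by move=> [w zw <-]; case: (sub t w zw).
move=> zv; exists (phi g' v); first by case: (sub t v zv).
by rewrite -comp_lfunE -phiM // gg' phi_one id_lfunE.
Qed.

Lemma stab_fixed : stab Y X z -> fixed_latfun.
Proof.
move=> zs g dg ig.
pose Q (g : 'M[k]_2) := \det g = 1 /\ act_latfun (phi g) z = z.
suff [] : Q g by [].
apply: (sl2_generated vP (Q := Q)) => //.
- move=> t it; split; first exact: det_upper.
  apply: (act_sub_eq (g' := mx2 1 (- t) 0 1)); rewrite ?det_upper //.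
    by rewrite mx2M mx2_1; congr mx2; ring.
  move=> r v zv; have [_ ->] := upper_nilpotent_exp; have [_ ->] := upper_nilpotent_exp.
  by split; apply: (stable_exp vP p_prime vp (zB (t := r)) (zZ (t := r))) => //;
    try (by move=> u /zs[]); apply: (intN vP).
- move=> t it; split; first exact: det_lower.
  apply: (act_sub_eq (g' := mx2 1 0 (- t) 1)); rewrite ?det_lower //.
    by rewrite mx2M mx2_1; congr mx2; ring.
  move=> r v zv; have [_ ->] := lower_nilpotent_exp; have [_ ->] := lower_nilpotent_exp.
  by split; apply: (stable_exp vP p_prime vp (zB (t := r)) (zZ (t := r))) => //;
    try (by move=> u /zs[]); apply: (intN vP).
- move=> g1 g2 [d1 f1] [d2 f2]; split; first by rewrite det_mulmx d1 d2 mulr1.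
  by rewrite act_phiM // f2.
Qed.

Lemma fixed_stab :
  (forall t, integers val t -> act_latfun (phi (mx2 1 t 0 1)) z = z) ->
  (forall t, integers val t -> act_latfun (phi (mx2 1 0 t 1)) z = z) ->
  stab Y X z.
Proof.
move=> fu fl t v zv; split.
  apply: (exp_stable vP p_prime vp (zB (t := t)) (zZ (t := t))) zv => r u ir zu.
  by have [_ <-] := upper_nilpotent_exp; rewrite -(fu r ir); exists u.
apply: (exp_stable vP p_prime vp (zB (t := t)) (zZ (t := t))) zv => r u ir zu.
by have [_ <-] := lower_nilpotent_exp; rewrite -(fl r ir); exists u.
Qed.

Lemma stab_H : stab Y X z -> stabilizes H z.
Proof.
move=> zs t v zv; have [_ _ XY] := kfun_ops s.
have -> : H v = X (Y v) - Y (X v).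
  by have := XY v; rewrite /kfun => ->; rewrite addrC addKr.
have [zx zy] := zs t v zv.
by apply: zB; [have [] := zs t _ zy|have [] := zs t _ zx].
Qed.

End Fixed.

Lemma triple_stabE (z : RR -> set V) : (forall t, is_lattice RD setT (z t)) ->
  (stabilizes Y z /\ stabilizes H z /\ stabilizes X z) <-> stab Y X z.
Proof.
move=> zl; split=> [[zY [_ zX]] t v zv|zs]; first by split; [apply: zX|apply: zY].
split; first by move=> t v /zs[].
by split; [exact: stab_H|move=> t v /zs[]].
Qed.

Definition shift (c : RR) (z : RR -> set V) : RR -> set V := fun t => z (t + c).

(** The hypothesis on g says that it is the commutator of g2 and g1, written without inverses; the
    two translations commute, so they cancel. *)
Lemma commutator_fixed (z : RR -> set V) (g g1 g2 : 'M[k]_2) c1 c2 :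
  \det g = 1 -> \det g1 = 1 -> \det g2 = 1 -> g *m (g1 *m g2) = g2 *m g1 ->
  act_latfun (phi g1) z = shift c1 z -> act_latfun (phi g2) z = shift c2 z ->
  act_latfun (phi g) z = z.
Proof.
move=> d d1 d2 gg e1 e2.
have d12 : \det (g1 *m g2) = 1 by rewrite det_mulmx d1 d2 mulr1.
have e12 : act_latfun (phi (g1 *m g2)) z = shift c2 (shift c1 z).
  by rewrite act_phiM // e2 -e1.
have e21 : act_latfun (phi (g2 *m g1)) z = shift c1 (shift c2 z).
  by rewrite act_phiM // e1 -e2.
have e := e21; rewrite -gg act_phiM // e12 in e.
apply/funext => t.
have := congr1 (fun f => f (t - c1 - c2)) e.
rewrite /act_latfun /shift /=.
by rewrite !subrK addrAC !subrK.
Qed.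

(* Transvections are commutators, so the translations that they induce are
   trivial. *)
Lemma shifted_stab (z : RR -> set V) : (forall t, is_lattice RD setT (z t)) ->
  (3 < p)%N \/ (dim V <= 1)%N ->
  (forall g : 'M[k]_2, \det g = 1 -> (forall i j, integers val (g i j)) ->
     exists c, act_latfun (phi g) z = shift c z) ->
  stab Y X z.
Proof.
move=> zl [p3|dim1] sh; last first.
  (* A nilpotent endomorphism is 0 when dim V <= 1. *)
  have z0 t v (A : 'End(V)) : (forall w, iter p.-1 A w = 0) -> z t (A v).
    move=> nA; have := nilpotent_dim D_division nA v.
    have -> : A v = 0; last by move=> _; exact: (lat0 nuP (zl t)).
    have := nilpotent_dim D_division nA v.
    by move: dim1; case: (dim V) => [|[|//]] _ /=; [move=> ->; rewrite linear0|].
  have [nX _] := upper_nilpotent_exp; have [nY _] := lower_nilpotent_exp.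
  by move=> t v _; split; apply: z0.
have n2 : (2%:R : k) != 0 by apply: small_nat_nz; lia.
have n3 : (3%:R : k) != 0 by apply: small_nat_nz.
have i2 : integers val (2%:R^-1) by apply: (int_inv vP p_prime vp); lia.
have i3 : integers val (3%:R^-1) by apply: (int_inv vP p_prime vp).
have int_mx2 a b c d : integers val a -> integers val b -> integers val c ->
    integers val d -> forall i j, integers val (mx2 a b c d i j).
  by move=> ? ? ? ? i j; rewrite mxE; case: ifP => _; case: ifP.
have i0 := int0 vP; have i1 := int1 vP.
(* Conjugation by diag(2, 1/2) multiplies the parameter of an upper transvection by 4 and that of a
   lower one by 1/4. The commutator thus multiplies it by 3, respectively by -3/4, whence the
   parameters t/3 and -4t/3 below; they are integral since p > 3. *)
pose g2 : 'M[k]_2 := mx2 2%:R 0 0 2%:R^-1.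
have d2 : \det g2 = 1 by rewrite det_mx2; field.
have [c2 e2] : exists c, act_latfun (phi g2) z = shift c z.
  by apply: sh => //; apply: int_mx2 => //; apply: (int_nat vP 2).
apply: fixed_stab => // t it.
  have [|c1 e1] := sh (mx2 1 (t / 3%:R) 0 1) (det_upper _).
    by apply: int_mx2 => //; apply: (intM vP).
  apply: (commutator_fixed (det_upper _) (det_upper _) d2 _ e1 e2).
  by rewrite !mx2M; congr mx2; field; rewrite ?n2 ?n3.
have [|c1 e1] := sh (mx2 1 0 (- (4%:R * t / 3%:R)) 1) (det_lower _).
  apply: int_mx2 => //; apply: (intN vP); apply: (intM vP) => //.
  by apply: (intM vP) => //; apply: (int_nat vP 4).
apply: (commutator_fixed (det_lower _) (det_lower _) d2 _ e1 e2).
by rewrite !mx2M; congr mx2; field; rewrite ?n2 ?n3.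
Qed.

(** Both sides are polynomials in t that agree on the infinite field k; the coefficients of t are
    compared. *)
Lemma exp_commute (g A : 'End(V)) :
  (forall t v, g (truncated_exp p t A v) = truncated_exp p t A (g v)) ->
  forall v, g (A v) = A (g v).
Proof.
move=> gA v; have [a a_inj] := infinite_sequence.
pose f j : kmod V := j`!%:R^-1 *:
  (kfun g (iter j A v) - (iter j A (g v) : kmod V)).
have f0 t : \sum_(j < p) t ^+ j *: f j = 0.
  have e : kfun g (\sum_(j < p) (t ^+ j / j`!%:R) *: (iter j A v : kmod V)) =
      \sum_(j < p) (t ^+ j / j`!%:R) *: (iter j A (g v) : kmod V) := gA t v.
  rewrite -[RHS](subrr (\sum_(j < p) (t ^+ j / j`!%:R) *: (iter j A (g v) : kmod V))).
  rewrite -{1}e linear_sum -sumrB; apply: eq_bigr => j _.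
  by rewrite /f scalerA scalerBr; congr (_ - _); rewrite [RHS]linearZ.
have := poly_vanish a_inj f0 (prime_gt1 p_prime).
by rewrite /f invr1 scale1r => /eqP; rewrite subr_eq0 => /eqP.
Qed.

Lemma centralizer_commute (g : 'End(V)) :
  (forall g', \det g' = 1 -> (g \o phi g')%VF = (phi g' \o g)%VF) ->
  [/\ forall v, g (Y v) = Y (g v), forall v, g (H v) = H (g v)
    & forall v, g (X v) = X (g v)].
Proof.
move=> gphi.
have gY : forall v, g (Y v) = Y (g v).
  apply: exp_commute => t v; have [_ e] := lower_nilpotent_exp.
  by rewrite -!e -!comp_lfunE gphi ?det_lower.
have gX : forall v, g (X v) = X (g v).
  apply: exp_commute => t v; have [_ e] := upper_nilpotent_exp.
  by rewrite -!e -!comp_lfunE gphi ?det_upper.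
split=> // v; have [_ _ XY] := kfun_ops s.
have HE w : H w = X (Y w) - Y (X w).
  by have := XY w; rewrite /kfun => ->; rewrite addrC addKr.
by rewrite !HE linearB /= gX gY gY gX.
Qed.

Section Correspondence.
Context (I : finType) (Us : I -> vectType k) (y h x : forall i, 'End(Us i)).
Hypothesis irrs : is_irr_system Y H X y h x.

Local Notation M := (fun i => sl2_hom Y H X (y i) (h i) (x i)).

(** The part common to the three kinds of groups: the lattices L_i do not depend on the group, and a
    form F enters only in the last clause, which matches self-duality on both sides. *)
Lemma lattice_correspondence : exists u0 : forall i, Us i,
  let L := @std_lattice RR k val I Us y u0 in
  [/\ forall i, is_stable_lattice val (y i) (h i) (x i) (L i),
      forall z, sl2_latfun nu Y X z -> forall i, is_latfun nu (M i) (@restrict_family _ _ _ _ _ _ M L z i),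
      forall z : mult_family RR V Us, (forall i, is_latfun nu (M i) (z i)) ->
        exists2 z', sl2_latfun nu Y X z' & restrict_family M L z' = z,
      forall z z', sl2_latfun nu Y X z -> sl2_latfun nu Y X z' ->
        restrict_family M L z = restrict_family M L z' -> z = z'
    & forall sigma eps F, is_involution sigma -> fixed_center sigma ->
        eps = 1 \/ eps = -1 -> is_hermitian sigma eps setT F ->
        (forall A, A \in [:: X; Y; H] -> forall v w, F (A v) w + F v (A w) = 0) ->
        are_mult_forms M y h x (@gamma k D V Y I Us u0 F) (U sigma eps F) /\
        forall z, sl2_latfun nu Y X z -> z = dual_latfun nu F setT z <->
          forall i, @restrict_family _ _ _ _ _ _ M L z i =
            dual_latfun nu (@gamma k D V Y I Us u0 F i) (M i)
              (@restrict_family _ _ _ _ _ _ M L z i)].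
Proof.
have [nX _] := upper_nilpotent_exp; have [nY _] := lower_nilpotent_exp.
have nz := small_nat_nz.
have ex i := irr_system_hw nz nX nY irrs i.
pose u0 i := sval (cid (ex i)); have u0P i := svalP (cid (ex i)).
have invP n : (0 < n < p)%N -> integers val n%:R^-1.
  by move=> np; apply: (int_inv vP p_prime vp).
have [c [ch cE cL cU]] := frame_exists nz s nX nY irrs.
have res_latfun z : sl2_latfun nu Y X z ->
    forall i, is_latfun nu (M i) (@restrict_family _ _ _ _ _ _ M (@std_lattice RR k val I Us y u0) z i).
  move=> gz i; exact: (restrict_latfun nz s nX nY vP nuP nu_val invP D_division irrs
    u0P ch cE cL cU i gz).
have gr z : sl2_latfun nu Y X z ->
    glue Y y u0 c (restrict_family M (@std_lattice RR k val I Us y u0) z) = z.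
  exact: (glue_restrict nz s nX nY vP nuP nu_val invP irrs u0P ch cE cL).
exists u0; split=> //.
- by move=> i; apply: (std_lattice_stable nz nX nY vP irrs u0P).
- move=> z zP; exists (glue Y y u0 c z).
    exact: (glue_latfun nz s nX nY vP nuP nu_val D_division irrs u0P ch cE cU zP).
  exact: (restrict_glue nz s nX nY vP nuP nu_val D_division irrs u0P ch cE cU zP).
- by move=> z z' gz gz' e; rewrite -(gr z gz) -(gr z' gz') e.
move=> sigma eps F sigP fixP epsP FP skew; split.
  move=> i; split; last exact: (gamma_mult nz s nX nY irrs u0P sigP fixP FP skew).
  exists ((-1) ^+ hwt Us i * eps); split; first exact: gamma_eps.
  exact: (gamma_hermitian nz s nX nY irrs u0P ch cE sigP fixP FP skew).
move=> z gz; have zP := res_latfun z gz.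
have := selfdual_glue nz s nX nY nuP irrs u0P ch cE cU sigP fixP FP skew zP.
by rewrite gr.
Qed.

End Correspondence.
End Triple.

(** * Equivariance, the bound on p, and the three kinds of groups *)

Lemma restrict_act (RR : realType) (k : fieldType) (D : falgType k) (V : vectType D^c)
  (I : finType) (Us : I -> vectType k) (M : forall i, set (Us i -> V))
  (L : forall i, set (Us i)) (g g' : 'End(V)) (z : RR -> set V) :
  (forall v, g (g' v) = v) -> (forall v, g' (g v) = v) ->
  (forall i f, M i f -> M i (g \o f)%FUN /\ M i (g' \o f)%FUN) ->
  restrict_family M L (act_latfun g z) = mult_act_family g (restrict_family M L z).
Proof.
move=> gg' g'g MP; apply: functional_extensionality_dep => i.
apply/funext => t; apply/seteqP; split=> f /=.
  (* The inverse of g provides the preimage; this is why M is required to be stable under both g and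
     g'. *)
  move=> [fM fL]; exists (g' \o f)%FUN; last by apply/funext => u /=; rewrite gg'.
  split; first by case: (MP i f fM).
  by move=> u /fL[v zv] /= <-; rewrite g'g.
move=> [f' [fM fL] <-]; split; first by case: (MP i f' fM).
by move=> u /fL zu; exists (f' u).
Qed.

(** If the absolute root system is empty then N = d dim V is at most 1, or at most 2 in the
    orthogonal case, and p > 2 is enough. Otherwise h >= 2, so p > 3, and 3(h-1) < p bounds N. In
    particular p = 3 leaves only dim V <= 1 for GL and SL. *)
Lemma dim_lt_char (k : fieldType) (D : falgType k) (V : vectType D^c)
  (G : group_kind V) (p d : nat) :
  prime p -> p != 2%N -> \dim {:D} = (d ^ 2 * \dim 'Z({:D})%VS)%N ->
  (3 * (max_coxeter d G - 1) < p)%N ->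
  (dim V < p)%N /\ (if G is U _ _ _ then true else (3 < p) || (dim V <= 1))%N.
Proof.
move=> p_prime p2 d_degree.
have d0 : (0 < d)%N.
  case: d d_degree => // d0; have := oner_neq0 D.
  have : (1 : D) \in {:D}%VS by rewrite memvf.
  by move/eqP: d0; rewrite mul0n dimv_eq0 => /eqP ->; rewrite memv0 => ->.
have pg2 : (2 < p)%N by rewrite ltn_neqAle eq_sym p2 prime_gt1.
have hN N : (odd N + 2 * N./2 = N)%N by rewrite mul2n odd_double_half.
have nN : (dim V <= d * dim V)%N by rewrite leq_pmull.
rewrite /max_coxeter; case: G => [||sigma eps F] /=; set N := (d * dim V)%N in nN *;
  rewrite /linear_type /orthogonal_type /symplectic_type.
- by case: ifP => N1; rewrite ?big_cons ?big_nil /= -?mul2n; move: N1 nN pg2 (hN N); lia.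
- by case: ifP => N1; rewrite ?big_cons ?big_nil /= -?mul2n; move: N1 nN pg2 (hN N); lia.
case: ifP => _; [|case: ifP => _].
- by case: ifP => N1; rewrite ?big_cons ?big_nil /= -?mul2n; move: N1 nN pg2 (hN N); lia.
- case: ifP => N2; first by rewrite big_nil; move: N2 nN pg2; lia.
  case: ifP => oN; have := hN N; rewrite oN /= => {}hN.
    by rewrite big_cons big_nil /= -mul2n; move: N2 nN pg2 hN; lia.
  (* For N = 4 the type is A_1 x A_1 with h = 2, and the bound gives only p > 3; that p is prime
     excludes p = N. *)
  have p4 : p != 4%N by apply: contraTneq p_prime => ->.
  by case: eqP => N4 /=; rewrite ?big_cons ?big_nil /= -?mul2n; move: N2 N4 nN pg2 hN p4; lia.
- by case: ifP => N1; rewrite ?big_cons ?big_nil /= -?mul2n; move: N1 nN pg2 (hN N); lia.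
Qed.

Lemma latfun_shift (RR : realType) (k : fieldType) (D : falgType k)
  (nu : D -> \bar RR) (W : lmodType D^c) (M : set W) (z : RR -> set W) (c : RR) :
  is_latfun nu M z -> is_latfun nu M (fun t => z (t + c)).
Proof.
move=> [zl zd zc zp]; split=> [t|t t' tt'|t|w r t wu wr].
- exact: zl.
- by apply: zd; rewrite lerD2r.
- rewrite zc; apply/seteqP; split=> v zv t' /= tt'.
    by apply: zv; rewrite /= ltrD2r.
  by have := zv (t' - c); rewrite /= subrK; apply; rewrite ltrBlDr.
- by rewrite addrAC; apply: zp.
Qed.

Theorem mainTheorem2 (RR : realType)
    (k : fieldType) (val : k -> \bar RR) (p : nat)
    (k_local : is_local_field val p) (p_odd : p != 2%N)
    (D : falgType k) (D_division : is_division D)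
    (nu : D -> \bar RR) (nu_val : is_valuation nu)
    (nu_extends : forall a : k, nu a%:A = val a)
    (d : nat) (d_degree : \dim {:D} = (d ^ 2 * \dim 'Z({:D})%VS)%N)
    (V : vectType D^c) (G : group_kind V) (G_adm : admissible G)
    (p_large : (3 * (max_coxeter d G - 1) < p)%N)
    (Y H X : 'End(V)) (triple : is_lie_triple d G Y H X)
    (phi : 'M[k]_2 -> 'End(V))
    (phi_triple : is_corresponding_hom d p G Y H X phi) :
  triple_building nu d G Y H X = fixed_points val nu G phi /\
  forall (I : finType) (Us : I -> vectType k) (y h x : forall i, 'End(Us i)),
    is_irr_system Y H X y h x ->
    let M i := sl2_hom Y H X (y i) (h i) (x i) in
    exists (L : forall i, set (Us i))
           (gamma : forall i, (Us i -> V) -> (Us i -> V) -> D),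
      [/\ forall i, is_stable_lattice val (y i) (h i) (x i) (L i),
          are_mult_forms M y h x gamma G
        & equivariant_bijection (centralizer_set d G phi)
            (act G) (mult_act G)
            (fixed_points val nu G phi) (mult_building nu M gamma G)
            (restrict_point M L G)].
Proof.
have [_ _ _ _ [p_prime _]] := k_local.
have [dimV p3] := dim_lt_char p_prime p_odd d_degree p_large.
have [[lieY [lieH lieX]] _ s] := triple.
have [phiG phiM phi_poly phi_char] := phi_triple.
have phi_inv g : \det g = 1 -> is_invertible (phi g).
  by move=> /phiG; case: (G) => [//||sigma eps F] [].
pose fixed z := @fixed_latfun RR k val D V phi z.
have to_fixed z : (forall t, is_lattice (integers nu : set D^c) setT (z t)) ->
    stab Y X z -> fixed z.
  exact: (stab_fixed k_local D_division nu_val nu_extends dimV phi_inv phiM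
    phi_poly phi_char).
have of_fixed z : (forall t, is_lattice (integers nu : set D^c) setT (z t)) ->
    fixed z -> stab Y X z.
  move=> zl fz.
  have intm a b c e : integers val a -> integers val b -> integers val c ->
      integers val e -> forall i j, integers val (mx2 a b c e i j).
    by move=> ? ? ? ? i j; rewrite mxE; case: ifP => _; case: ifP.
  have vP : is_valuation val by case: k_local.
  have i0 := int0 vP; have i1 := int1 vP.
  apply: (fixed_stab k_local D_division nu_val nu_extends dimV phi_inv phiM
    phi_poly phi_char zl) => t it; apply: fz; rewrite ?det_upper ?det_lower //;
    exact: intm.
have tripleE (z : RR -> set V) : (forall t, is_lattice (integers nu : set D^c) setT (z t)) ->
    (stabilizes Y z /\ stabilizes H z /\ stabilizes X z) <-> stab Y X z.
  by move=> zl; refine (triple_stabE k_local nu_val nu_extends s zl).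
have commute g : centralizer_set d G phi g ->
  exists g' : 'End(V), [/\ forall v, g (g' v) = v, forall v, g' (g v) = v
    & [/\ forall v, g (Y v) = Y (g v), forall v, g (H v) = H (g v)
    & forall v, g (X v) = X (g v)]].
  move=> [gG gphi]; have : is_invertible g by move: gG; case: (G) => [//||sigma eps F] [].
  move=> [g' [gg' g'g]]; exists g'; split.
  - by move=> v; rewrite -comp_lfunE gg' id_lfunE.
  - by move=> v; rewrite -comp_lfunE g'g id_lfunE.
  - exact: (centralizer_commute k_local D_division s dimV phi_inv phiM
      phi_poly phi_char gphi).
have equiv (I : finType) (Us : I -> vectType k) (y h x : forall i, 'End(Us i))
    (L : forall i, set (Us i)) (g : 'End(V)) (z : RR -> set V) :
    centralizer_set d G phi g ->
    restrict_family (fun i => sl2_hom Y H X (y i) (h i) (x i)) L (act_latfun g z) =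
    mult_act_family g (restrict_family (fun i => sl2_hom Y H X (y i) (h i) (x i)) L z).
  move=> /commute[g' [gg' g'g [gY gH gX]]]; apply: (restrict_act _ _ gg' g'g).
  have g'c (A : 'End(V)) : (forall v, g (A v) = A (g v)) -> forall v, g' (A v) = A (g' v).
    by move=> gA v; rewrite -{1}(gg' v) -gA g'g.
  have comp i (f : Us i -> V) (g1 : 'End(V)) : (forall v, g1 (Y v) = Y (g1 v)) ->
      (forall v, g1 (H v) = H (g1 v)) -> (forall v, g1 (X v) = X (g1 v)) ->
      sl2_hom Y H X (y i) (h i) (x i) f -> sl2_hom Y H X (y i) (h i) (x i) (g1 \o f)%FUN.
    move=> cY cH cX [fD fZ fP]; split=> [u1 u2|a u|u] /=.
    - by rewrite fD linearD.
    - by rewrite fZ /kscale /rscale linearZ.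
    - by have [-> -> ->] := fP u.
  by move=> i f fM; split; apply: comp => //; apply: g'c.
have inY : [set Y; H; X] Y by left; left.
have inH : [set Y; H; X] H by left; right.
have inX : [set Y; H; X] X by right.
have fixedE : triple_building nu d G Y H X = fixed_points val nu G phi.
  clear equiv commute; case: G G_adm p_large triple phi_triple p3 lieY lieH lieX phiG => [||sigma eps F] /= _ _ _ _ p3 lieY lieH lieX phiG.
  - apply/seteqP; split=> z [zB zf]; split=> //; have [zl _ _ _] := zB.
      apply: (to_fixed z zl); apply/(tripleE z zl).
      have [_ zY] := zf _ inY; have [_ zH] := zf _ inH; have [_ zX] := zf _ inX.
      by split; [|split].
    have /tripleE[//|zY [zH zX]] := of_fixed _ zl zf.
    by move=> _ [[->|->]|->]; split.
  - apply/seteqP; split=> w [[z zB <-] zf]; split; try by exists z.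
      have zl t : is_lattice (integers nu : set D^c) setT (z t) by case: zB.
      have zz : translates z z by exists 0 => //; apply/funext => t; rewrite addr0.
      have zs : fixed z.
        apply: (to_fixed z zl); apply/(tripleE z zl).
        have [_ /(_ _ zz) zY] := zf _ inY; have [_ /(_ _ zz) zH] := zf _ inH.
        by have [_ /(_ _ zz) zX] := zf _ inX; split; [|split].
      (* As phi g fixes every lattice of z, it fixes each translate of z. *)
      move=> g dg ig; apply/seteqP; split=> w'.
        move=> [_ [c _ <-] <-]; exists c => //; apply/funext => t.
        by rewrite -[in LHS](zs g dg ig).
      move=> [c _ <-]; exists (fun t => z (t + c)); first by exists c.
      by apply/funext => t; rewrite -[in RHS](zs g dg ig).
    have zl t : is_lattice (integers nu : set D^c) setT (z t) by case: zB.
    have zs : stab Y X z.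
      apply: (shifted_stab k_local p_odd D_division nu_val nu_extends dimV phi_inv phiM
        phi_poly phi_char zl) => [|g dg ig].
        by case/orP: p3; [left|right].
      (* The image of z belongs to the fixed class, so it is a translate of z. *)
      have : (@act RR k D V SL (phi g) (translates z) : set _) (act_latfun (phi g) z).
        by exists z => //; exists 0 => //; apply/funext => t; rewrite addr0.
      by rewrite (zf g dg ig) => -[c _ <-]; exists c.
    have /tripleE[//|zY [zH zX]] := zs.
    have sh A : stabilizes A z -> forall l, translates z l -> stabilizes A l.
      by move=> zA _ [c _ <-] t v; apply: zA.
    by move=> _ [[->|->]|->]; split=> //; apply: sh.
  - apply/seteqP; split=> z [zB zf]; split=> //; have [[zl _ _ _] _] := zB.
      apply: (to_fixed z zl); apply/(tripleE z zl).
      have [_ zY] := zf _ inY; have [_ zH] := zf _ inH; have [_ zX] := zf _ inX.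
      by split; [|split].
    have /tripleE[//|zY [zH zX]] := of_fixed _ zl zf.
    by move=> _ [[->|->]|->]; split.
split=> // I Us y h x irrs M.
have [u0 /= [Lst res_lat res_surj res_inj resU]] :=
  lattice_correspondence k_local D_division nu_val nu_extends s dimV phi_inv phiM
    phi_poly phi_char irrs.
rewrite -fixedE; set L := @std_lattice RR k val I Us y u0 in Lst res_lat res_surj res_inj resU *.
pose res (z : RR -> set V) := restrict_family M L z.
have sl2_latfunE (z : RR -> set V) : is_latfun nu setT z ->
    (stabilizes Y z /\ stabilizes H z /\ stabilizes X z) <-> sl2_latfun nu Y X z.
  move=> zB; have zl t : is_lattice (integers nu : set D^c) setT (z t) by case: zB.
  by split=> [/(tripleE z zl)//|[_ zs]]; apply/(tripleE z zl).
exists L.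
clear fixedE; case: G G_adm p_large triple phi_triple p3 lieY lieH lieX phiG commute equiv
  => [||sigma eps F] G_adm p_large triple phi_triple p3 lieY lieH lieX phiG commute equiv.
(* Without a form on V there is no condition on [gamma]; 0 is a placeholder. *)
- exists (fun i f g => 0); split=> //; split; last first.
    by move=> g z /equiv cg _; apply: cg.
  have tg z : triple_building nu d GL Y H X z <-> sl2_latfun nu Y X z.
    split=> [[zB zf]|gz].
      have [_ zY] := zf _ inY; have [_ zH] := zf _ inH; have [_ zX] := zf _ inX.
      by apply/(sl2_latfunE z zB).
    have zB : is_latfun nu setT z by case: gz.
    have /(sl2_latfunE z zB)[zY [zH zX]] := gz.
    by split=> // _ [[->|->]|->]; split.
  split.
  - by move=> z /tg gz i; apply: res_lat.
  - by move=> z z' /set_mem/tg gz /set_mem/tg gz'; apply: res_inj.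
  - by move=> w /res_surj[z gz <-]; exists z => //; apply/tg.
- exists (fun i f g => 0).
  have shift_latfun (c : RR) (z : RR -> set V) : sl2_latfun nu Y X z -> sl2_latfun nu Y X (fun t => z (t + c)).
    by move=> [zB zs]; split; [exact: latfun_shift|move=> t; apply: zs].
  have tr_refl (z : RR -> set V) : translates z z.
    by exists 0 => //; apply/funext => t; rewrite addr0.
  have tg w : triple_building nu d SL Y H X w <-> exists2 z, sl2_latfun nu Y X z & translates z = w.
    split=> [[[z zB <-] zf]|[z gz <-]].
      have [_ /(_ _ (tr_refl z)) zY] := zf _ inY.
      have [_ /(_ _ (tr_refl z)) zH] := zf _ inH.
      have [_ /(_ _ (tr_refl z)) zX] := zf _ inX.
      by exists z => //; apply/(sl2_latfunE z zB).
    split; first by exists z => //; case: gz.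
    have st (l : RR -> set V) : translates z l -> stabilizes Y l /\ stabilizes H l /\ stabilizes X l.
      move=> [c _ <-]; have gc := shift_latfun c z gz.
      by apply/(sl2_latfunE _ _) => //; case: gc.
    by move=> _ [[->|->]|->]; split=> // l /st[? []].
  have resE (z : RR -> set V) : [set res l | l in translates z] = mult_translates (res z).
    apply/seteqP; split=> w.
      by move=> [_ [c _ <-] <-]; exists c.
    by move=> [c _ <-]; exists (fun t => z (t + c)) => //; exists c.
  split=> //; split; last first.
    move=> g w cg _; apply/seteqP; split=> l.
      move=> [_ [z wz <-] <-]; exists (res z); first by exists z.
      by rewrite [RHS]equiv.
    move=> [_ [z wz <-] <-]; exists (act_latfun g z); first by exists z.
    by rewrite [LHS]equiv.
  split.
  - move=> w /tg[z gz <-]; exists (res z); last by rewrite -resE.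
    by move=> i; apply: res_lat.
  - move=> w w' /set_mem/tg[z gz <-] /set_mem/tg[z' gz' <-].
    rewrite /restrict_point !resE => e.
    (* Equality of the two classes yields one real c by which all the components are shifted
       simultaneously; restriction commutes with shifts, so z is the translate of z' by c. *)
    have : mult_translates (res z) (res z).
      exists 0 => //; apply: functional_extensionality_dep => i.
      by apply/funext => t; rewrite addr0.
    rewrite e => -[c _ ec].
    have -> : z = (fun t => z' (t + c)) by apply: res_inj => //; exact: shift_latfun.
    apply/seteqP; split=> _ [b _ <-].
      by exists (b + c) => //; apply/funext => t; rewrite addrA.
    by exists (b - c) => //; apply/funext => t; rewrite -addrA subrK.
  - move=> w [zz /res_surj[z gz zzE] <-]; exists (translates z); first by apply/tg; exists z.
    by rewrite /restrict_point [LHS]resE /res zzE.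
- exists (@gamma k D V Y I Us u0 F).
  have [sigP fixP epsP FP] := G_adm.
  have skew A : A \in [:: X; Y; H] -> forall v w, F (A v) w + F v (A w) = 0.
    by rewrite !inE => /or3P[] /eqP ->.
  have [forms dualE] := resU sigma eps F sigP fixP epsP FP skew.
  split=> //; split; last first.
    by move=> g z /equiv cg _; apply: cg.
  have tg z : triple_building nu d (U sigma eps F) Y H X z <->
      sl2_latfun nu Y X z /\ z = dual_latfun nu F setT z.
    split=> [[[zB zd] zf]|[gz zd]].
      have [_ zY] := zf _ inY; have [_ zH] := zf _ inH; have [_ zX] := zf _ inX.
      by split=> //; apply/(sl2_latfunE z zB).
    have zB : is_latfun nu setT z by case: gz.
    have /(sl2_latfunE z zB)[zY [zH zX]] := gz.
    by split=> // _ [[->|->]|->]; split.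
  split.
  - move=> z /tg[gz zd] i; split; first exact: res_lat.
    exact: ((dualE z gz).1 zd i).
  - by move=> z z' /set_mem/tg[gz _] /set_mem/tg[gz' _]; apply: res_inj.
  - move=> w wB; have [|z gz zw] := res_surj w; first by move=> i; case: (wB i).
    exists z => //; apply/tg; split=> //; apply/(dualE z gz) => i.
    by have [_] := wB i; rewrite -zw.
Qed.
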